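(* Let $h:S^7\to S^4$ be the Hopf fibration $h(u,v)=(2u\bar v,\,|u|^2-|v|^2)$, where $S^7$ is the unit sphere in $\mathbf{H}\times\mathbf{H}$ and $S^4$ is the unit sphere in $\mathbf{H}\times\mathbf{R}$. Let $M$ be a non-isoparametric compact, connected proper Dupin hypersurface embedded in $S^4$ with $g$ distinct principal curvatures, where $g=2$ or $3$. Then $h^{-1}(M)$ is a compact, connected proper Dupin hypersurface in $S^7$ with $2g$ distinct principal curvatures that does not have constant Lie curvatures. Therefore, it is not Lie equivalent to an isoparametric hypersurface in $S^7$.
   Context: $\mathbf{H}$ denotes the quaternions and $\bar v$ the quaternionic conjugate of $v$. For an oriented hypersurface $f:M\to S^n$ with unit normal field $\xi$, the shape operator $A$ is defined by $df(AX)=-d\xi(X)$, and its eigenvalues are the principal curvatures. A curvature surface of $M$ is a smooth connected submanifold $S\subset M$ such that for every $x\in S$ the space $T_xS$ is an eigenspace of the shape operator at $x$. $M$ is Dupin if along each curvature surface the corresponding principal curvature is constant, and proper Dupin if in addition the number of distinct principal curvatures is constant on $M$. $M$ is isoparametric if its principal curvatures are constant. Lie curvatures: for distinct $a,b,c,d\in\mathbf{R}\cup\{\infty\}$ put $[a,b;c,d]=\frac{(a-b)(d-c)}{(a-c)(d-b)}$ (usual conventions with $\infty$). If $\kappa_1,\ldots,\kappa_k$, $k\ge4$, are the distinct principal curvature functions of a proper Dupin hypersurface (smooth functions, e.g. in increasing order), the Lie curvatures are the functions $[\kappa_{i_1},\kappa_{i_2};\kappa_{i_3},\kappa_{i_4}]$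 for distinct indices $i_1,i_2,i_3,i_4$. ''Does not have constant Lie curvatures'' means that at least one of these functions is not constant. Lie equivalence: let $\langle x,y\rangle=-x_1y_1+x_2y_2+\cdots+x_{n+2}y_{n+2}-x_{n+3}y_{n+3}$ on $\mathbf{R}^{n+3}$, and let $Q^{n+1}\subset\mathbf{P}^{n+2}$ be the quadric $\langle x,x\rangle=0$. A Lie sphere transformation is a projective transformation of $\mathbf{P}^{n+2}$ mapping $Q^{n+1}$ to itself; it induces a map of the manifold $\Lambda^{2n-1}$ of projective lines contained in $Q^{n+1}$. The Legendre lift of an oriented hypersurface $f:M^{n-1}\to S^n$ with unit normal field $\xi$ is the map $\lambda:M^{n-1}\to\Lambda^{2n-1}$ sending $x$ to the line through $[(1,f(x),0)]$ and $[(0,\xi(x),1)]$. Two hypersurfaces in $S^n$ are Lie equivalent if a Lie sphere transformation carries the Legendre lift of one to the Legendre lift of the other (as usual, up to a diffeomorphism of the domain). *)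

(* Defs.v *)
From HB Require Import structures.
From mathcomp Require Import all_boot all_order all_algebra.
From mathcomp Require Import all_classical all_reals all_analysis.
Import Order.TTheory GRing.Theory Num.Theory.
Import numFieldNormedType.Exports.

Set Implicit Arguments.
Unset Strict Implicit.
Unset Printing Implicit Defensive.

Local Open Scope classical_set_scope.
Local Open Scope ring_scope.

(* Every manifold is represented as a submanifold D of some Euclidean space
   'rV_N (no loss, by Whitney's theorem), and maps on D are given by total
   functions of which only the values on D matter.  The library norm on 'rV_N
   is the sup norm; it is only used through the topology and the derivative,
   and Euclidean lengths are expressed with [dot]. *)

Definition dot (R : realType) (n : nat) (x y : 'rV[R]_n) : R :=
  \sum_(i < n) x 0 i * y 0 i.

(* [sphere R n] is S^n in R^(n+1) *)
Definition sphere (R : realType) (n : nat) : set 'rV[R]_n.+1 :=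
  [set x : 'rV[R]_n.+1 | dot x x = 1].
Arguments sphere : clear implicits.

Fixpoint Ck (R : realType) (V W : normedModType R) (k : nat)
    (U : set V) (F : V -> W) : Prop :=
  if k is k'.+1 then
    (forall x, U x -> differentiable F x) /\
    (forall v, Ck k' U (fun x => 'D_v F x))
  else forall x, U x -> {for x, continuous F}.

Definition smooth_on (R : realType) (V W : normedModType R)
    (U : set V) (F : V -> W) : Prop :=
  forall k, Ck k U F.

Definition local_extension (R : realType) (V W : normedModType R)
    (D : set V) (f : V -> W) (x : V) : set (V -> W) :=
  [set F | exists U, [/\ open U, U x, smooth_on U F &
                         forall y, D y -> U y -> F y = f y]].

Definition smooth_map (R : realType) (V W : normedModType R)
    (D : set V) (f : V -> W) : Prop :=
  forall x, D x -> local_extension D f x !=set0.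

Definition diffeomorphism (R : realType) (V W : normedModType R)
    (A : set V) (B : set W) (phi : V -> W) : Prop :=
  smooth_map A phi /\
  exists psi : W -> V,
    [/\ smooth_map B psi,
        forall x, A x -> B (phi x) /\ psi (phi x) = x &
        forall y, B y -> A (psi y) /\ phi (psi y) = y].

Definition submanifold (R : realType) (N d : nat) (D : set 'rV[R]_N) : Prop :=
  forall x, D x ->
    exists (W : set 'rV[R]_N) (Omega : set 'rV[R]_d) (phi : 'rV[R]_d -> 'rV[R]_N),
      [/\ open W, W x, open Omega & diffeomorphism Omega (D `&` W) phi].

(* velocities at x of smooth curves in D *)
Definition tangent (R : realType) (N : nat) (D : set 'rV[R]_N) (x : 'rV[R]_N) :
    set 'rV[R]_N :=
  [set v | exists (e : R) (gamma : R -> 'rV[R]_N),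
     [/\ 0 < e, smooth_on (ball (0 : R) e) gamma,
         forall t, ball (0 : R) e t -> D (gamma t),
         gamma 0 = x & derive1 gamma 0 = v]].

(* df_x on the tangent space of D at x, computed with an arbitrary smooth
   extension of f near x; meaningful for f smooth on D and v tangent to D. *)
Definition tdiff (R : realType) (N m : nat) (D : set 'rV[R]_N)
    (f : 'rV[R]_N -> 'rV[R]_m) (x v : 'rV[R]_N) : 'rV[R]_m :=
  'd (get (local_extension D f x)) x v.

(* f : D -> S^n is an immersion of a manifold of dimension n-1, with unit
   normal field xi tangent to S^n.  Embedded hypersurfaces are the case
   f = idfun with D a subset of S^n. *)
Record oriented_hypersurface (R : realType) (N n : nat) (D : set 'rV[R]_N)
    (f xi : 'rV[R]_N -> 'rV[R]_n.+1) : Prop := OrientedHypersurface {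
  oh_submanifold : submanifold n.-1 D;
  oh_smooth : smooth_map D f;
  oh_sphere : forall x, D x -> sphere R n (f x);
  oh_immersion : forall x v, D x -> tangent D x v -> tdiff D f x v = 0 -> v = 0;
  oh_normal_smooth : smooth_map D xi;
  oh_normal_unit : forall x, D x -> sphere R n (xi x);
  oh_normal_sphere : forall x, D x -> dot (xi x) (f x) = 0;
  oh_normal : forall x v, D x -> tangent D x v -> dot (xi x) (tdiff D f x v) = 0
}.

(* the graph of the shape operator A at x: Y = A X iff df Y = - dxi X *)
Definition shape_operator (R : realType) (N n : nat) (D : set 'rV[R]_N)
    (f xi : 'rV[R]_N -> 'rV[R]_n.+1) (x X Y : 'rV[R]_N) : Prop :=
  [/\ tangent D x X, tangent D x Y & tdiff D f x Y = - tdiff D xi x X].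

Definition shape_eigenspace (R : realType) (N n : nat) (D : set 'rV[R]_N)
    (f xi : 'rV[R]_N -> 'rV[R]_n.+1) (x : 'rV[R]_N) (k : R) : set 'rV[R]_N :=
  [set X | shape_operator D f xi x X (k *: X)].

Definition principal_curvatures (R : realType) (N n : nat) (D : set 'rV[R]_N)
    (f xi : 'rV[R]_N -> 'rV[R]_n.+1) (x : 'rV[R]_N) : set R :=
  [set k | exists2 X, shape_eigenspace D f xi x k X & X != 0].

Definition isoparametric (R : realType) (N n : nat) (D : set 'rV[R]_N)
    (f xi : 'rV[R]_N -> 'rV[R]_n.+1) : Prop :=
  forall x y, D x -> D y ->
    principal_curvatures D f xi x = principal_curvatures D f xi y.

Definition tangent_eigenspace (R : realType) (N n : nat) (D : set 'rV[R]_N)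
    (f xi : 'rV[R]_N -> 'rV[R]_n.+1) (S : set 'rV[R]_N) (x : 'rV[R]_N) (k : R) :
    Prop :=
  principal_curvatures D f xi x k /\ tangent S x = shape_eigenspace D f xi x k.

Definition curvature_surface (R : realType) (N n : nat) (D : set 'rV[R]_N)
    (f xi : 'rV[R]_N -> 'rV[R]_n.+1) (S : set 'rV[R]_N) : Prop :=
  [/\ exists d, submanifold d S, connected S, S `<=` D &
      forall x, S x -> exists k, tangent_eigenspace D f xi S x k].

Definition dupin (R : realType) (N n : nat) (D : set 'rV[R]_N)
    (f xi : 'rV[R]_N -> 'rV[R]_n.+1) : Prop :=
  forall S, curvature_surface D f xi S ->
  forall x y k l, S x -> S y ->
    tangent_eigenspace D f xi S x k -> tangent_eigenspace D f xi S y l -> k = l.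

Definition proper_dupin (R : realType) (N n : nat) (D : set 'rV[R]_N)
    (f xi : 'rV[R]_N -> 'rV[R]_n.+1) (g : nat) : Prop :=
  dupin D f xi /\
  forall x, D x -> (principal_curvatures D f xi x #= `I_g)%card.

(* Principal curvatures are finite, so that the usual conventions for
   infinite arguments are not needed. *)
Definition cross_ratio (R : realType) (a b c d : R) : R :=
  ((a - b) * (d - c)) / ((a - c) * (d - b)).

Definition principal_curvature_functions (R : realType) (N n : nat)
    (D : set 'rV[R]_N) (f xi : 'rV[R]_N -> 'rV[R]_n.+1)
    (g : nat) (kappa : 'I_g -> 'rV[R]_N -> R) : Prop :=
  forall x, D x ->
    (forall i j : 'I_g, (i < j)%N -> kappa i x < kappa j x) /\
    principal_curvatures D f xi x = range (fun i => kappa i x).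

Definition constant_lie_curvatures (R : realType) (N n : nat)
    (D : set 'rV[R]_N) (f xi : 'rV[R]_N -> 'rV[R]_n.+1) (g : nat) : Prop :=
  forall kappa : 'I_g -> 'rV[R]_N -> R,
  principal_curvature_functions D f xi kappa ->
  forall i1 i2 i3 i4 : 'I_g, uniq [:: i1; i2; i3; i4] ->
  forall x y, D x -> D y ->
    cross_ratio (kappa i1 x) (kappa i2 x) (kappa i3 x) (kappa i4 x) =
    cross_ratio (kappa i1 y) (kappa i2 y) (kappa i3 y) (kappa i4 y).

(* R^(n+3) is split as R x R^(n+1) x R *)
Definition lie_vec (R : realType) (n : nat) (a : R) (v : 'rV[R]_n.+1) (b : R) :
    'rV[R]_(1 + (n.+1 + 1)) :=
  row_mx a%:M (row_mx v b%:M).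

Definition lie_form (R : realType) (n : nat) (x y : 'rV[R]_(1 + (n.+1 + 1))) : R :=
  - dot (lsubmx x) (lsubmx y)
  + dot (lsubmx (rsubmx x)) (lsubmx (rsubmx y))
  - dot (rsubmx (rsubmx x)) (rsubmx (rsubmx y)).

(* the linear map x |-> x *m B represents a Lie sphere transformation *)
Definition lie_sphere_transformation (R : realType) (n : nat)
    (B : 'M[R]_(1 + (n.+1 + 1))) : Prop :=
  B \in unitmx /\
  forall x : 'rV[R]_(1 + (n.+1 + 1)),
    lie_form x x = 0 <-> lie_form (x *m B) (x *m B) = 0.

(* A projective line is the row space of a rank 2 matrix; this one passes
   through [(1, f x, 0)] and [(0, xi x, 1)]. *)
Definition legendre_lift (R : realType) (N n : nat)
    (f xi : 'rV[R]_N -> 'rV[R]_n.+1) (x : 'rV[R]_N) :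
    'M[R]_(1 + 1, 1 + (n.+1 + 1)) :=
  col_mx (lie_vec 1 (f x) 0) (lie_vec 0 (xi x) 1).

Definition lie_equivalent (R : realType) (N1 N2 n : nat)
    (D1 : set 'rV[R]_N1) (f1 xi1 : 'rV[R]_N1 -> 'rV[R]_n.+1)
    (D2 : set 'rV[R]_N2) (f2 xi2 : 'rV[R]_N2 -> 'rV[R]_n.+1) : Prop :=
  exists (B : 'M[R]_(1 + (n.+1 + 1))) (phi : 'rV[R]_N1 -> 'rV[R]_N2),
    [/\ lie_sphere_transformation B, diffeomorphism D1 D2 phi &
        forall x, D1 x ->
          (legendre_lift f1 xi1 x *m B == legendre_lift f2 xi2 (phi x))%MS].

(* H is R^4 with basis 1, i, j, k *)
Definition qcoef (R : realType) (a : 'rV[R]_4) (k : nat) : R := a 0 (inord k).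

Definition qmul (R : realType) (a b : 'rV[R]_4) : 'rV[R]_4 :=
  let a0 := qcoef a 0 in let a1 := qcoef a 1 in
  let a2 := qcoef a 2 in let a3 := qcoef a 3 in
  let b0 := qcoef b 0 in let b1 := qcoef b 1 in
  let b2 := qcoef b 2 in let b3 := qcoef b 3 in
  \row_(l < 4) nth 0
    [:: a0 * b0 - a1 * b1 - a2 * b2 - a3 * b3;
        a0 * b1 + a1 * b0 + a2 * b3 - a3 * b2;
        a0 * b2 - a1 * b3 + a2 * b0 + a3 * b1;
        a0 * b3 + a1 * b2 - a2 * b1 + a3 * b0] l.

Definition qconj (R : realType) (a : 'rV[R]_4) : 'rV[R]_4 :=
  \row_(l < 4) if l == 0 then a 0 l else - a 0 l.

(* H x H = 'rV_(4 + 4) and H x R = 'rV_(4 + 1) *)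
Definition hopf (R : realType) (x : 'rV[R]_8) : 'rV[R]_5 :=
  let u := lsubmx (x : 'rV[R]_(4 + 4)) in
  let v := rsubmx (x : 'rV[R]_(4 + 4)) in
  row_mx (2 *: qmul u (qconj v)) ((dot u u - dot v v)%:M : 'rV[R]_1).

Definition hopf_preimage (R : realType) (M : set 'rV[R]_5) : set 'rV[R]_8 :=
  sphere R 7 `&` @hopf R @^-1` M.

(* Main.v *)
Require Import Defs.
From HB Require Import structures.
From mathcomp Require Import all_boot all_order all_algebra.
From mathcomp Require Import all_classical all_reals all_analysis.
From mathcomp Require Import ring lra.
From mathcomp Require finmap.
Import Order.TTheory GRing.Theory Num.Theory.
Import numFieldNormedType.Exports.

Set Implicit Arguments.
Unset Strict Implicit.
Unset Printing Implicit Defensive.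

Local Open Scope classical_set_scope.
Local Open Scope ring_scope.

(* Write H(a, r)(p, q) = (a q + r p, conj a p - r q) for the Clifford action of
   R^5 = H x R on R^8 = H x H, so that <h(x), v> = <H(v)x, x> and
   dh_x(Y).v = 2 <H(v)x, Y>.  If xi is the unit normal of M, then H(xi(h x))x is
   the unit normal of P = h^-1(M), unique up to sign since P is connected.  With
   the relations H(u)H(v) + H(v)H(u) = 2<u, v> one finds that dh_x maps the
   eigenspace of P at x for the eigenvalue l isomorphically onto that of M at h(x)
   for (l^2 - 1) / (2 l); hence each principal curvature k of M yields the two
   principal curvatures k -+ sqrt(k^2 + 1) of P, and curvature surfaces of P
   locally project diffeomorphically onto curvature surfaces of M.

   The cross ratio of the four principal curvatures of P over a pair k, l
   determines (1 + k l) / (l - k) up to sign.  If this took only finitely many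
   values, it would be locally constant; as principal curvatures are constant along
   their own curvature surfaces (for a simple one: along integral curves of the
   eigendirection; for the double one when g = 2: by the Codazzi equation), all of
   them would be constant, so M would be isoparametric.  Constant Lie curvatures
   give finitely many cross ratios.  So does a Lie equivalence with an isoparametric
   hypersurface, since a linear map carrying Legendre lifts to Legendre lifts acts
   on the principal curvatures at each point by a Moebius transformation. *)

(** * Calculus of smooth maps *)

(** The hypotheses on [M] are pointwise: [proper_dupin] counts the principal curvatures at each
    point and says nothing about how they depend on the point. Their smoothness has to be produced
    before any of them can be differentiated. A simple curvature and its eigenvector come from the
    inverse function theorem. For g = 2 one curvature is simple and the other double, since [M] has
    dimension 3; the double one is then a quotient of the two fundamental forms on the complement of
    the simple eigenvector.

    A curvature surface tangent to a simple eigendirection is the image of an integral curve. For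
    the double curvature such a surface would require integrating a plane field; the Codazzi
    equation, obtained by equating mixed second derivatives, gives the vanishing derivative without
    constructing it.

    The final statement concerns every unit normal field of the preimage, and the sign of the normal
    cannot be prescribed; the case of the opposite sign is reduced to the other by reversing the
    normal of [M]. *)

Section Differentiability.
Variables (R : realType) (V W : normedModType R).
Implicit Types (F G : V -> W) (U : set V) (x v : V).

Lemma diff_near_eps F x : differentiable F x ->
  forall e, 0 < e -> \forall y \near x, `|F y - F x - 'd F x (y - x)| <= e * `|y - x|.
Proof.
move=> dF e e0; have /diff_locallyxP[_] := dF.
set k := 'o _ => Fk.
have /(littleoP [littleo of k]) : 0 < e by [].
move=> H.
rewrite [\forall y \near x, _](near_shift 0 x) /= subr0.
apply: filterS H => h /= kh.
by rewrite Fk addrK -[_ - _ - _]addrA -opprD addrAC addrN add0r.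
Qed.

Lemma is_diff_eps F (L : {linear V -> W}) x : continuous L ->
  (forall e, 0 < e -> \forall y \near x, `|F y - F x - L (y - x)| <= e * `|y - x|) ->
  is_diff x F L.
Proof.
move=> cL H.
have E : F \o shift x = cst (F x) + L +o_ 0 id.
  apply/eqaddoP => e e0; move: (H e e0).
  rewrite [\forall y \near x, _](near_shift 0 x) /= subr0 => {}H.
  by apply: filterS H => h /=; rewrite addrK -addrA -opprD.
have dFE := diff_unique cL E.
by split=> //; apply/diff_locallyP; rewrite dFE.
Qed.

Lemma differentiable_near F G x : (\forall y \near x, F y = G y) ->
  differentiable F x -> differentiable G x.
Proof.
move=> FG dF.
suff /@ex_diff : is_diff x G ('d F x) by [].
apply: is_diff_eps; first exact: diff_continuous.
move=> e e0; have Fx := nbhs_singleton FG.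
near=> y; rewrite -Fx -(near FG y)//; near: y.
exact: diff_near_eps.
Unshelve. all: by end_near. Qed.

Lemma Ck_sub U U' F k : U' `<=` U -> Ck k U F -> Ck k U' F.
Proof.
move=> UU'; elim: k F => [|k IH] F /=; first by move=> cF x /UU'; exact: cF.
by move=> [dF CF]; split=> [x /UU'|v]; [exact: dF|exact: IH].
Qed.

Lemma Ck_local U F k :
  (forall x, U x -> exists U', [/\ open U', U' x & Ck k U' F]) -> Ck k U F.
Proof.
elim: k F => [|k IH] F /= H.
  by move=> x /H[U' [_ U'x]]; exact.
split=> [x /H[U' [_ U'x [+ _]]]|v]; first exact.
by apply: IH => x /H[U' [oU' U'x [_ C]]]; exists U'.
Qed.

(** Openness of [U] is essential: agreement on a neighbourhood of each point is what makes the
    directional derivatives agree. *)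
Lemma Ck_eq U F G k : open U -> (forall x, U x -> F x = G x) ->
  Ck k U F -> Ck k U G.
Proof.
move=> oU; elim: k F G => [|k IH] F G /= FG.
  move=> cF x Ux; rewrite /prop_for /continuous_at -(FG x Ux).
  apply: cvg_trans (cF x Ux); apply: near_eq_cvg.
  by near=> y; rewrite FG//; near: y; exact: open_nbhs_nbhs.
have near_FG x : U x -> \forall y \near x, F y = G y.
  by move=> Ux; near=> y; rewrite FG//; near: y; exact: open_nbhs_nbhs.
move=> [dF CF]; split=> [x Ux|v].
  exact: differentiable_near (near_FG x Ux) (dF x Ux).
by apply: IH (CF v) => x Ux; apply: near_eq_derive; exact: near_FG.
Unshelve. all: by end_near. Qed.

Lemma Ck_continuous U F k : Ck k U F -> forall x, U x -> {for x, continuous F}.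
Proof.
case: k => //= k [dF _] x /dF; exact: differentiable_continuous.
Qed.

Lemma CkSP U F k : Ck k.+1 U F <->
  (forall x, U x -> differentiable F x) /\ (forall v, Ck k U (fun x => 'D_v F x)).
Proof. by []. Qed.

Lemma CkS U F k : Ck k.+1 U F -> Ck k U F.
Proof.
elim: k F => [F [dF _] x /dF|k IH F].
  exact: differentiable_continuous.
by move=> [dF CF]; split=> // v; apply: IH.
Qed.

Lemma Ck_cst U (c : W) k : Ck k U (fun=> c).
Proof.
elim: k c => [|k IH] c /=; first by move=> x _; exact: cst_continuous.
split=> [x _|v]; first exact: differentiable_cst.
by under eq_fun do rewrite derive_cst; apply: IH.
Qed.

Lemma Ck_linear U (L : {linear V -> W}) k : continuous L -> Ck k U L.
Proof.
move=> cL; case: k => [|k] /=; first by move=> x _; exact: cL.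
split=> [x _|v]; first exact: linear_differentiable.
rewrite (_ : (fun x => 'D_v L x) = (fun=> L v)); first exact: Ck_cst.
apply/funext => x; rewrite deriveE; last exact: linear_differentiable.
by rewrite diff_lin.
Qed.

Lemma CkD U F G k : open U -> Ck k U F -> Ck k U G -> Ck k U (fun x => F x + G x).
Proof.
move=> oU; elim: k F G => [|k IH] F G /=.
  by move=> cF cG x Ux; apply: continuousD; [exact: cF|exact: cG].
move=> [dF CF] [dG CG]; split=> [x Ux|v].
  by apply: differentiableD; [exact: dF|exact: dG].
apply: Ck_eq (IH _ _ (CF v) (CG v)) => // x Ux.
by apply/esym/deriveD; apply: diff_derivable; [exact: dF|exact: dG].
Qed.

Lemma CkN U F k : open U -> Ck k U F -> Ck k U (fun x => - F x).
Proof.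
move=> oU; elim: k F => [|k IH] F /=.
  by move=> cF x Ux; apply: continuousN; exact: cF.
move=> [dF CF]; split=> [x Ux|v].
  by apply: differentiableN; exact: dF.
apply: Ck_eq (IH _ (CF v)) => // x Ux.
by apply/esym/deriveN; apply: diff_derivable; exact: dF.
Qed.

Lemma Ck_sum U (I : Type) (r : seq I) (P : pred I) (F : I -> V -> W) k : open U ->
  (forall i, Ck k U (F i)) -> Ck k U (fun x => \sum_(i <- r | P i) F i x).
Proof.
move=> oU CF; elim: r => [|i r IH].
  by under eq_fun do rewrite big_nil; exact: Ck_cst.
under eq_fun do rewrite big_cons; case: (P i) => //; exact: CkD.
Qed.

End Differentiability.

Section Scalar.
Variables (R : realType) (V : normedModType R).
Implicit Types (f g : V -> R) (U : set V).

Lemma CkM U f g k : open U -> Ck k U f -> Ck k U g -> Ck k U (fun x => f x * g x).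
Proof.
move=> oU; elim: k f g => [|k IH] f g.
  by move=> cf cg x Ux; apply: continuousM; [exact: cf|exact: cg].
move=> Cf Cg; have [df Df] := iffLR (CkSP _ _ _) Cf; have [dg Dg] := iffLR (CkSP _ _ _) Cg; split=> [x Ux|v].
  by apply: differentiableM; [exact: df|exact: dg].
have := CkD oU (IH _ _ (CkS Cf) (Dg v)) (IH _ _ (CkS Cg) (Df v)).
apply: Ck_eq => // x Ux.
by apply/esym/deriveM; apply: diff_derivable; [exact: df|exact: dg].
Qed.

(** The derivative of 1/f is -(1/f)(1/f)f', so the induction hypothesis on 1/f itself and [CkM]
    suffice. *)
Lemma CkV U f k : open U -> (forall x, U x -> f x != 0) -> Ck k U f ->
  Ck k U (fun x => (f x)^-1).
Proof.
move=> oU f0; elim: k => [|k IH].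
  by move=> cf x Ux; apply: continuousV; [exact: f0|exact: cf].
move=> Cf; have [df Df] := iffLR (CkSP _ _ _) Cf; split=> [x Ux|v].
  by apply: differentiableV; [exact: df|exact: f0].
have IHk := IH (CkS Cf).
apply: Ck_eq (CkN oU (CkM oU (CkM oU IHk IHk) (Df v))) => // x Ux.
have -> : 'D_v (fun y => (f y)^-1) x = - (f x) ^- 2 *: 'D_v f x.
  by apply: deriveV; [exact: f0|apply: diff_derivable; exact: df].
by rewrite -[RHS]/(_ * _) mulNr expr2 invfM.
Qed.

Lemma Ck_prod U (I : Type) (r : seq I) (P : pred I) (F : I -> V -> R) k : open U ->
  (forall i, Ck k U (F i)) -> Ck k U (fun x => \prod_(i <- r | P i) F i x).
Proof.
move=> oU CF; elim: r => [|i r IH].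
  by under eq_fun do rewrite big_nil; exact: Ck_cst.
by under eq_fun do rewrite big_cons; case: (P i) => //; exact: CkM.
Qed.

Lemma Ck_det U n (A : V -> 'M[R]_n) k : open U ->
  (forall i j, Ck k U (fun x => A x i j)) -> Ck k U (fun x => \det (A x)).
Proof.
move=> oU CA; apply: Ck_sum => // s; apply: CkM => //; first exact: Ck_cst.
exact: Ck_prod.
Qed.

(** Cramer's rule: the entries of the inverse are cofactors divided by the determinant, and both are
    polynomial in the entries of the matrix. *)
Lemma Ck_invmx U n (A : V -> 'M[R]_n) k i j : open U ->
  (forall x, U x -> A x \in unitmx) ->
  (forall i j, Ck k U (fun x => A x i j)) -> Ck k U (fun x => invmx (A x) i j).
Proof.
move=> oU uA CA.
have : Ck k U (fun x => (\det (A x))^-1 * cofactor (A x) j i).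
  apply: CkM => //.
    apply: CkV => //; last exact: Ck_det.
    by move=> x /uA; rewrite unitmxE unitfE.
  apply: CkM => //; first exact: Ck_cst.
  by apply: Ck_det => // k1 k2; under eq_fun do rewrite !mxE; exact: CA.
by apply: Ck_eq => // x Ux; rewrite /invmx uA// !mxE.
Qed.

End Scalar.

Section Coordinates.
Variables (R : realType) (V : normedModType R).

Lemma continuous_sum (T : topologicalType) (W : normedModType R) n (F : 'I_n -> T -> W) x :
  (forall j, {for x, continuous (F j)}) -> {for x, continuous (fun y => \sum_(j < n) F j y)}.
Proof.
move=> cF.
suff H (s : seq 'I_n) : {for x, continuous (fun y => \sum_(j <- s) F j y)} by exact: H.
elim: s => [|i s IH].
  rewrite (_ : (fun _ => _) = fun=> 0); first exact: cst_continuous.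
  by apply/funext => y; rewrite big_nil.
rewrite (_ : (fun _ => _) = F i + fun y => \sum_(j <- s) F j y).
  by apply: continuousD; [exact: cF|exact: IH].
by apply/funext => y; rewrite big_cons.
Qed.

Lemma linear_rV_continuous n (W : normedModType R) (L : {linear 'rV[R]_n -> W}) :
  continuous L.
Proof.
have -> : (L : 'rV[R]_n -> W) = fun y => \sum_(j < n) y 0 j *: L (delta_mx 0 j).
  apply/funext => y; rewrite {1}[y]row_sum_delta linear_sum.
  by apply: eq_bigr => j _; rewrite linearZ.
move=> y; apply: continuous_sum => j; apply: continuousZr_tmp.
exact: (@coord_continuous R 1 n 0 j).
Qed.

Lemma norm_coord_le n (y : 'rV[R]_n) j : `|y 0 j| <= `|y|.
Proof. by rewrite [leRHS]/Num.norm/= mx_normrE; exact: (le_bigmax _ _ (0, j)). Qed.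

Lemma rV_norm_le n (y : 'rV[R]_n) e : 0 <= e -> (forall j, `|y 0 j| <= e) -> `|y| <= e.
Proof.
move=> e0 H; rewrite [leLHS]/Num.norm/= mx_normrE; apply: bigmax_le => //.
by move=> [i j] _ /=; rewrite (ord1 i).
Qed.

Lemma differentiable_coordP n (F : V -> 'rV[R]_n) x :
  differentiable F x <-> forall j, differentiable (fun y => F y 0 j) x.
Proof.
split=> [dF j|dF].
  apply: (differentiable_comp dF (g := fun y : 'rV[R]_n => y 0 j)).
  exact: differentiable_coord.
have -> : F = \sum_(j < n) (fun y => F y 0 j *: delta_mx 0 j).
  by apply/funext => y; rewrite fct_sumE -row_sum_delta.
by apply: differentiable_sum => j; exact: differentiableZl.
Qed.

Lemma derive_coord n (F : V -> 'rV[R]_n) x v j : derivable F x v ->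
  'D_v F x 0 j = 'D_v (fun y => F y 0 j) x.
Proof. by move=> dF; rewrite derive_mx// mxE. Qed.

Lemma continuous_coordP n (T : topologicalType) (F : T -> 'rV[R]_n) x :
  {for x, continuous F} <-> forall j, {for x, continuous (fun y => F y 0 j)}.
Proof.
split=> [cF j|cF].
  apply: (@continuous_comp _ _ _ F (fun y : 'rV[R]_n => y 0 j)) => //.
  exact: coord_continuous.
have -> : F = fun y => \sum_(j < n) F y 0 j *: delta_mx 0 j.
  by apply/funext => y; rewrite -row_sum_delta.
by apply: continuous_sum => j; apply: cvgZr_tmp; exact: cF.
Qed.

Lemma Ck_coordP n k (U : set V) (F : V -> 'rV[R]_n) : open U ->
  Ck k U F <-> forall j, Ck k U (fun y => F y 0 j).
Proof.
move=> oU; elim: k F => [|k IH] F.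
  split=> [cF j x /cF/continuous_coordP|cF x Ux]; first exact.
  by apply/continuous_coordP => j; exact: cF.
split=> [[dF CF] j|CF].
  split=> [x /dF/differentiable_coordP|v]; first exact.
  apply: Ck_eq (iffLR (IH _) (CF v) j) => // x Ux.
  by rewrite derive_coord//; apply: diff_derivable; exact: dF.
have dF x : U x -> differentiable F x.
  by move=> Ux; apply/differentiable_coordP => j; exact: (CF j).1.
split=> // v; apply/IH => j; apply: Ck_eq ((CF j).2 v) => // x Ux.
by rewrite derive_coord//; apply: diff_derivable; exact: dF.
Qed.

Lemma diff_sum_delta n (W : normedModType R) (G : 'rV[R]_n -> W) y w :
  differentiable G y -> 'd G y w = \sum_(j < n) w 0 j *: 'D_(delta_mx 0 j) G y.
Proof.
move=> dG; rewrite {1}[w]row_sum_delta linear_sum.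
by apply: eq_bigr => j _; rewrite linearZ deriveE.
Qed.

Lemma derive_comp n (W : normedModType R) (F : V -> 'rV[R]_n) (G : 'rV[R]_n -> W) x v :
  differentiable F x -> differentiable G (F x) ->
  'D_v (fun y => G (F y)) x = 'd G (F x) ('D_v F x).
Proof.
move=> dF dG; rewrite deriveE; last exact: differentiable_comp.
by rewrite diff_comp//= deriveE.
Qed.

Lemma open_preim_Ck (W : normedModType R) k (U : set V) (F : V -> W) (U' : set W) :
  open U -> open U' -> Ck k U F -> open (U `&` F @^-1` U').
Proof.
move=> oU oU' CF; rewrite openE => x [Ux U'Fx].
apply: filterI; first exact: open_nbhs_nbhs.
by apply: (Ck_continuous CF Ux); exact: open_nbhs_nbhs.
Qed.

(** By the chain rule a derivative of G o F is a sum of products of coordinates of D_v F with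
    partial derivatives of G composed with F. The latter are compositions of the same kind at one
    order less, so the induction generalizes over [G]. *)
Lemma Ck_comp_scalar n k (U : set V) (U' : set 'rV[R]_n) (F : V -> 'rV[R]_n)
    (G : 'rV[R]_n -> R) : open U -> open U' -> (forall x, U x -> U' (F x)) ->
  Ck k U F -> Ck k U' G -> Ck k U (fun x => G (F x)).
Proof.
move=> oU oU' FU; elim: k F G FU => [|k IH] F G FU CF CG.
  move=> x Ux; apply: continuous_comp; first exact: CF.
  by apply: CG; exact: FU.
have [[dF DF] [dG DG]] := (iffLR (CkSP _ _ _) CF, iffLR (CkSP _ _ _) CG).
split=> [x Ux|v].
  by apply: differentiable_comp; [exact: dF|apply: dG; exact: FU].
have : Ck k U (fun x => \sum_(j < n) 'D_v F x 0 j * 'D_(delta_mx 0 j) G (F x)).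
  apply: Ck_sum => // j; apply: CkM => //; first exact: (iffLR (Ck_coordP _ _ oU) (DF v) j).
  exact: (IH F _ FU (CkS CF) (DG _)).
apply: Ck_eq => // x Ux; rewrite derive_comp; [|exact: dF|apply: dG; exact: FU].
by rewrite diff_sum_delta//; apply: dG; exact: FU.
Qed.

Lemma Ck_comp_real_scalar k (U : set V) (U' : set R) (F : V -> R) (G : R -> R) :
  open U -> open U' -> (forall x, U x -> U' (F x)) ->
  Ck k U F -> Ck k U' G -> Ck k U (fun x => G (F x)).
Proof.
move=> oU oU' FU; elim: k F G FU => [|k IH] F G FU CF CG.
  move=> x Ux; apply: continuous_comp; first exact: CF.
  by apply: CG; exact: FU.
have [[dF DF] [dG DG]] := (iffLR (CkSP _ _ _) CF, iffLR (CkSP _ _ _) CG).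
split=> [x Ux|v].
  by apply: differentiable_comp; [exact: dF|apply: dG; exact: FU].
have : Ck k U (fun x => 'D_v F x * 'D_1 G (F x)).
  by apply: CkM => //; exact: (IH F _ FU (CkS CF) (DG _)).
apply: Ck_eq => // x Ux; rewrite !deriveE; last first.
- exact: dF.
- by apply: dG; exact: FU.
- by apply: differentiable_comp; [exact: dF|apply: dG; exact: FU].
rewrite (diff_comp (f := F))/=; [|exact: dF|by apply: dG; exact: FU].
by rewrite -{2}['d F x v]mulr1 -['d F x v * 1]/('d F x v *: 1) linearZ.
Qed.

End Coordinates.

Section SmoothMaps.
Variables (R : realType) (V : normedModType R).

Lemma Ck_comp n m k (U : set V) (U' : set 'rV[R]_n) (F : V -> 'rV[R]_n)
    (G : 'rV[R]_n -> 'rV[R]_m) : open U -> open U' -> (forall x, U x -> U' (F x)) ->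
  Ck k U F -> Ck k U' G -> Ck k U (fun x => G (F x)).
Proof.
move=> oU oU' FU CF CG; apply/Ck_coordP => // j; have {}CG := iffLR (Ck_coordP _ _ oU') CG j.
exact: (Ck_comp_scalar oU oU' FU CF CG).
Qed.

Lemma Ck_comp_real n k (U : set V) (U' : set R) (F : V -> R) (G : R -> 'rV[R]_n) :
  open U -> open U' -> (forall x, U x -> U' (F x)) ->
  Ck k U F -> Ck k U' G -> Ck k U (fun x => G (F x)).
Proof.
move=> oU oU' FU CF CG; apply/Ck_coordP => // j; have {}CG := iffLR (Ck_coordP _ _ oU') CG j.
exact: (Ck_comp_real_scalar oU oU' FU CF CG).
Qed.

Lemma smooth_map_comp n m (D : set V) (E : set 'rV[R]_n) (f : V -> 'rV[R]_n)
    (g : 'rV[R]_n -> 'rV[R]_m) : (forall x, D x -> E (f x)) ->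
  smooth_map D f -> smooth_map E g -> smooth_map D (fun x => g (f x)).
Proof.
move=> DE sf sg x Dx.
have [F [U [oU Ux sF FE]]] := sf x Dx.
have [G [U' [oU' U'x sG GE]]] := sg _ (DE x Dx).
(* The extension [F] may leave [U'], so the domain is cut down to the points where it does not. *)
exists (G \o F), (U `&` F @^-1` U'); split.
- exact: open_preim_Ck oU oU' (sF 0%N).
- by split=> //=; rewrite FE.
- move=> k; apply: (Ck_comp _ oU' _ (Ck_sub _ (sF k)) (sG k)).
  + exact: open_preim_Ck oU oU' (sF 0%N).
  + by move=> y [].
  + by move=> y [].
- by move=> y Dy [Uy /= U'y]; rewrite -FE// GE ?FE//; [exact: DE|rewrite -FE].
Qed.

Lemma smooth_map_open (W : normedModType R) (D : set V) (f : V -> W) : open D ->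
  smooth_map D f <-> smooth_on D f.
Proof.
move=> oD; split=> [sf k|sf x Dx]; last by exists f, D; split.
apply: Ck_local => x Dx; have [F [U [oU Ux sF FE]]] := sf x Dx.
exists (D `&` U); split=> //; first exact: openI.
apply: (@Ck_eq _ _ _ _ F); first exact: openI.
  by move=> y [Dy Uy]; exact: FE.
by apply: Ck_sub (sF k) => y [].
Qed.

Lemma smooth_map_sub (W : normedModType R) (D D' : set V) (f : V -> W) :
  D' `<=` D -> smooth_map D f -> smooth_map D' f.
Proof.
move=> DD' sf x /DD' Dx; have [F [U [oU Ux sF FE]]] := sf x Dx.
by exists F, U; split=> // y /DD' Dy Uy; exact: FE.
Qed.

Lemma smooth_map_eq (W : normedModType R) (D : set V) (f g : V -> W) :
  (forall x, D x -> f x = g x) -> smooth_map D f -> smooth_map D g.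
Proof.
move=> fg sf x Dx; have [F [U [oU Ux sF FE]]] := sf x Dx.
by exists F, U; split=> // y Dy Uy; rewrite FE// fg.
Qed.

Lemma smooth_on_map (W : normedModType R) (D U : set V) (f : V -> W) : open U ->
  D `<=` U -> smooth_on U f -> smooth_map D f.
Proof. by move=> oU DU sf x Dx; exists f, U; split=> //; exact: DU. Qed.

Lemma smooth_on_differentiable (W : normedModType R) (U : set V) (f : V -> W) x :
  smooth_on U f -> U x -> differentiable f x.
Proof. by move=> sf; exact: (sf 1%N).1. Qed.

Lemma smooth_map_continuous (W : normedModType R) (D : set V) (f : V -> W) :
  smooth_map D f -> {within D, continuous f}.
Proof.
move=> sf; apply/subspace_continuousP => x Dx.
have [F [U [oU Ux sF FE]]] := sf x Dx.
have cF : F y @[y --> within D (nbhs x)] --> f x.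
  rewrite -FE//; apply: cvg_within_filter; exact: (sF 0%N x Ux).
apply: cvg_trans cF; apply: near_eq_cvg.
rewrite near_withinE; near=> y => Dy; apply: FE => //.
by near: y; exact: open_nbhs_nbhs.
Unshelve. all: by end_near. Qed.

End SmoothMaps.

Section MeanValue.
Variables (R : realType) (V : normedModType R).

Lemma is_derive_line (W : normedModType R) (f : V -> W) x v (t : R) :
  differentiable f (x + t *: v) ->
  is_derive t 1 (fun s : R => f (x + s *: v)) ('D_v f (x + t *: v)).
Proof.
move=> df.
have dl : is_diff t (fun s : R => x + s *: v) (fun s => s *: v).
  have H : is_diff t (cst x + (fun s : R => s *: v)) (0 + (fun s : R => s *: v)).
    exact: is_diffD.
  by apply: is_diff_eq; apply/funext => s /=; exact: add0r.
have dc : differentiable (fun s : R => f (x + s *: v)) t.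
  by apply: (differentiable_comp (f := fun s : R => x + s *: v)).
split; first exact: diff_derivable.
rewrite deriveE// (diff_comp (f := fun s : R => x + s *: v))//=.
by rewrite diff_val scale1r -deriveE.
Qed.

Lemma MVT_line (f : V -> R) x v :
  (forall t : R, 0 <= t <= 1 -> differentiable f (x + t *: v)) ->
  exists2 t : R, 0 <= t <= 1 & f (x + v) - f x = 'D_v f (x + t *: v).
Proof.
move=> df.
have dg (t : R) : 0 <= t <= 1 -> is_derive t 1 (fun s : R => f (x + s *: v)) ('D_v f (x + t *: v)).
  by move=> /df; exact: is_derive_line.
have [|||t t01] := @MVT R (fun s : R => f (x + s *: v)) (fun t => 'D_v f (x + t *: v)) 0 1.
- exact: ltr01.
- by move=> t; rewrite in_itv/= => /andP[t0 t1]; apply: dg; rewrite !ltW.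
- apply: derivable_within_continuous => t; rewrite in_itv/= => t01.
  by have [] := dg t t01.
rewrite scale1r scale0r addr0 subr0 mulr1 => E; exists t => //.
by move: t01; rewrite in_itv/= => /andP[t0 t1]; rewrite !ltW.
Qed.

Lemma ball_segment (x0 x y : V) r (t : R) : ball x0 r x -> ball x0 r y ->
  0 <= t <= 1 -> ball x0 r (x + t *: (y - x)).
Proof.
rewrite -ball_normE /= => bx by_ /andP[t0 t1].
have -> : x0 - (x + t *: (y - x)) = (1 - t) *: (x0 - x) + t *: (x0 - y).
  rewrite scalerBl scale1r -addrA -scalerN -scalerDr opprD addrA -scalerN.
  by congr (_ + _ *: _); rewrite !opprB subrKA.
apply: le_lt_trans (ler_normD _ _) _; rewrite !normrZ.
rewrite (ger0_norm t0) ger0_norm ?subr_ge0//.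
have [->|tn0] := eqVneq t 0; first by rewrite subr0 mul1r mul0r addr0.
have tp : 0 < t by rewrite lt_neqAle eq_sym tn0.
rewrite (_ : r = (1 - t) * r + t * r); last by rewrite -mulrDl subrK mul1r.
apply: ler_ltD; first by rewrite ler_wpM2l ?subr_ge0// ltW.
by rewrite ltr_pM2l.
Qed.

Lemma derive0_ball_const (f : V -> R) x r :
  (forall y, ball x r y -> differentiable f y /\ forall v, 'D_v f y = 0) ->
  forall y, ball x r y -> f y = f x.
Proof.
move=> H y ry.
have r0 : 0 < r by move: ry; rewrite -ball_normE /=; exact: le_lt_trans.
have [t t01|t t01] := @MVT_line f x (y - x).
  have /H[] // : ball x r (x + t *: (y - x)).
  by apply: ball_segment => //; exact: ballxx.
rewrite (addrC x) subrK => E; apply/eqP; rewrite -subr_eq0 E; apply/eqP.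
have /H[_ ->] // : ball x r (x + t *: (y - x)).
by apply: ball_segment => //; exact: ballxx.
Qed.

(** The mean value theorem is used twice: for p |-> f(p + v) - f(p) along [u], then for D_u f along
    [v]. *)
Lemma second_difference (f : V -> R) U x u v : open U -> Ck 2 U f ->
  (forall s t : R, 0 <= s <= 1 -> 0 <= t <= 1 -> U (x + s *: u + t *: v)) ->
  exists s t : R, [/\ 0 <= s <= 1, 0 <= t <= 1 &
    f (x + u + v) - f (x + u) - (f (x + v) - f x) =
    'D_v ('D_u f) (x + s *: u + t *: v)].
Proof.
move=> oU [df Cf] Ux.
have df0 (s t : R) : 0 <= s <= 1 -> 0 <= t <= 1 -> differentiable f (x + s *: u + t *: v).
  by move=> s01 t01; apply: df; exact: Ux.
have i0 : (0 : R) <= (0 : R) <= (1 : R) by rewrite lexx ler01.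
have i1 : (0 : R) <= (1 : R) <= (1 : R) by rewrite lexx ler01.
have dsh (s : R) (s01 : 0 <= s <= 1) :
    is_diff (x + s *: u) (fun p => f (p + v)) ('d f (x + s *: u + v)).
  have df1 : differentiable f (x + s *: u + v).
    by have := df0 s 1 s01 i1; rewrite scale1r.
  have H : is_diff (x + s *: u) (id + cst v) (id + 0).
    exact: is_diffD.
  have H' : is_diff (x + s *: u) (fun p => p + v) id.
    by apply: is_diff_eq H _; apply/funext => p /=; exact: addr0.
  have dc : differentiable (fun p => f (p + v)) (x + s *: u).
    exact: (differentiable_comp (f := fun p => p + v)).
  split=> //; rewrite (diff_comp (f := fun p => p + v))//=.
  by apply/funext => p /=; rewrite diff_val.
have dphi s : 0 <= s <= 1 -> differentiable (fun p => f (p + v) - f p) (x + s *: u).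
  move=> s01; apply: differentiableB; first by have [] := dsh s s01.
  by have := df0 s 0 s01 i0; rewrite scale0r addr0.
have [s s01 E1] := MVT_line dphi.
have [t t01|t t01 E2] := @MVT_line ('D_u f) (x + s *: u) v.
  have [+ _] := Cf u; apply; exact: Ux.
exists s, t; split=> //; rewrite -E2 E1.
have dfs : differentiable f (x + s *: u).
  by have := df0 s 0 s01 i0; rewrite scale0r addr0.
have [ds ds'] := dsh s s01.
rewrite -[LHS]/('D_u ((fun p => f (p + v)) - f) _) deriveB; last 2 first.
- exact: diff_derivable.
- exact: diff_derivable.
congr (_ - _); rewrite deriveE// ds' -deriveE//.
by have := df0 s 1 s01 i1; rewrite scale1r.
Qed.

(** The second difference of [f] over a small parallelogram is symmetric in the two sides, and by
    [second_difference] it equals each mixed derivative at some nearby point. Continuity of these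
    derivatives closes the gap. *)
Lemma schwarz (f : V -> R) U x u v : open U -> U x -> Ck 2 U f ->
  'D_v ('D_u f) x = 'D_u ('D_v f) x.
Proof.
move=> oU Ux Cf.
have [cuv cvu] : {for x, continuous ('D_v ('D_u f))} /\ {for x, continuous ('D_u ('D_v f))}.
  by split; [exact: (Cf.2 u).2|exact: (Cf.2 v).2].
apply/eqP; rewrite -subr_eq0 -normr_le0; apply/ler_addgt0Pl => e e0; rewrite addr0.
have e20 : 0 < e / 2 by rewrite divr_gt0.
move/cvgrPdist_le : cuv => /(_ _ e20) /nbhs_ballP[r1 /= r10 H1].
move/cvgrPdist_le : cvu => /(_ _ e20) /nbhs_ballP[r2 /= r20 H2].
have /nbhs_ballP[r3 /= r30 H3] : nbhs x U by exact: open_nbhs_nbhs.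
set r := Num.min r1 (Num.min r2 r3).
have r0 : 0 < r by rewrite !lt_min r10 r20.
have K0 : 0 < `|u| + `|v| + 1 by rewrite ltr_wpDl// addr_ge0.
(* Scaling both sides by [h] brings the parallelogram into the ball of radius [r]; the summand 1
   keeps the divisor positive when u = v = 0. *)
have [h h0 hr] : exists2 h : R, 0 < h & h * (`|u| + `|v| + 1) < r.
  exists (r / 2 / (`|u| + `|v| + 1)); first by rewrite !divr_gt0.
  by rewrite divfK ?gt_eqF// ltr_pdivrMr// ltr_pMr ?ltr1n.
have bd (s t : R) : 0 <= s <= 1 -> 0 <= t <= 1 -> ball x r (x + s *: (h *: u) + t *: (h *: v)).
  move=> /andP[s0 s1] /andP[t0 t1].
  rewrite -ball_normE /= -addrA opprD addrA subrr add0r normrN.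
  apply: le_lt_trans hr.
  apply: le_trans (ler_normD _ _) _; rewrite !normrZ.
  rewrite (ger0_norm s0) (ger0_norm t0) (ger0_norm (ltW h0)) !mulrDr mulr1 -addrA lerD//.
    by rewrite ler_piMl// mulr_ge0// ltW.
  by rewrite ler_wpDr ?(ltW h0)// ler_piMl// mulr_ge0// ltW.
have rr1 y : ball x r y -> ball x r1 y.
  by apply: le_ball; rewrite /r ge_min lexx.
have rr2 y : ball x r y -> ball x r2 y.
  by apply: le_ball; rewrite /r !ge_min lexx orbT.
have rr3 y : ball x r y -> ball x r3 y.
  by apply: le_ball; rewrite /r !ge_min lexx !orbT.
have [|s [t [s01 t01 E1]]] := @second_difference f U x (h *: u) (h *: v) oU Cf.
  by move=> s t s01 t01; apply/H3/rr3/bd.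
have [|s' [t' [s01' t01' E2]]] := @second_difference f U x (h *: v) (h *: u) oU Cf.
  by move=> s' t' s01' t01'; rewrite addrAC; apply/H3/rr3/bd.
have key y : ball x r y -> forall a b, 'D_(h *: b) ('D_(h *: a) f) y = h ^+ 2 * 'D_b ('D_a f) y.
  move=> ry a b; have Uy : U y by exact/H3/rr3.
  have Da : {in U, 'D_(h *: a) f =1 fun z => h * 'D_a f z}.
    move=> z; rewrite inE => Uz; rewrite !deriveE; [|exact: Cf.1|exact: Cf.1].
    by rewrite linearZ.
  transitivity ('D_(h *: b) (h \*: 'D_a f) y).
    apply: near_eq_derive; near=> z; rewrite Da// inE; near: z.
    exact: open_nbhs_nbhs.
  have da : differentiable ('D_a f) y by exact: (Cf.2 a).1.
  rewrite deriveZ; last exact: diff_derivable.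
  by rewrite !deriveE// linearZ /= scalerA -expr2.
(* Multiplied by h^2, both sides are the same second difference. *)
have E : 'D_v ('D_u f) (x + s *: (h *: u) + t *: (h *: v)) =
         'D_u ('D_v f) (x + s' *: (h *: v) + t' *: (h *: u)).
  have hn0 : h ^+ 2 != 0 by rewrite expf_neq0// gt_eqF.
  have bq : ball x r (x + s' *: (h *: v) + t' *: (h *: u)) by rewrite addrAC; exact: bd.
  apply: (mulfI hn0); apply: (etrans (esym (key _ (bd s t s01 t01) u v))); apply: etrans (key _ bq v u).
  by rewrite -E1 -E2 (addrAC x (h *: v)) !opprB addrACA [RHS]addrACA (addrC (- _)).
rewrite (splitr e).
rewrite -(subrKA ('D_v ('D_u f) (x + s *: (h *: u) + t *: (h *: v)))).
apply: le_trans (ler_normD _ _) _; apply: lerD; first exact/H1/rr1/bd.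
by rewrite E distrC; apply: H2; apply: rr2; rewrite addrAC; exact: bd.
Unshelve. all: by end_near. Qed.

End MeanValue.

(** Gives row vectors the complete normed structure under which [banach_fixed_point] and
    [geometric_limit] are applied to them. *)
HB.instance Definition _ (R : realType) (n : nat) := Complete.on 'rV[R]_n.

(** * The inverse function theorem *)

Section InverseFunction.
Variable R : realType.

Lemma linear_rV_bounded n (W : normedModType R) (L : {linear 'rV[R]_n -> W}) :
  exists2 k : R, 0 < k & forall x, `|L x| <= k * `|x|.
Proof. exact/linear_lipschitz/linear_rV_continuous. Qed.

Lemma derive_near_const n (U : set 'rV[R]_n) (f : 'rV[R]_n -> R) (x0 : 'rV[R]_n) (e : R) :
  open U -> U x0 -> Ck 1 U f -> 0 < e ->
  \forall z \near x0, U z /\ forall w, `|'D_w f z - 'D_w f x0| <= e * `|w|.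
Proof.
move=> oU Ux0 [df Cf] e0.
(* Each of the n partial derivatives may vary by e/(n + 1); dividing by n + 1 instead of n also
   covers n = 0. *)
have en0 : 0 < e / n.+1%:R by rewrite divr_gt0.
have H : \forall z \near x0, forall j : 'I_n,
    `|'D_(delta_mx 0 j) f x0 - 'D_(delta_mx 0 j) f z| <= e / n.+1%:R.
  apply: (@filter_forall _ _ _ _ (nbhs_filter x0)) => j.
  by have /cvgrPdist_le/(_ _ en0) := Cf (delta_mx 0 j) x0 Ux0.
near=> z.
have Uz : U z by near: z; exact: open_nbhs_nbhs.
split=> // w.
have Df y : U y -> 'D_w f y = \sum_(j < n) w 0 j *: 'D_(delta_mx 0 j) f y.
  by move=> Uy; rewrite deriveE ?diff_sum_delta//; exact: df.
rewrite (Df z Uz) (Df x0 Ux0).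
rewrite -sumrB; apply: le_trans (ler_norm_sum _ _ _) _.
apply: (@le_trans _ _ (\sum_(j < n) e / n.+1%:R * `|w|)).
  apply: ler_sum => j _; rewrite -scalerBr normrZ mulrC.
  apply: ler_pM => //; last exact: norm_coord_le.
  by rewrite distrC; move: j; near: z.
rewrite sumr_const card_ord -[_ *+ n]mulr_natl mulrA ler_wpM2r//.
rewrite mulrA ler_pdivrMr// mulrC ler_pM2l//.
by rewrite ler_nat.
Unshelve. all: by end_near. Qed.

(** Strict differentiability: both points vary near [x0], which is the form a contraction estimate
    needs. It follows from the mean value theorem on the segment between them, which stays in the
    ball. *)
Lemma strict_diff_scalar n (U : set 'rV[R]_n) (f : 'rV[R]_n -> R) (x0 : 'rV[R]_n) (e : R) :
  open U -> U x0 -> Ck 1 U f -> 0 < e ->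
  \forall d \near 0^'+, forall x y : 'rV[R]_n, ball x0 d x -> ball x0 d y ->
    `|f y - f x - 'd f x0 (y - x)| <= e * `|y - x|.
Proof.
move=> oU Ux0 Cf e0.
have /nbhs_ballP[r /= r0 H] := derive_near_const oU Ux0 Cf e0.
near=> d => x y dx dy.
have dr : ball x0 d `<=` ball x0 r by apply: le_ball; near: d; exact: nbhs_right_le.
have [t t01|t t01] := @MVT_line _ _ f x (y - x).
  by have /dr/H[Uz _] := ball_segment dx dy t01; exact: Cf.1.
rewrite [x + (y - x)]addrC subrK => ->.
have /dr/H[Uz] := ball_segment dx dy t01.
by move/(_ (y - x)); rewrite ['D__ f x0]deriveE//; exact: Cf.1.
Unshelve. all: by end_near. Qed.

Lemma strict_diff n m (U : set 'rV[R]_n) (F : 'rV[R]_n -> 'rV[R]_m) (x0 : 'rV[R]_n)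
    (e : R) : open U -> U x0 -> Ck 1 U F ->
  0 < e ->
  \forall d \near 0^'+, forall x y : 'rV[R]_n, ball x0 d x -> ball x0 d y ->
    `|F y - F x - 'd F x0 (y - x)| <= e * `|y - x|.
Proof.
move=> oU Ux0 CF e0.
have dF : differentiable F x0 by exact: CF.1.
have H : \forall d \near 0^'+, forall i : 'I_m, forall x y : 'rV[R]_n, ball x0 d x -> ball x0 d y ->
    `|F y 0 i - F x 0 i - 'd (fun z => F z 0 i) x0 (y - x)| <= e * `|y - x|.
  apply: filter_forall => i; apply: (strict_diff_scalar oU Ux0 _ e0).
  exact: (iffLR (Ck_coordP _ _ oU) CF i).
apply: filterS H => d H x y dx dy.
apply: rV_norm_le => [|i]; first by rewrite mulr_ge0// ltW.
have dFi : differentiable (fun z => F z 0 i) x0 by exact: (iffLR (differentiable_coordP _ _) dF).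
rewrite !mxE -[in X in _ - X]deriveE// derive_coord; last exact: diff_derivable.
by rewrite deriveE//; exact: H.
Qed.

(** Simplified Newton iteration with the fixed matrix [A] as approximate inverse Jacobian: x |-> x +
    (z - F x) A contracts by 1/2 on the closed ball of radius s/2. The bound s/(4c) on z - F x1
    moves the centre by at most s/4, so the ball is preserved. A fixed point solves F x = z because
    [A] is invertible. *)
Lemma locally_surjective n (F : 'rV[R]_n -> 'rV[R]_n) (A : 'M[R]_n) (x1 : 'rV[R]_n) (s c : R) : 0 < s -> 0 < c ->
  (forall v : 'rV[R]_n, `|v *m A| <= c * `|v|) -> A \in unitmx ->
  (forall x y : 'rV[R]_n, ball x1 s x -> ball x1 s y ->
     `|y - x - (F y - F x) *m A| <= 2^-1 * `|y - x|) ->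
  forall z : 'rV[R]_n, `|z - F x1| < s / (4 * c) -> exists2 x, ball x1 s x & F x = z.
Proof.
move=> s0 c0 cA uA H z zF.
pose U : set 'rV[R]_n := closed_ball_ (fun x : 'rV[R]_n => `|x|) x1 (s / 2).
have US x : U x -> ball x1 s x.
  rewrite -ball_normE /U /= => xs; apply: le_lt_trans xs _.
  by rewrite ltr_pdivrMr// ltr_pMr// ltr1n.
pose g (x : 'rV[R]_n) : 'rV[R]_n := x + (z - F x) *m A.
have gd (x y : 'rV[R]_n) : ball x1 s x -> ball x1 s y -> `|g y - g x| <= 2^-1 * `|y - x|.
  move=> sx sy; suff -> : g y - g x = y - x - (F y - F x) *m A by exact: H.
  rewrite /g opprD addrACA -mulmxBl; congr (_ + _); rewrite -mulNmx; congr (_ *m _).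
  by apply/rowP => j; rewrite !mxE; ring.
have x1U : U x1 by rewrite /U /closed_ball_ /= subrr normr0 divr_ge0// ltW.
have gU : forall x, U x -> U (g x).
  move=> x Ux; rewrite /U /closed_ball_ /= -[x1 - g x](subrKA (g x1)).
  apply: le_trans (ler_normD _ _) _.
  have -> : s / 2 = s / 4 + 2^-1 * (s / 2) by field.
  apply: lerD.
    rewrite /g opprD addrA subrr add0r normrN.
    apply: le_trans (cA _) _.
    move/ltW : zF; rewrite invfM mulrA ler_pdivlMr// mulrC => /le_trans; apply.
    by [].
  apply: le_trans (gd _ _ (US _ Ux) (US _ x1U)) _.
  by rewrite ler_pM2l.
pose gfun : {fun U >-> U} := HB.pack g (isFun.Build _ _ U U g gU).
have [|||x Ux xg] := @banach_fixed_point R 'rV[R]_n U gfun.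
- exists (2^-1)%:nng; split=> /=; first by rewrite invf_lt1// ltr1n.
  by move=> [a b] /= [Ua Ub]; rewrite distrC [`|a - b|]distrC; exact: (gd _ _ (US _ Ua) (US _ Ub)).
- exact: closed_closed_ball_.
- by exists x1.
exists x; first exact: US.
move: xg; rewrite /= /g => /eqP; rewrite -subr_eq0 opprD addrA subrr add0r oppr_eq0 => /eqP E.
apply/eqP; rewrite eq_sym -subr_eq0; apply/eqP.
by rewrite -(mulmxK uA (z - F x)) E mul0mx.
Qed.

Lemma jacobianE n m (F : 'rV[R]_n -> 'rV[R]_m) (x v : 'rV[R]_n) :
  'd F x v = v *m jacobian F x.
Proof. by rewrite /jacobian mul_rV_lin1. Qed.

Lemma Ck_jacobian n m k (U : set 'rV[R]_n) (F : 'rV[R]_n -> 'rV[R]_m) i j : open U ->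
  Ck k.+1 U F -> Ck k U (fun x => jacobian F x i j).
Proof.
move=> oU [dF CF]; apply: Ck_eq (iffLR (Ck_coordP _ _ oU) (CF (delta_mx 0 i)) j) => // x Ux.
by rewrite /jacobian mxE deriveE//; exact: dF.
Qed.

Lemma inj_jacobian_unit n (F : 'rV[R]_n -> 'rV[R]_n) (x : 'rV[R]_n) :
  (forall v, 'd F x v = 0 -> v = 0) -> jacobian F x \in unitmx.
Proof.
move=> H; rewrite -row_free_unit; apply: inj_row_free => v.
by rewrite -jacobianE; exact: H.
Qed.

(** The expansion of [F] at [x], read at the point G z, is solved for G z - x with the inverse
    Jacobian. The Lipschitz bound on [G] turns the error in G z - x into one in z - F x. *)
Lemma inverse_differentiable n (F G : 'rV[R]_n -> 'rV[R]_n) (B : set 'rV[R]_n) (c : R) x :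
  B x -> open (F @` B) -> (forall y, B y -> G (F y) = y) -> 0 < c ->
  (forall y z, B y -> B z -> `|z - y| <= c * `|F z - F y|) ->
  differentiable F x -> jacobian F x \in unitmx ->
  is_diff (F x) G (mulmxr (invmx (jacobian F x))).
Proof.
move=> Bx oV GF c0 lip dF uJ.
apply: is_diff_eps => [|e e0]; first exact: linear_rV_continuous.
have [k k0 kJ] := linear_rV_bounded (mulmxr (invmx (jacobian F x))).
have GV z : (F @` B) z -> B (G z) /\ F (G z) = z by move=> [y By <-]; rewrite GF.
have VFx : (F @` B) (F x) by exists x.
have Glip z : (F @` B) z -> `|G z - x| <= c * `|z - F x|.
  by move=> /GV[BG {2}<-]; exact: lip.
have cG : G z @[z --> F x] --> x.
  apply/(@cvgrPdist_le _ _ _ _ (nbhs_filter (F x))) => r r0.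
  have rc : 0 < r / c by rewrite divr_gt0.
  near=> z; rewrite distrC; apply: le_trans (Glip z _) _.
    by near: z; exact: open_nbhs_nbhs.
  rewrite -ler_pdivlMl// mulrC distrC; apply: ltW.
  by near: z; apply: (@cvgr_dist_lt _ _ _ (nbhs (F x)) _ id).
(* The error is multiplied by [k], a bound for the inverse Jacobian, and by [c], the Lipschitz
   constant of [G]. *)
have ek : 0 < e / (k * c) by rewrite divr_gt0// mulr_gt0.
have H := cG _ (diff_near_eps dF ek).
near=> z.
have Vz : (F @` B) z by near: z; exact: open_nbhs_nbhs.
have [BG FG] := GV z Vz.
have : `|F (G z) - F x - 'd F x (G z - x)| <= e / (k * c) * `|G z - x| by near: z.
rewrite FG jacobianE GF// => Hz.
have -> : G z - x - mulmxr (invmx (jacobian F x)) (z - F x) =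
    - mulmxr (invmx (jacobian F x)) (z - F x - (G z - x) *m jacobian F x).
  by rewrite /= [in RHS]mulmxBl (mulmxK uJ) opprB.
rewrite normrN; apply: le_trans (kJ _) _.
rewrite -ler_pdivlMl//; apply: le_trans Hz _.
rewrite invfM mulrA -mulrA mulrC -!mulrA [e * _]mulrC !mulrA.
rewrite [leRHS]mulrC mulrA ler_wpM2r ?(ltW e0)//.
rewrite ler_pM2r ?invr_gt0//.
by rewrite mulrC ler_pdivrMr// mulrC; exact: Glip.
Unshelve. all: by end_near. Qed.

(** Bootstrapping: the Jacobian of [G] at z is the inverse of that of [F] at G z, so it is of class
    C^k as soon as [G] is, and then [G] is of class C^(k+1). *)
Lemma inverse_smooth n (F G : 'rV[R]_n -> 'rV[R]_n) (B : set 'rV[R]_n) (c : R) :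
  open B -> open (F @` B) -> (forall y, B y -> G (F y) = y) -> 0 < c ->
  (forall y z, B y -> B z -> `|z - y| <= c * `|F z - F y|) ->
  smooth_on B F -> (forall x, B x -> jacobian F x \in unitmx) ->
  smooth_on (F @` B) G.
Proof.
move=> oB oV GF c0 lip sF uJ.
have dG x (Bx : B x) := inverse_differentiable Bx oV GF c0 lip
  (smooth_on_differentiable sF Bx) (uJ x Bx).
elim=> [|k IH].
  by move=> _ [x Bx <-]; apply: differentiable_continuous; have [] := dG x Bx.
split=> [_ [x Bx <-]|v]; first by have [] := dG x Bx.
apply/Ck_coordP => // j.
have : Ck k (F @` B) (fun z => \sum_(i < n) v 0 i * invmx (jacobian F (G z)) i j).
  apply: Ck_sum => // i; apply: CkM => //; first exact: Ck_cst.
  apply: (Ck_comp_scalar (G := fun x => invmx (jacobian F x) i j) oV oB _ IH).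
    by move=> _ [x Bx <-]; rewrite GF.
  by apply: Ck_invmx => // i' j'; exact: Ck_jacobian.
apply: Ck_eq => // _ [x Bx <-]; rewrite GF//; have [dGx dGE] := dG x Bx.
by rewrite deriveE// dGE /= mxE.
Qed.

Lemma inverse_function n (F : 'rV[R]_n -> 'rV[R]_n) (U : set 'rV[R]_n) (x0 : 'rV[R]_n) :
  open U -> U x0 -> smooth_on U F -> (forall v, 'd F x0 v = 0 -> v = 0) ->
  exists (B : set 'rV[R]_n) (G : 'rV[R]_n -> 'rV[R]_n),
    [/\ open B, B x0, B `<=` U, open (F @` B) &
        smooth_on (F @` B) G /\ forall x, B x -> G (F x) = x].
Proof.
move=> oU Ux0 sF inj.
have uJ0 := inj_jacobian_unit inj.
have [c c0 cA] := linear_rV_bounded (mulmxr (invmx (jacobian F x0))).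
pose U1 := U `&` (fun x => \det (jacobian F x)) @^-1` [set r : R | r != 0].
have CJ k : Ck k U (fun x => \det (jacobian F x)).
  by apply: Ck_det => // i j; exact: Ck_jacobian (sF k.+1).
have oU1 : open U1 by apply: open_preim_Ck (CJ 0%N) => //; exact: open_neq.
have U1x0 : U1 x0 by split=> //=; move: uJ0; rewrite unitmxE unitfE.
(* As [c] bounds the inverse Jacobian at [x0], an error of 1/(2c) becomes the contraction factor 1/2
   in [HA]. *)
have e0 : 0 < (2 * c)^-1 by rewrite invr_gt0 mulr_gt0.
have /nbhs_ballP[d1 /= d10 Hd1] : nbhs x0 U1 by exact: open_nbhs_nbhs.
have [d [d0 dd1 Hd]] : exists d : R, [/\ 0 < d, d <= d1 &
    forall x y : 'rV[R]_n, ball x0 d x -> ball x0 d y ->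
    `|F y - F x - 'd F x0 (y - x)| <= (2 * c)^-1 * `|y - x|].
  have := strict_diff oU Ux0 (sF 1%N) e0 => H.
  near (0 : R)^'+ => d; exists d; split=> //.
  - by near: d; exact: nbhs_right_le.
  - by near: d.
have HA (x y : 'rV[R]_n) : ball x0 d x -> ball x0 d y ->
    `|y - x - (F y - F x) *m invmx (jacobian F x0)| <= 2^-1 * `|y - x|.
  move=> dx dy.
  have -> : y - x - (F y - F x) *m invmx (jacobian F x0) =
      - mulmxr (invmx (jacobian F x0)) (F y - F x - 'd F x0 (y - x)).
    by rewrite jacobianE /= [in RHS]mulmxBl (mulmxK uJ0) opprB.
  rewrite normrN; apply: le_trans (cA _) _.
  rewrite -ler_pdivlMl// mulrA -invfM [c * _]mulrC; exact: Hd.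
have lip (y z : 'rV[R]_n) : ball x0 d y -> ball x0 d z -> `|z - y| <= 2 * c * `|F z - F y|.
  move=> dy dz; have H1 := HA _ _ dy dz; have H2 := cA (F z - F y).
  have := ler_normD (z - y - (F z - F y) *m invmx (jacobian F x0))
                    ((F z - F y) *m invmx (jacobian F x0)).
  rewrite subrK => H3; move: H1 H2 H3 => /=.
  set a := `|_|; set b := `|z - y|; set e := `|_ *m _|; lra.
have dU x : ball x0 d x -> U1 x by move=> dx; apply: Hd1; exact: le_ball dx.
have Bx0 : ball x0 d x0 by exact: ballxx.
have oB : open (ball x0 d) by exact: ball_open.
have injF (y z : 'rV[R]_n) : ball x0 d y -> ball x0 d z -> F y = F z -> y = z.
  move=> dy dz E; have := lip _ _ dy dz; rewrite E subrr normr0 mulr0.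
  by rewrite normr_le0 subr_eq0 => /eqP.
(* [locally_surjective] applies around every point of the ball with one and the same matrix, the
   inverse Jacobian at [x0]. *)
have oV : open (F @` ball x0 d).
  rewrite openE => _ [x dx <-].
  have /nbhs_ballP[s /= s0 Hs] : nbhs x (ball x0 d) by exact: open_nbhs_nbhs.
  have cA' (v : 'rV[R]_n) : `|v *m invmx (jacobian F x0)| <= c * `|v| := cA v.
  have uA : invmx (jacobian F x0) \in unitmx by rewrite unitmx_inv.
  have HA' (y z : 'rV[R]_n) : ball x s y -> ball x s z ->
      `|z - y - (F z - F y) *m invmx (jacobian F x0)| <= 2^-1 * `|z - y|.
    by move=> /Hs ? /Hs ?; exact: HA.
  apply/nbhs_ballP; exists (s / (4 * c)); first by rewrite /= divr_gt0// mulr_gt0.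
  move=> z; rewrite -ball_normE /= distrC => zF.
  by have [y sy <-] := locally_surjective s0 c0 cA' uA HA' zF; exists y => //; move/Hs: sy; rewrite -ball_normE.
pose G (z : 'rV[R]_n) := get [set x | ball x0 d x /\ F x = z].
have GF x : ball x0 d x -> G (F x) = x.
  move=> dx; have [] : [set y | ball x0 d y /\ F y = F x] (G (F x)).
    by apply: getPex; exists x.
  by move=> dG E; exact: injF.
exists (ball x0 d), G; split=> //; first by move=> x /dU[].
have c20 : 0 < 2 * c by rewrite mulr_gt0.
have sFB : smooth_on (ball x0 d) F by move=> k; apply: Ck_sub (sF k) => x /dU[].
have uJ x : ball x0 d x -> jacobian F x \in unitmx.
  by move=> /dU[_ /=]; rewrite unitmxE unitfE.
by split; [exact: (inverse_smooth oB oV GF c20 lip sFB uJ)|exact: GF].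
Unshelve. all: by end_near. Qed.

End InverseFunction.

Section Connected.
Variables (R : realType).

(** The level set of [f] through [x] is clopen relative to [A]. Interiors supply the ambient open
    sets, since [f] is controlled on [A] only. *)
Lemma connected_locally_constant (T : topologicalType) (A : set T) (V : Type) (f : T -> V) :
  connected A -> (forall x, A x -> \forall y \near x, A y -> f y = f x) ->
  forall x y, A x -> A y -> f x = f y.
Proof.
move=> cA lf x y Ax Ay.
have E : A `&` [set z | f z = f x] = A.
  apply: cA; first by exists x.
  - exists (interior [set z | A z -> f z = f x]); first exact: open_interior.
    apply/seteqP; split=> [z [Az /= fz]|z [Az /interior_subset/= H]].
      by split=> //; rewrite /interior/= -fz; exact: lf.
    by split=> //; exact: H.
  - exists (~` (interior [set z | A z -> f z <> f x])).
      by apply: open_closedC; exact: open_interior.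
    apply/seteqP; split=> [z [Az /= fz]|z [Az /= H]].
      by split=> // /interior_subset/(_ Az).
    split=> //=; apply: contrapT => fz; apply: H; rewrite /interior/=.
    by apply: filterS (lf z Az) => w H Aw; rewrite H.
by move: Ay; rewrite -E => -[].
Qed.

Lemma ball_connected (V : normedModType R) (x : V) (r : R) : connected (ball x r).
Proof.
have -> : ball x r =
    \bigcup_(y in ball x r) ((fun t : R => x + t *: (y - x)) @` `[0, 1]).
  apply/seteqP; split=> [y xy|y [z xz [t /=]]].
    exists y => //; exists 1; first by rewrite /= in_itv/= ler01 lexx.
    by rewrite scale1r addrC subrK.
  rewrite in_itv/= => t01 <-; apply: ball_segment => //.
  by apply: ballxx; move: xz; rewrite -ball_normE /=; exact: le_lt_trans.
apply: bigcup_connected.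
  by exists x => y _; exists 0; [rewrite /= in_itv/= lexx ler01|rewrite scale0r addr0].
move=> y _; apply: connected_continuous_connected.
  by apply/connected_intervalP; exact: interval_is_interval.
apply: continuous_subspaceT => t.
by apply: cvgD; [exact: cvg_cst|exact: scalel_continuous].
Qed.

End Connected.

Section Curves.
Variables (R : realType).

Definition curve_in N (D : set 'rV[R]_N) (x : 'rV[R]_N) (gamma : R -> 'rV[R]_N) :=
  exists e : R, [/\ 0 < e, smooth_on (ball (0 : R) e) gamma,
     forall t, ball (0 : R) e t -> D (gamma t) & gamma 0 = x].

Lemma tangentP N (D : set 'rV[R]_N) x v :
  tangent D x v <-> exists2 gamma, curve_in D x gamma & is_derive (0 : R) (1 : R) gamma v.
Proof.
split=> [[e [gamma [e0 sg gD g0 g'0]]]|[gamma [e [e0 sg gD g0]] [_ dg]]].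
  exists gamma; first by exists e.
  have dg : differentiable gamma 0 by apply: (smooth_on_differentiable sg); exact: ballxx.
  by split; [exact: diff_derivable|rewrite -derive1E].
by exists e, gamma; split=> //; rewrite derive1E.
Qed.

Lemma curve_near N (D : set 'rV[R]_N) x gamma : curve_in D x gamma ->
  \forall t \near (0 : R), D (gamma t).
Proof.
by move=> [e [e0 _ gD _]]; apply/nbhs_ballP; exists e.
Qed.

Lemma curve_differentiable N (D : set 'rV[R]_N) x gamma : curve_in D x gamma ->
  differentiable gamma (0 : R).
Proof.
by move=> [e [e0 sg _ _]]; apply: (smooth_on_differentiable sg); exact: ballxx.
Qed.

Lemma curve_open N (D : set 'rV[R]_N) x gamma (U : set 'rV[R]_N) : curve_in D x gamma ->
  open U -> U x -> curve_in (D `&` U) x gamma.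
Proof.
move=> [e [e0 sg gD g0]] oU Ux.
have cg : {for (0 : R), continuous gamma} by apply: (sg 0%N); exact: ballxx.
have : \forall t \near (0 : R), U (gamma t).
  by apply: cg; rewrite g0; exact: open_nbhs_nbhs.
move=> /nbhs_ballP[r /= r0 rU]; exists (Num.min e r); split=> //.
- by rewrite lt_min e0.
- by move=> k; apply: Ck_sub (sg k); apply: le_ball; rewrite ge_min lexx.
- move=> t mt; split; first by apply: gD; apply: le_ball mt; rewrite ge_min lexx.
  by apply: rU; apply: le_ball mt; rewrite ge_min lexx orbT.
Qed.

Lemma curve_push N m (D : set 'rV[R]_N) (E : set 'rV[R]_m) (f : 'rV[R]_N -> 'rV[R]_m) x gamma :
  smooth_map D f -> (forall y, D y -> E (f y)) -> curve_in D x gamma ->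
  curve_in E (f x) (fun t => f (gamma t)).
Proof.
move=> sf DE [e [e0 sg gD g0]]; exists e; split=> //; last by rewrite g0.
- apply/smooth_map_open; first exact: ball_open.
  by apply: (smooth_map_comp gD) => //; apply/smooth_map_open => //; exact: ball_open.
- by move=> t et; apply: DE; exact: gD.
Qed.

Lemma tdiff_ext N m (D : set 'rV[R]_N) (f : 'rV[R]_N -> 'rV[R]_m) x : smooth_map D f -> D x ->
  local_extension D f x (get (local_extension D f x)).
Proof. by move=> sf Dx; apply: getPex; exact: sf. Qed.

Lemma derive_curve_comp N m (F : 'rV[R]_N -> 'rV[R]_m) (gamma : R -> 'rV[R]_N) v t :
  differentiable gamma t -> is_derive t (1 : R) gamma v -> differentiable F (gamma t) ->
  is_derive t (1 : R) (fun s => F (gamma s)) ('d F (gamma t) v).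
Proof.
move=> dg [_ <-] dF; split; last exact: derive_comp.
by apply: diff_derivable; exact: differentiable_comp.
Qed.

Lemma tdiff_derive N m (D : set 'rV[R]_N) (f : 'rV[R]_N -> 'rV[R]_m) x gamma v :
  smooth_map D f -> curve_in D x gamma -> is_derive (0 : R) (1 : R) gamma v ->
  is_derive (0 : R) (1 : R) (fun t => f (gamma t)) (tdiff D f x v).
Proof.
move=> sf cg dg.
have Dx : D x by have [e [e0 _ gD <-]] := cg; apply: gD; exact: ballxx.
have [U [oU Ux sF FE]] := tdiff_ext sf Dx; rewrite /tdiff.
set F := get _ in sF FE *.
have g0 : gamma 0 = x by have [e []] := cg.
have dF : differentiable F (gamma 0).
  by rewrite g0; exact: (smooth_on_differentiable sF).
have := derive_curve_comp (curve_differentiable cg) dg dF; rewrite g0.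
apply: near_eq_is_derive.
apply: filterS (curve_near (curve_open cg oU Ux)) => t [Dt Ut].
exact: FE.
Qed.

Lemma is_derive_unique (V W : normedModType R) (f : V -> W) x v a b :
  is_derive x v f a -> is_derive x v f b -> a = b.
Proof. by move=> [_ <-] [_ <-]. Qed.

Lemma smooth_map_id (V : normedModType R) (D : set V) : smooth_map D idfun.
Proof.
by move=> x _; exists idfun, setT; split=> //; [exact: openT|move=> k; apply: Ck_linear => y; exact].
Qed.

Lemma tdiff_id N (D : set 'rV[R]_N) x v : D x -> tangent D x v -> tdiff D idfun x v = v.
Proof.
move=> Dx /tangentP[gamma cg dg].
exact: is_derive_unique (tdiff_derive (@smooth_map_id _ D) cg dg) dg.
Qed.

Lemma tangent_push N m (D : set 'rV[R]_N) (E : set 'rV[R]_m) (f : 'rV[R]_N -> 'rV[R]_m) x v :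
  smooth_map D f -> (forall y, D y -> E (f y)) -> tangent D x v ->
  tangent E (f x) (tdiff D f x v).
Proof.
move=> sf DE /tangentP[gamma cg dg]; apply/tangentP.
exists (fun t => f (gamma t)); first exact: curve_push cg.
exact: tdiff_derive.
Qed.

Lemma tdiff_eq N m (D : set 'rV[R]_N) (f g : 'rV[R]_N -> 'rV[R]_m) x v :
  smooth_map D f -> (forall y, D y -> f y = g y) -> tangent D x v ->
  tdiff D f x v = tdiff D g x v.
Proof.
move=> sf fg /tangentP[gamma cg dg].
have sg : smooth_map D g by exact: smooth_map_eq sf.
apply: (is_derive_unique (tdiff_derive sf cg dg)).
apply: near_eq_is_derive (tdiff_derive sg cg dg).
by apply: filterS (curve_near cg) => t Dt; rewrite fg.
Qed.

Lemma curve_line N (Om : set 'rV[R]_N) a w : open Om -> Om a ->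
  curve_in Om a (fun t : R => a + t *: w).
Proof.
move=> oO Oa; have : curve_in (setT `&` Om) a (fun t : R => a + t *: w).
  apply: curve_open => //; exists 1; split=> //; last by rewrite scale0r addr0.
  move=> k; apply/Ck_coordP; first exact: ball_open.
  move=> j; under eq_fun do rewrite !mxE.
  apply: CkD; [exact: ball_open|exact: Ck_cst|].
  apply: CkM; [exact: ball_open| |exact: Ck_cst].
  by apply: (@Ck_linear _ _ _ _ idfun) => y; exact.
by move=> [e [? ? H ?]]; exists e; split=> // t /H[].
Qed.

Lemma is_derive_line0 (V W : normedModType R) (F : V -> W) a w : differentiable F a ->
  is_derive (0 : R) (1 : R) (fun t : R => F (a + t *: w)) ('d F a w).
Proof.
by move=> dF; have := @is_derive_line _ _ _ F a w 0; rewrite scale0r addr0 -deriveE//; exact.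
Qed.

End Curves.

(** * Charts, tangent spaces and immersions *)

Section Charts.
Variables (R : realType).

Lemma diffeo_sub d N (A A' : set 'rV[R]_d) (phi : 'rV[R]_d -> 'rV[R]_N) :
  A' `<=` A -> diffeomorphism A (phi @` A) phi -> diffeomorphism A' (phi @` A') phi.
Proof.
move=> A'A [sphi [psi [spsi H1 H2]]]; split; first exact: smooth_map_sub sphi.
exists psi; split.
- by apply: smooth_map_sub spsi => _ [x /A'A Ax <-]; exists x.
- by move=> x A'x; split; [exists x|have [_] := H1 x (A'A _ A'x)].
- by move=> _ [x A'x <-]; have [_ ->] := H1 x (A'A _ A'x).
Qed.

Lemma diffeo_image d N (A : set 'rV[R]_d) (B : set 'rV[R]_N) phi :
  diffeomorphism A B phi -> phi @` A = B.
Proof.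
move=> [_ [psi [_ H1 H2]]]; apply/seteqP; split=> [_ [x Ax <-]|y By].
  by have [] := H1 x Ax.
by have [Apy E] := H2 y By; exists (psi y).
Qed.

Lemma diffeo_diff_inj d N (Om : set 'rV[R]_d) (B : set 'rV[R]_N) phi a w : open Om ->
  diffeomorphism Om B phi -> Om a -> 'd phi a w = 0 -> w = 0.
Proof.
move=> oO [/(smooth_map_open _ oO) sphi [psi [spsi H1 H2]]] Oa dw.
have [Ba _] := H1 a Oa; have [Psi [U [oU Ux sPsi PsiE]]] := spsi _ Ba.
have dphi : differentiable phi a by exact: (smooth_on_differentiable sphi).
have dPsi : differentiable Psi (phi a) by exact: (smooth_on_differentiable sPsi).
have E : 'D_w (fun b => Psi (phi b)) a = 'D_w id a.
  apply: near_eq_derive; near=> b.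
  have Ob : Om b by near: b; exact: open_nbhs_nbhs.
  have [Bb pb] := H1 b Ob; rewrite PsiE//; near: b.
  by apply: (differentiable_continuous dphi); exact: open_nbhs_nbhs.
move: E; rewrite derive_id derive_comp// deriveE// dw => <-.
by rewrite linear0.
Unshelve. all: by end_near. Qed.

(** Curves in [D] are pulled back by the inverse chart; straight lines in the parameter domain are
    pushed forward. *)
Lemma tangent_chart d N (Om : set 'rV[R]_d) (D W : set 'rV[R]_N) phi a v :
  open W -> open Om -> diffeomorphism Om (D `&` W) phi -> Om a ->
  tangent D (phi a) v <-> exists w, v = 'd phi a w.
Proof.
move=> oW oO dphi Oa.
have [/(smooth_map_open _ oO) sphi [psi [spsi H1 H2]]] := dphi.
have [[Da Wa] psia] := H1 a Oa.
have dfphi : differentiable phi a by exact: (smooth_on_differentiable sphi).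
split=> [/tangentP[gamma cg dg]|[w ->]].
  have {}cg := curve_open cg oW Wa.
  have cc := curve_push spsi (fun y H => (H2 y H).1) cg.
  have dc := curve_differentiable cc.
  have c0 : psi (gamma 0) = a by have [e [_ _ _ ->]] := cg.
  exists ('D_1 (fun t => psi (gamma t)) 0).
  apply: (is_derive_unique dg).
  have : is_derive (0 : R) (1 : R) (fun t => phi (psi (gamma t)))
      ('d phi a ('D_1 (fun t => psi (gamma t)) 0)).
    rewrite -[in 'd phi a]c0; apply: derive_curve_comp => //.
      by apply/derivableP/diff_derivable.
    by rewrite c0.
  apply: near_eq_is_derive.
  by apply: filterS (curve_near cg) => t DW; have [_] := H2 _ DW.
apply/tangentP; exists (fun t : R => phi (a + t *: w)); last first.
  exact: is_derive_line0.
apply: (curve_push _ _ (curve_line w oO Oa)); last by move=> b /H1[[]].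
exact/smooth_map_open.
Qed.

Lemma submanifold_tangentZ d N (D : set 'rV[R]_N) x c v : submanifold d D -> D x ->
  tangent D x v -> tangent D x (c *: v).
Proof.
move=> sD Dx; have [W [Om [phi [oW Wx oO dphi]]]] := sD x Dx.
have [a Oa phia] : exists2 a, Om a & phi a = x.
  by have : (D `&` W) x by []; rewrite -(diffeo_image dphi) => -[a Oa <-]; exists a.
rewrite -phia => /(tangent_chart _ oW oO dphi Oa)[v' ->].
by apply/(tangent_chart _ oW oO dphi Oa); exists (c *: v'); rewrite linearZ.
Qed.

(** A right inverse [M] of the Jacobian, in row convention, projects the target onto the parameter
    space. The map a |-> F a M has the identity as differential at [a0], and its local inverse [G]
    yields the smooth inverse y |-> G (y M) of [F]. *)
Lemma immersion_diffeo d N (F : 'rV[R]_d -> 'rV[R]_N) (Om : set 'rV[R]_d) a0 :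
  open Om -> Om a0 -> smooth_on Om F -> (forall w, 'd F a0 w = 0 -> w = 0) ->
  exists B : set 'rV[R]_d, [/\ open B, B a0, B `<=` Om & diffeomorphism B (F @` B) F].
Proof.
move=> oO Oa sF inj.
have : row_free (jacobian F a0).
  by apply: inj_row_free => v; rewrite -jacobianE; exact: inj.
move=> /row_freeP[M JM].
have dF : differentiable F a0 by exact: (smooth_on_differentiable sF).
have sM : smooth_on (setT : set 'rV[R]_N) (mulmxr M : 'rV[R]_N -> 'rV[R]_d).
  by move=> k; apply: Ck_linear; exact: linear_rV_continuous.
have sH : smooth_on Om (fun a => F a *m M).
  by move=> k; exact: (Ck_comp oO openT _ (sF k) (sM k)).
have dH v : 'd (fun a => F a *m M) a0 v = v.
  rewrite -deriveE; last exact: (smooth_on_differentiable sH).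
  rewrite (derive_comp (G := mulmxr M))//; last exact: (smooth_on_differentiable sM).
  rewrite diff_lin; last exact: linear_rV_continuous.
  by rewrite /= deriveE// jacobianE -mulmxA JM mulmx1.
have [|B [G [oB Ba BO oV [sG GH]]]] := @inverse_function _ _ (fun a => F a *m M) Om a0 oO Oa sH.
  by move=> v; rewrite dH.
exists B; split=> //; split.
  by apply/smooth_map_open => // k; exact: Ck_sub (sF k).
exists (fun y => G (y *m M)); split.
- have oW : open (setT `&` (mulmxr M : 'rV[R]_N -> 'rV[R]_d) @^-1` ((fun a => F a *m M) @` B)).
    by apply: open_preim_Ck (sM 0%N) => //; exact: openT.
  apply: (smooth_on_map oW).
    by move=> _ [a Ba' <-]; split=> //=; exists a.
  move=> k; apply: (Ck_comp oW oV _ _ (sG k)); first by move=> y [].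
  by apply: Ck_sub (sM k).
- by move=> a Ba'; split; [exists a|exact: GH].
- by move=> _ [a Ba' <-]; rewrite GH.
Qed.

End Charts.

(** * Integral curves *)

Section Picard.
Variables (R : realType).

Lemma geometric_limit (V : completeNormedModType R) (u : nat -> V) (D : R) :
  (forall k, `|u k.+1 - u k| <= D / 2 ^+ k) ->
  exists l, forall k, `|l - u k| <= 2 * D / 2 ^+ k.
Proof.
move=> du.
have D0 : 0 <= D by apply: le_trans (le_trans (normr_ge0 _) (du 0%N)) _; rewrite expr0 divr1.
have p2 k : 0 < (2 : R) ^+ k by rewrite exprn_gt0.
have H k j : `|u (k + j)%N - u k| <= 2 * D / 2 ^+ k - 2 * D / 2 ^+ (k + j)%N.
  elim: j => [|j IH]; first by rewrite addn0 !subrr normr0.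
  rewrite addnS -(subrKA (u (k + j)%N)); apply: le_trans (ler_normD _ _) _.
  apply: le_trans (lerD (du _) IH) _.
  rewrite le_eqVlt; apply/orP; left; apply/eqP; rewrite exprS.
  by field; rewrite !gt_eqF//; apply: p2.
have H' k m : (k <= m)%N -> `|u m - u k| <= 2 * D / 2 ^+ k.
  move=> km; rewrite -(subnKC km); apply: le_trans (H k _) _.
  by rewrite gerBl divr_ge0 ?mulr_ge0// ltW.
have : cvgn u.
  apply/cauchy_cvgP/cauchy_exP => e e0 /=.
  have h21 : `|2^-1 : R| < 1 by rewrite ger0_norm ?invr_ge0// invf_lt1// ltr1n.
  have /cvgrPdist_lt/(_ _ e0)[N _ HN] := @cvg_geometric R (2 * D) 2^-1 h21.
  exists (u N); exists N => // m Nm; rewrite -ball_normE /= distrC.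
  apply: le_lt_trans (H' _ _ Nm) _.
  have := HN N (leqnn N); rewrite sub0r normrN /geometric /= exprVn.
  by apply: le_lt_trans; exact: ler_norm.
move=> /cvg_ex[l ul]; exists l => k.
apply/ler_addgt0Pl => e e0.
have /cvgrPdist_le/(_ _ e0)[N _ HN] := ul.
rewrite -(subrKA (u (maxn N k))); apply: le_trans (ler_normD _ _) _.
by apply: lerD; [apply: HN; rewrite /= leq_maxl|apply: H'; rewrite leq_maxr].
Qed.

Lemma exists_antiderivative (f : R -> R) : continuous f ->
  exists F : R -> R, F 0 = 0 /\ forall t, `|t| < 1 -> is_derive t (1 : R) F (f t).
Proof.
(* Starting the integral at -1 brings every t with |t| < 1, negative ones included, into the range
   of the fundamental theorem. *)
move=> cf; pose F0 (x : R) := (\int[@lebesgue_measure R]_(t in `[(-1)%R, x]) f t)%R.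
exists (fun t => F0 t - F0 0); split; first by rewrite subrr.
move=> t; rewrite ltr_norml => /andP[t1 t2].
have [|||dF F'] := @continuous_FTC1_closed R f (-1) t 1 t2.
- apply: continuous_compact_integrable; first exact: segment_compact.
  exact: continuous_subspaceT.
- exact: t1.
- exact: cf.
- rewrite derive1E in F'; rewrite -F' -[X in is_derive _ _ _ X]subr0.
  have d1 : is_derive t (1 : R) F0 ('D_1 F0 t) by exact/derivableP.
  have d2 : is_derive t (1 : R) (cst (F0 0) : R -> R) 0 by exact: is_derive_cst.
  exact: (@is_deriveB _ _ _ _ _ _ _ _ _ d1 d2).
Qed.

Lemma derive_bound_line (f df : R -> R) (t C : R) :
  (forall s, `|s| <= `|t| -> is_derive s (1 : R) f (df s)) ->
  (forall s, `|s| <= `|t| -> `|df s| <= C) -> `|f t - f 0| <= C * `|t|.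
Proof.
move=> fd dC.
have H (a b : R) : a <= b -> (forall s, s \in `[a, b] -> `|s| <= `|t|) ->
    `|f b - f a| <= C * (b - a).
  move=> ab abt.
  have [s /itvP sab||c cab ->] := @MVT_segment R f df a b ab.
  - by apply/fd/abt; rewrite in_itv/= !sab.
  - apply: derivable_within_continuous => s sab.
    by have [] := fd s (abt s sab).
  - rewrite normrM (ger0_norm (_ : 0 <= b - a)) ?subr_ge0// ler_wpM2r ?subr_ge0//.
    by apply/dC/abt.
have [t0|t0] := leP 0 t.
  have := H 0 t t0; rewrite subr0 (ger0_norm t0); apply => s.
  by rewrite in_itv/= => /andP[s0 st]; rewrite ger0_norm.
have := H t 0 (ltW t0); rewrite sub0r distrC (ltr0_norm t0); apply => s.
by rewrite in_itv/= => /andP[s0 st]; rewrite ler0_norm// lerN2.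
Qed.

(** The nearest-point retraction onto [a - h, a + h]. It is 1-Lipschitz, so composing with it makes
    local data global without spoiling Lipschitz constants. *)
Definition clamp (a h t : R) : R := Num.max (a - h) (Num.min (a + h) t).

Lemma clampP (a h t : R) : 0 <= h ->
  [\/ t < a - h /\ clamp a h t = a - h, a + h < t /\ clamp a h t = a + h |
      a - h <= t <= a + h /\ clamp a h t = t].
Proof.
move=> h0; rewrite /clamp; have [t1|t1] := ltP t (a - h).
  by constructor 1; split=> //; rewrite max_l// ge_min (ltW t1) orbT.
have [t2|t2] := ltP (a + h) t.
  by constructor 2; split=> //; rewrite max_r//; lra.
by constructor 3; split=> //; rewrite max_r.
Qed.

Lemma clamp_dist (a h t : R) : 0 <= h -> `|clamp a h t - a| <= h.
Proof.
move=> h0; rewrite ler_norml.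
by have [[? ->]|[? ->]|[/andP[? ?] ->]] := clampP a t h0; apply/andP; split; lra.
Qed.

Lemma clamp_id (a h t : R) : 0 <= h -> `|t - a| <= h -> clamp a h t = t.
Proof.
move=> h0; rewrite ler_norml => /andP[h1 h2].
by have [[? ->]|[? ->]|[/andP[? ?] ->]] := clampP a t h0; lra.
Qed.

Lemma clamp_lip (a h t s : R) : 0 <= h -> `|clamp a h t - clamp a h s| <= `|t - s|.
Proof.
move=> h0; have : - `|t - s| <= t - s <= `|t - s| by rewrite -ler_norml.
have : 0 <= `|t - s| by exact: normr_ge0.
move: `|t - s| => n n0 /andP[h1 h2].
rewrite ler_norml.
have [[? ->]|[? ->]|[/andP[? ?] ->]] := clampP a t h0;
by have [[? ->]|[? ->]|[/andP[? ?] ->]] := clampP a s h0; apply/andP; split; lra.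
Qed.

Lemma lipschitz_continuous (V W : normedModType R) (f : V -> W) (L : R) :
  (forall x y, `|f x - f y| <= L * `|x - y|) -> continuous f.
Proof.
move=> fL x; apply/cvgrPdist_le => e e0.
have L0 : 0 < `|L| + 1 by rewrite ltr_wpDl.
have eL : 0 < e / (`|L| + 1) by rewrite divr_gt0.
near=> y; apply: le_trans (fL _ _) _.
apply: (@le_trans _ _ ((`|L| + 1) * `|x - y|)).
  by rewrite ler_wpM2r// ler_wpDr//; exact: ler_norm.
rewrite -ler_pdivlMl// mulrC; apply: ltW.
by near: y; apply: (@cvgr_dist_lt _ _ _ (nbhs x) _ id).
Unshelve. all: by end_near. Qed.

Lemma clamp_continuous (a h : R) : 0 <= h -> continuous (clamp a h).
Proof.
move=> h0; apply: (@lipschitz_continuous _ _ _ 1) => x y; rewrite mul1r; exact: clamp_lip.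
Qed.

(** Picard iteration for a globally Lipschitz field. Time is clamped to [-h, h], so that the
    iterates are continuous on all of R and the sup-norm estimates hold for every t; L h <= 1/2
    makes [T] halve distances. *)
Lemma picard_lipschitz n (X : 'rV[R]_n -> 'rV[R]_n) (a0 : 'rV[R]_n) (L : R) : 0 < L ->
  (forall x y, `|X x - X y| <= L * `|x - y|) ->
  exists (h : R) (g : R -> 'rV[R]_n),
    [/\ 0 < h, g 0 = a0 & forall t, `|t| < h -> is_derive t (1 : R) g (X (g t))].
Proof.
move=> L0 XL.
have cX : continuous X by exact: (@lipschitz_continuous _ _ _ L).
have [h [h0 h1 hL]] : exists h : R, [/\ 0 < h, h < 1 & L * h <= 2^-1].
  exists (2^-1 / (L + 1)); have L10 : 0 < L + 1 by rewrite ltr_wpDl// ltW.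
  split; first by rewrite divr_gt0.
    by rewrite ltr_pdivrMr// mul1r; lra.
  by rewrite mulrCA ler_piMr// ler_pdivrMr// mul1r lerDl.
(* A chosen antiderivative vanishing at 0, so that [T g] below is [a0] plus the integral of X(g). *)
pose A (f : R -> R) : R -> R :=
  get [set F | F 0 = 0 /\ forall t, `|t| < 1 -> is_derive t (1 : R) F (f t)].
have AP f : continuous f -> A f 0 = 0 /\ forall t, `|t| < 1 -> is_derive t (1 : R) (A f) (f t).
  by move=> /exists_antiderivative ex; have := getPex ex.
pose c := clamp 0 h.
pose T (g : R -> 'rV[R]_n) (t : R) : 'rV[R]_n :=
  \row_j (a0 0 j + A (fun s => X (g s) 0 j) (c t)).
have cT0 (g : R -> 'rV[R]_n) j : continuous g -> continuous (fun s => X (g s) 0 j).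
  move=> cg s; apply: (@continuous_comp _ _ _ (fun s => X (g s)) (fun y : 'rV[R]_n => y 0 j)).
    by apply: continuous_comp; [exact: cg|exact: cX].
  exact: coord_continuous.
have ch t : `|c t| <= h by have := @clamp_dist 0 h t (ltW h0); rewrite subr0.
have ch1 t : `|c t| < 1 by apply: le_lt_trans h1.
have cT g : continuous g -> continuous (T g).
  move=> cg t; apply/continuous_coordP => j.
  rewrite (_ : (fun y => T g y 0 j) = fun y => a0 0 j + A (fun s => X (g s) 0 j) (c y)); last first.
    by apply/funext => y; rewrite mxE.
  apply: cvgD; first exact: cvg_cst.
  apply: continuous_comp; first by apply: clamp_continuous; exact: ltW.
  have [_ /(_ (c t) (ch1 t))[dA _]] := AP _ (cT0 g j cg).
  exact/differentiable_continuous/derivable1_diffP.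
have TT (g g' : R -> 'rV[R]_n) D : continuous g -> continuous g' ->
    (forall t, `|g t - g' t| <= D) -> forall t, `|T g t - T g' t| <= D / 2.
  move=> cg cg' gD t.
  have D0 : 0 <= D by exact: le_trans (normr_ge0 _) (gD 0).
  apply: rV_norm_le => [|j]; first by rewrite divr_ge0.
  rewrite !mxE opprD addrACA subrr add0r.
  have [A0 dA] := AP _ (cT0 g j cg); have [A0' dA'] := AP _ (cT0 g' j cg').
  have := @derive_bound_line
    (fun s => A (fun s => X (g s) 0 j) s - A (fun s => X (g' s) 0 j) s)
    (fun s => X (g s) 0 j - X (g' s) 0 j) (c t) (L * D).
  rewrite A0 A0' subrr subr0 => H.
  apply: (le_trans (H _ _)).
  - move=> s st; have s1 : `|s| < 1 by exact: le_lt_trans (ch1 t).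
    exact: is_deriveB (dA s s1) (dA' s s1).
  - move=> s _; have := norm_coord_le (X (g s) - X (g' s)) j; rewrite !mxE.
    move=> /le_trans; apply; apply: le_trans (XL _ _) _.
    by rewrite ler_pM2l.
  apply: (@le_trans _ _ (L * D * h)).
    by apply: ler_wpM2l => //; rewrite mulr_ge0// ltW.
  by rewrite mulrAC mulrC ler_wpM2l.
pose u k := iter k T (fun=> a0).
have cu k : continuous (u k).
  by elim: k => [|k IH] /=; [exact: cst_continuous|exact: cT].
have [D HD] : exists D : R, forall t, `|u 1%N t - u 0%N t| <= D.
  exists (\sum_(j < n) `|X a0 0 j| * h) => t.
  have S0 : 0 <= \sum_(j < n) `|X a0 0 j| * h.
    by apply: sumr_ge0 => j _; rewrite mulr_ge0// ltW.
  apply: rV_norm_le => // j; rewrite /= !mxE addrAC subrr add0r.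
  have [A0 dA] := AP _ (cT0 (fun=> a0) j (@cst_continuous _ _ _)).
  have := @derive_bound_line (A (fun s => X a0 0 j)) (fun s => X a0 0 j) (c t) `|X a0 0 j|.
  rewrite A0 subr0 => H; apply: (le_trans (H _ _)) => //.
    by move=> s st; apply: dA; exact: le_lt_trans (ch1 t).
  rewrite (bigD1 j)//=; apply: (@le_trans _ _ (`|X a0 0 j| * h)).
    by rewrite ler_wpM2l.
  by rewrite lerDl; apply: sumr_ge0 => i _; rewrite mulr_ge0// ltW.
have du k t : `|u k.+1 t - u k t| <= D / 2 ^+ k.
  elim: k t => [|k IH] t; first by rewrite expr0 divr1; exact: HD.
  rewrite exprSr invfM mulrA /=; exact: (TT (u k.+1) (u k)).
(* The limit is taken pointwise, but the rate 2D/2^k is uniform in t; this gives continuity of [g]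
   and T g = g. *)
have /choice[g Hg] : forall t, exists l, forall k, `|l - u k t| <= 2 * D / 2 ^+ k.
  by move=> t; apply: (@geometric_limit 'rV[R]_n) => k; exact: du.
have small e : 0 < e -> exists k, 2 * D / 2 ^+ k <= e.
  move=> e0; have h21 : `|2^-1 : R| < 1 by rewrite ger0_norm ?invr_ge0// invf_lt1// ltr1n.
  have /cvgrPdist_lt/(_ _ e0)[N _ HN] := @cvg_geometric R (2 * D) 2^-1 h21.
  exists N; have := HN N (leqnn N); rewrite sub0r normrN /geometric /= exprVn => /ltW.
  by apply: le_trans; exact: ler_norm.
have cg : continuous g.
  move=> t; apply/cvgrPdist_le => e e0.
  have e30 : 0 < e / 3 by rewrite divr_gt0.
  have [k Hk] := small _ e30.
  have /cvgrPdist_le/(_ _ e30) := cu k t; apply: filterS => s us.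
  rewrite -(subrKA (u k t)) -(subrKA (u k s) (u k t)).
  apply: le_trans (ler_normD _ _) _.
  have -> : e = e / 3 + (e / 3 + e / 3) by field.
  apply: lerD; first exact: le_trans (Hg t k) Hk.
  apply: le_trans (ler_normD _ _) _; apply: lerD => //.
  rewrite distrC; exact: le_trans (Hg s k) Hk.
have Tg t : T g t = g t.
  apply/eqP; rewrite -subr_eq0 -normr_le0; apply/ler_addgt0Pl => e e0; rewrite addr0.
  have e20 : 0 < e / 2 by rewrite divr_gt0.
  have [k Hk] := small _ e20.
  rewrite -(subrKA (u k.+1 t)) [e]splitr.
  have D0 : 0 <= 2 * D / 2 ^+ k by apply: le_trans (Hg t k).
  apply: le_trans (ler_normD _ _) _; apply: lerD.
    apply: le_trans (TT g (u k) _ cg (cu k) (fun s => Hg s k) t) _.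
    apply: le_trans Hk; rewrite ler_pdivrMr// ler_peMr// ler1n//.
  rewrite distrC; apply: le_trans (Hg t k.+1) _; apply: le_trans Hk.
  by rewrite exprSr invfM mulrA ler_pdivrMr// ler_peMr// ler1n.
have c0 : c 0 = 0 by apply: clamp_id; rewrite ?subrr ?normr0 ltW.
exists h, g; split=> //.
  rewrite -Tg; apply/rowP => j; rewrite mxE c0.
  by have [-> _] := AP _ (cT0 g j cg); rewrite addr0.
move=> t th.
have t1 : `|t| < 1 by exact: lt_trans h1.
have nt : \forall s \near t, g s = \row_j (a0 0 j + A (fun s => X (g s) 0 j) s).
  have : \forall s \near t, `|s| < h.
    have bt : ball (0 : R) h t by rewrite -ball_normE /= sub0r normrN.
    apply: filterS (open_nbhs_nbhs (conj (@ball_open _ _ 0 h) bt)) => s.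
    by rewrite -ball_normE /= sub0r normrN.
  by apply: filterS => s sh; rewrite -Tg /T /c clamp_id// ?subr0 ltW.
have nt' : \forall s \near t, \row_j (a0 0 j + A (fun s => X (g s) 0 j) s) = g s.
  by apply: filterS nt => s ->.
apply: near_eq_is_derive nt' _.
have dj j : is_derive t (1 : R) (fun s => a0 0 j + A (fun s => X (g s) 0 j) s) (X (g t) 0 j).
  have [_ /(_ t t1) dA] := AP _ (cT0 g j cg).
  rewrite -[X in is_derive _ _ _ X]add0r.
  exact: is_deriveD (is_derive_cst _ _ _) dA.
have dr : derivable (fun s => \row_j (a0 0 j + A (fun s => X (g s) 0 j) s)) t (1 : R).
  apply/derivable_mxP => i j; rewrite (ord1 i).
  by under eq_fun do rewrite mxE; have [] := dj j.
split=> //; apply/rowP => j; rewrite derive_mx// mxE.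
by under eq_fun do rewrite mxE; have [] := dj j.
Qed.

(** Clamping the coordinates to a cube on which [X] is Lipschitz makes the field globally Lipschitz.
    For a short time the solution stays in the cube, where the field is unchanged. Smoothness is
    bootstrapped from g' = X(g). *)
Lemma integral_curve n (X : 'rV[R]_n -> 'rV[R]_n) (U : set 'rV[R]_n) (a0 : 'rV[R]_n) :
  open U -> U a0 -> smooth_on U X ->
  exists (h : R) (g : R -> 'rV[R]_n), [/\ 0 < h, smooth_on (ball (0 : R) h) g, g 0 = a0,
    forall t, ball (0 : R) h t -> U (g t) &
    forall t, ball (0 : R) h t -> is_derive t (1 : R) g (X (g t))].
Proof.
move=> oU Ua sX.
have /nbhs_ballP[r1 /= r10 Hr1] : nbhs a0 U by exact: open_nbhs_nbhs.
have [K K0 HK] := linear_rV_bounded ('d X a0).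
have [r [r0 rr1 Hr]] : exists r : R, [/\ 0 < r, r <= r1 &
    forall x y : 'rV[R]_n, ball a0 r x -> ball a0 r y ->
    `|X y - X x - 'd X a0 (y - x)| <= 1 * `|y - x|].
  have := strict_diff oU Ua (sX 1%N) ltr01 => H.
  near (0 : R)^'+ => d; exists d; split=> //.
  - by near: d; exact: nbhs_right_le.
  - by near: d.
have r20 : 0 < r / 2 by rewrite divr_gt0.
pose rho (x : 'rV[R]_n) : 'rV[R]_n := \row_j clamp (a0 0 j) (r / 2) (x 0 j).
have rhoB x : ball a0 r (rho x).
  rewrite -ball_normE /=; apply: (@le_lt_trans _ _ (r / 2)).
    apply: rV_norm_le => [|j]; first by rewrite divr_ge0// ltW.
    by rewrite !mxE distrC; apply: clamp_dist; rewrite divr_ge0// ltW.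
  by rewrite ltr_pdivrMr// ltr_pMr// ltr1n.
have rhoL x y : `|rho x - rho y| <= `|x - y|.
  apply: rV_norm_le => // j; rewrite !mxE; apply: le_trans (clamp_lip _ _ _ (ltW r20)) _.
  by have := norm_coord_le (x - y) j; rewrite !mxE.
have XL x y : `|X (rho x) - X (rho y)| <= (K + 1) * `|x - y|.
  apply: (@le_trans _ _ ((K + 1) * `|rho x - rho y|)); last first.
    by rewrite ler_pM2l// ltr_wpDl// ltW.
  rewrite -[X (rho x) - _](subrK ('d X a0 (rho x - rho y))).
  apply: le_trans (ler_normD _ _) _; rewrite mulrDl addrC lerD//.
  exact: Hr.
have K10 : 0 < K + 1 by rewrite ltr_wpDl// ltW.
have [h1 [g [h10 g0 dg]]] := picard_lipschitz a0 K10 XL.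
have cg t : `|t| < h1 -> {for t, continuous g}.
  by move=> /dg[+ _] => /derivable1_diffP; exact: differentiable_continuous.
have : \forall t \near (0 : R), ball a0 (r / 2) (g t).
  apply: (cg 0); first by rewrite normr0.
  by rewrite g0; exact: nbhsx_ballx.
move=> /nbhs_ballP[h2 /= h20 Hh2].
have bh t : ball (0 : R) (Num.min h1 h2) t -> `|t| < h1 /\ ball a0 (r / 2) (g t).
  move=> bt; split; last by apply: Hh2; apply: le_ball bt; rewrite ge_min lexx orbT.
  by move: bt; rewrite -ball_normE /= sub0r normrN lt_min => /andP[].
have Ug t : ball (0 : R) (Num.min h1 h2) t -> U (g t).
  move=> /bh[_ bg]; apply: Hr1; apply: le_ball bg; apply: le_trans rr1.
  by lra.
have dg' t : ball (0 : R) (Num.min h1 h2) t -> is_derive t (1 : R) g (X (g t)).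
  move=> /bh[th bg]; have := dg t th; suff -> : rho (g t) = g t by [].
  apply/rowP => j; rewrite mxE; apply: clamp_id; first exact: ltW.
  rewrite distrC.
  have := norm_coord_le (a0 - g t) j; rewrite !mxE => /le_trans; apply.
  by move: bg; rewrite -ball_normE => /ltW.
exists (Num.min h1 h2), g; split=> //; first by rewrite lt_min h10.
have oB : open (ball (0 : R) (Num.min h1 h2)) by exact: ball_open.
have df t : ball (0 : R) (Num.min h1 h2) t -> differentiable g t.
  by move=> /dg'[+ _] => /derivable1_diffP.
elim=> [|k IH].
  by move=> t /df; exact: differentiable_continuous.
split=> // v; apply/Ck_coordP => // j.
have : Ck k (ball (0 : R) (Num.min h1 h2)) (fun t => v * X (g t) 0 j).
  apply: CkM => //; first exact: Ck_cst.
  exact: (iffLR (Ck_coordP _ _ oB) (Ck_comp oB oU Ug IH (sX k)) j).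
apply: Ck_eq => // t bt; rewrite deriveE; last exact: df.
have -> : v = v *: (1 : R) by rewrite [RHS]mulr1.
rewrite linearZ mxE -deriveE; last exact: df.
by have [_ ->] := dg' t bt; rewrite [v *: _]mulr1.
Unshelve. all: by end_near. Qed.

End Picard.

Section Dot.
Variables (R : realType) (n : nat).
Implicit Types x y z : 'rV[R]_n.

Lemma dotE x y : dot x y = (x *m y^T) 0 0.
Proof. by rewrite mxE; apply: eq_bigr => i _; rewrite mxE. Qed.

Lemma dotC x y : dot x y = dot y x.
Proof. by apply: eq_bigr => i _; rewrite mulrC. Qed.

Lemma dotDl x y z : dot (x + y) z = dot x z + dot y z.
Proof. by rewrite -big_split; apply: eq_bigr => i _; rewrite mxE mulrDl. Qed.

Lemma dotDr x y z : dot z (x + y) = dot z x + dot z y.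
Proof. by rewrite dotC dotDl !(dotC z). Qed.

Lemma dotZl c x y : dot (c *: x) y = c * dot x y.
Proof. by rewrite mulr_sumr; apply: eq_bigr => i _; rewrite mxE mulrA. Qed.

Lemma dotZr c x y : dot x (c *: y) = c * dot x y.
Proof. by rewrite dotC dotZl dotC. Qed.

Lemma dotNl x y : dot (- x) y = - dot x y.
Proof. by rewrite -scaleN1r dotZl mulN1r. Qed.

Lemma dotNr x y : dot x (- y) = - dot x y.
Proof. by rewrite dotC dotNl dotC. Qed.

Lemma dotBl x y z : dot (x - y) z = dot x z - dot y z.
Proof. by rewrite dotDl dotNl. Qed.

Lemma dotBr x y z : dot z (x - y) = dot z x - dot z y.
Proof. by rewrite dotDr dotNr. Qed.

Lemma dot0l x : dot 0 x = 0.
Proof. by rewrite -(scale0r 0) dotZl mul0r. Qed.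

Lemma dot0r x : dot x 0 = 0.
Proof. by rewrite dotC dot0l. Qed.

Lemma dot_ge0 x : 0 <= dot x x.
Proof. by apply: sumr_ge0 => i _; rewrite -expr2 sqr_ge0. Qed.

Lemma dot_eq0 x : dot x x = 0 -> x = 0.
Proof.
move=> /eqP; rewrite psumr_eq0 => [/allP H|i _]; last by rewrite -expr2 sqr_ge0.
apply/rowP => i; have := H i (mem_index_enum i).
by rewrite mulf_eq0 orbb mxE => /eqP.
Qed.

Lemma dot_gt0 x : x != 0 -> 0 < dot x x.
Proof.
move=> x0; rewrite lt_neqAle dot_ge0 andbT eq_sym; apply: contra_neq x0.
exact: dot_eq0.
Qed.

Lemma is_derive_coord (V : normedModType R) (F : V -> 'rV[R]_n) (x v : V) (dF : 'rV[R]_n) j :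
  is_derive x v F dF -> is_derive x v (fun t => F t 0 j) (dF 0 j).
Proof.
move=> [dv <-]; split; first exact: (iffLR (derivable_mxP _ _ _) dv).
by rewrite derive_coord.
Qed.

Lemma is_derive_dot (V : normedModType R) (F G : V -> 'rV[R]_n) (x v : V) (dF dG : 'rV[R]_n) :
  is_derive x v F dF -> is_derive x v G dG ->
  is_derive x v (fun t => dot (F t) (G t)) (dot dF (G x) + dot (F x) dG).
Proof.
move=> HF HG.
have -> : (fun t => dot (F t) (G t)) = \sum_(j < n) (fun t => F t 0 j * G t 0 j).
  by apply/funext => t; rewrite fct_sumE.
have -> : dot dF (G x) + dot (F x) dG =
    \sum_(j < n) (F x 0 j *: dG 0 j + G x 0 j *: dF 0 j).
  rewrite /dot -big_split /=; apply: eq_bigr => j _.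
  by rewrite addrC [X in _ + X]mulrC.
apply: is_derive_sum => j.
exact: (is_deriveM (is_derive_coord j HF) (is_derive_coord j HG)).
Qed.

Lemma Ck_dot (V : normedModType R) (U : set V) (F G : V -> 'rV[R]_n) k : open U ->
  Ck k U F -> Ck k U G -> Ck k U (fun t => dot (F t) (G t)).
Proof.
move=> oU CF CG; apply: Ck_sum => // j; apply: CkM => //.
  exact: (iffLR (Ck_coordP _ _ oU) CF j).
exact: (iffLR (Ck_coordP _ _ oU) CG j).
Qed.

End Dot.

(** * Tangent spaces and shape operator of a hypersurface of the sphere *)

Section Hypersurface.
Variables (R : realType).

Lemma curve_dot_const n N (F G : 'rV[R]_N -> 'rV[R]_n) (D : set 'rV[R]_N) x v (c : R) :
  smooth_map D F -> smooth_map D G -> tangent D x v ->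
  (forall y, D y -> dot (F y) (G y) = c) ->
  dot (tdiff D F x v) (G x) + dot (F x) (tdiff D G x v) = 0.
Proof.
move=> sF sG /tangentP[gamma cg dg] FG.
have [e [_ _ _ g0]] := cg.
have := is_derive_dot (tdiff_derive sF cg dg) (tdiff_derive sG cg dg).
rewrite /= g0 => H; apply: is_derive_unique H _.
have dc : is_derive (0 : R) (1 : R) (cst c : R -> R) 0 by exact: is_derive_cst.
apply: near_eq_is_derive dc.
by apply: filterS (curve_near cg) => t Dt; rewrite FG.
Qed.

(** One inclusion comes from differentiating |x| = 1 and from the definition of a normal. The other
    is a dimension count: the complement of the orthonormal pair [x], [xi x] has dimension m, which
    is the rank of the chart. *)
Lemma hypersurface_tangent m (D : set 'rV[R]_m.+2) xi x v :
  @oriented_hypersurface R m.+2 m.+1 D idfun xi -> D x ->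
  tangent D x v <-> dot v x = 0 /\ dot v (xi x) = 0.
Proof.
move=> H Dx; have sub := oh_submanifold H.
have perp u : tangent D x u -> dot u x = 0 /\ dot u (xi x) = 0.
  move=> Tu; split; last first.
    by have := oh_normal H Dx Tu; rewrite (tdiff_id Dx Tu) dotC.
  have := curve_dot_const (oh_smooth H) (oh_smooth H) Tu (oh_sphere H).
  rewrite (tdiff_id Dx Tu) /= [X in _ + X]dotC => /eqP.
  by rewrite -mulr2n mulrn_eq0 /= => /eqP.
split; first exact: perp.
move=> [vx vxi]; have [W [Om [phi [oW Wx oO dphi]]]] := sub x Dx.
have [a Oa phia] : exists2 a, Om a & phi a = x.
  by have : (D `&` W) x by []; rewrite -(diffeo_image dphi) => -[a Oa <-]; exists a.
rewrite -phia; apply/(tangent_chart _ oW oO dphi Oa).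
pose J : 'M[R]_(m, m.+2) := jacobian phi a.
pose C := col_mx x (xi x).
have CE (u : 'rV[R]_m.+2) : dot u x = 0 -> dot u (xi x) = 0 -> u *m C^T = 0.
  rewrite !dotE /C tr_col_mx mul_mx_row => u1 u2.
  rewrite -[RHS](row_mx0 _ _ 1%N 1%N); congr (row_mx _ _); apply/matrixP => i j;
  by rewrite (ord1 i) (ord1 j) [RHS]mxE.
have rC : \rank C^T = 2%N.
  rewrite mxrank_tr; apply/eqP; rewrite -[_ == _]/(row_free C); apply/row_freeP.
  exists C^T; rewrite /C tr_col_mx mul_col_row scalar_mx_block.
  have E (u w : 'rV[R]_m.+2) (c : R) : dot u w = c -> u *m w^T = c%:M.
    by rewrite dotE => <-; rewrite -mx11_scalar.
  rewrite !(E _ _ _ erefl) (dotC x).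
  have -> : dot x x = 1 by exact: (oh_sphere H Dx).
  have -> : dot (xi x) (xi x) = 1 by exact: (oh_normal_unit H Dx).
  have -> : dot (xi x) x = 0 by exact: (oh_normal_sphere H Dx).
  by rewrite !raddf0.
have rJ : \rank J = m.
  apply/eqP; rewrite -[_ == _]/(row_free J); apply: inj_row_free => w.
  by rewrite -jacobianE; exact: diffeo_diff_inj oO dphi Oa.
have JK : (J <= kermx C^T)%MS.
  apply/sub_kermxP/row_matrixP => i; rewrite row_mul row0.
  have -> : row i J = 'd phi a (delta_mx 0 i) by rewrite jacobianE -rowE.
  have /perp[] : tangent D x ('d phi a (delta_mx 0 i)).
    by rewrite -phia; apply/(tangent_chart _ oW oO dphi Oa); exists (delta_mx 0 i).
  exact: CE.
have : (kermx C^T <= J)%MS.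
  have := mxrank_leqif_sup JK; rewrite mxrank_ker rC rJ !subSS subn0 => -[_ <-].
  exact: eqxx.
move=> KJ; have : (v <= J)%MS.
  by apply: submx_trans KJ; apply/sub_kermxP; exact: CE.
by move=> /submxP[w ->]; exists w; rewrite jacobianE.
Qed.

Lemma shape_eigenspaceP n d (D : set 'rV[R]_n.+1) (xi : 'rV[R]_n.+1 -> 'rV[R]_n.+1) x k X :
  submanifold d D -> D x -> @shape_eigenspace R n.+1 n D idfun xi x k X <->
  tangent D x X /\ tdiff D xi x X = - (k *: X).
Proof.
move=> sD Dx; split=> [[TX TkX]|[TX E]].
  by rewrite (tdiff_id Dx TkX) => ->; rewrite opprK; split.
have TkX := submanifold_tangentZ k sD Dx TX.
by split; [exact: TX|exact: TkX|rewrite (tdiff_id Dx TkX) E opprK].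
Qed.

(** Differentiating <xi, x> = 0 and <xi, xi> = 1 gives orthogonality to both [x] and [xi x]. *)
Lemma shape_tangent m (D : set 'rV[R]_m.+2) xi x v :
  @oriented_hypersurface R m.+2 m.+1 D idfun xi -> D x -> tangent D x v ->
  tangent D x (tdiff D xi x v).
Proof.
move=> H Dx Tv; apply/(hypersurface_tangent _ H Dx).
have [_ v2] := iffLR (hypersurface_tangent _ H Dx) Tv.
have sx := oh_normal_smooth H; split.
  have := curve_dot_const sx (oh_smooth H) Tv (oh_normal_sphere H).
  by rewrite (tdiff_id Dx Tv) [X in _ + X]dotC v2 addr0.
have := curve_dot_const sx sx Tv (oh_normal_unit H).
by rewrite [X in _ + X]dotC => /eqP; rewrite -mulr2n mulrn_eq0 /= => /eqP.
Qed.

Lemma tdiff_chart N d m (D W : set 'rV[R]_N) (Om : set 'rV[R]_d) phi (F : 'rV[R]_N -> 'rV[R]_m) a w :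
  open Om -> diffeomorphism Om (D `&` W) phi -> Om a -> smooth_map D F ->
  smooth_on Om (fun b => F (phi b)) /\
  tdiff D F (phi a) ('d phi a w) = 'd (fun b => F (phi b)) a w.
Proof.
move=> oO [sphi [psi [spsi H1 H2]]] Oa sF.
have sFphi : smooth_on Om (fun b => F (phi b)).
  apply/smooth_map_open => //; apply: smooth_map_comp sphi sF.
  by move=> b /H1[[]].
split=> //.
have dl n (G : 'rV[R]_d -> 'rV[R]_n) : smooth_on Om G ->
    is_derive (0 : R) (1 : R) (fun t : R => G (a + t *: w)) ('d G a w).
  by move=> sG; apply/is_derive_line0/(smooth_on_differentiable sG).
have cphi : curve_in D (phi a) (fun t : R => phi (a + t *: w)).
  by apply: (curve_push sphi _ (curve_line w oO Oa)) => b /H1[[]].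
apply: (is_derive_unique (tdiff_derive sF cphi (dl _ phi _))).
  exact/smooth_map_open.
exact: dl.
Qed.

End Hypersurface.

Section MatrixSmooth.
Variables (R : realType) (V : normedModType R) (U : set V).
Hypothesis oU : open U.

Lemma Ck_row_mx n1 n2 (F1 : V -> 'rV[R]_n1) (F2 : V -> 'rV[R]_n2) k :
  Ck k U F1 -> Ck k U F2 -> Ck k U (fun x => row_mx (F1 x) (F2 x)).
Proof.
move=> C1 C2; apply/Ck_coordP => // j; rewrite -(splitK j).
case: (fintype.split j) => i /=.
  by under eq_fun do rewrite row_mxEl; exact: (iffLR (Ck_coordP _ _ oU) C1 i).
by under eq_fun do rewrite row_mxEr; exact: (iffLR (Ck_coordP _ _ oU) C2 i).
Qed.

Lemma Ck_mulmx n m (F : V -> 'rV[R]_n) (A : V -> 'M[R]_(n, m)) k :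
  Ck k U F -> (forall i j, Ck k U (fun x => A x i j)) -> Ck k U (fun x => F x *m A x).
Proof.
move=> CF CA; apply/Ck_coordP => // j; under eq_fun do rewrite mxE.
by apply: Ck_sum => // i; apply: CkM => //; exact: (iffLR (Ck_coordP _ _ oU) CF i).
Qed.

Lemma CkZ n (a : V -> R) (F : V -> 'rV[R]_n) k : Ck k U a -> Ck k U F ->
  Ck k U (fun x => a x *: F x).
Proof.
move=> Ca CF; apply/Ck_coordP => // j; under eq_fun do rewrite mxE.
by apply: CkM => //; exact: (iffLR (Ck_coordP _ _ oU) CF j).
Qed.

Lemma Ck_scalar_mx (a : V -> R) k : Ck k U a -> Ck k U (fun x => (a x)%:M : 'rV[R]_1).
Proof.
move=> Ca; apply/Ck_coordP => // j.
by under eq_fun do rewrite mxE (ord1 j) /= mulr1n.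
Qed.

End MatrixSmooth.

Lemma Ck_rV_linear (R : realType) n m (U : set 'rV[R]_n) (L : {linear 'rV[R]_n -> 'rV[R]_m}) :
  smooth_on U L.
Proof. by move=> k; exact: Ck_linear (@linear_rV_continuous _ _ _ _). Qed.

(** * Smooth dependence of a simple eigenvalue and its eigenvector *)

Section SimpleEigenpair.
Variables (R : realType) (p n : nat).

(** The map inverted in [simple_eigenpair] is quadratic along the lines that matter, so its
    differential is read off as a linear coefficient. *)
Lemma is_derive_quadratic (m : nat) (P0 P1 P2 : 'rV[R]_m) :
  is_derive (0 : R) (1 : R) (fun t : R => P0 + t *: P1 + t ^+ 2 *: P2) P1.
Proof.
have dj j : is_derive (0 : R) (1 : R)
    (fun t : R => P0 0 j + t * P1 0 j + t ^+ 2 * P2 0 j) (P1 0 j).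
  have d1 : is_derive (0 : R) (1 : R) (id : R -> R) 1 by exact: is_derive_id.
  have dc (c : R) : is_derive (0 : R) (1 : R) (cst c : R -> R) 0 by exact: is_derive_cst.
  rewrite (_ : (fun t : R => _) = cst (P0 0 j) + id * cst (P1 0 j) + id ^+ 2 * cst (P2 0 j));
    last by apply/funext => t; rewrite !fctE.
  apply: is_derive_eq (is_deriveD (is_deriveD (dc (P0 0 j)) (is_deriveM d1 (dc (P1 0 j))))
                     (is_deriveM (is_deriveX 2 d1) (dc (P2 0 j)))) _.
  rewrite /GRing.scale /= /cst expr1 !mulr0 !add0r.
  by rewrite !mul0r !mulr0 !addr0 mulr1.
have dr : derivable (fun t : R => P0 + t *: P1 + t ^+ 2 *: P2) (0 : R) (1 : R).
  apply/derivable_mxP => i j; rewrite (ord1 i).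
  by under eq_fun do rewrite !mxE; have [] := dj j.
split=> //; apply/rowP => j; rewrite derive_mx// mxE.
by under eq_fun do rewrite !mxE; have [] := dj j.
Qed.

Variables (Om : set 'rV[R]_p) (A B : 'rV[R]_p -> 'M[R]_n).
Hypothesis oO : open Om.
Hypothesis sA : forall i j, smooth_on Om (fun a => A a i j).
Hypothesis sB : forall i j, smooth_on Om (fun a => B a i j).
Hypothesis symA : forall a, Om a -> (A a)^T = A a.
Hypothesis symB : forall a, Om a -> (B a)^T = B a.
Hypothesis posB : forall a w, Om a -> dot (w *m B a) w = 0 -> w = 0.

(** The generalized eigenvalue problem of a symmetric pencil. In a chart the matrix of the shape
    operator need not be symmetric, whereas both fundamental forms are. *)
Definition pencil_eigen (a : 'rV[R]_p) (k : R) (w : 'rV[R]_n) := w *m A a = k *: (w *m B a).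

Lemma dot_mulmx_sym (M : 'M[R]_n) u v : M^T = M -> dot (u *m M) v = dot u (v *m M).
Proof. by move=> sM; rewrite !dotE trmx_mul sM mulmxA. Qed.

(** The inverse function theorem for (a, w, k) |-> (a, w A - k w B, <w, w0>). Its differential at
    (a0, w0, k0) is injective because k0 is simple. The last entry normalizes [w], and the eigenpair
    over [a] is the preimage of (a, 0, <w0, w0>). *)
Lemma simple_eigenpair a0 k0 w0 : Om a0 -> w0 != 0 -> pencil_eigen a0 k0 w0 ->
  (forall u, pencil_eigen a0 k0 u -> exists c, u = c *: w0) ->
  exists (Om' : set 'rV[R]_p) (kap : 'rV[R]_p -> R) (w : 'rV[R]_p -> 'rV[R]_n),
  [/\ open Om', Om' a0, Om' `<=` Om, smooth_on Om' kap /\ smooth_on Om' w &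
      kap a0 = k0 /\ forall a, Om' a -> [/\ w a != 0, pencil_eigen a (kap a) (w a) &
        forall u, pencil_eigen a (kap a) u -> exists c, u = c *: w a]].
Proof.
move=> Oa w00 Ew0 simple.
pose la (z : 'rV[R]_(p + (n + 1))) : 'rV[R]_p := lsubmx z.
pose lw (z : 'rV[R]_(p + (n + 1))) : 'rV[R]_n := lsubmx (rsubmx z).
pose lk (z : 'rV[R]_(p + (n + 1))) : R := rsubmx (rsubmx z) 0 0.
have lwD (z v : 'rV[R]_(p + (n + 1))) (t : R) : lw (z + t *: v) = lw z + t *: lw v.
  by apply/rowP => j; rewrite !mxE.
have lkD (z v : 'rV[R]_(p + (n + 1))) (t : R) : lk (z + t *: v) = lk z + t * lk v.
  by rewrite /lk !mxE.
pose F (z : 'rV[R]_(p + (n + 1))) : 'rV[R]_(p + (n + 1)) :=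
  row_mx (la z) (row_mx (lw z *m A (la z) - lk z *: (lw z *m B (la z)))
                        ((dot (lw z) w0)%:M : 'rV_1)).
pose U : set 'rV[R]_(p + (n + 1)) := setT `&` la @^-1` Om.
have sla k (U' : set 'rV[R]_(p + (n + 1))) : Ck k U' la.
  exact: (Ck_rV_linear U' (lsubmx : {linear 'rV[R]_(p + (n + 1)) -> 'rV[R]_p})).
have srs k (U' : set 'rV[R]_(p + (n + 1))) :
    Ck k U' (rsubmx : 'rV[R]_(p + (n + 1)) -> 'rV[R]_(n + 1)).
  exact: (Ck_rV_linear U' (rsubmx : {linear 'rV[R]_(p + (n + 1)) -> 'rV[R]_(n + 1)})).
have slw k (U' : set 'rV[R]_(p + (n + 1))) : open U' -> Ck k U' lw.
  move=> oU'; apply: (Ck_comp (U' := setT) (G := lsubmx) oU' openT _ (srs k U')) => //.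
  exact: (Ck_rV_linear setT (lsubmx : {linear 'rV[R]_(n + 1) -> 'rV[R]_n})).
have slk k (U' : set 'rV[R]_(p + (n + 1))) : open U' -> Ck k U' lk.
  move=> oU'.
  have := Ck_comp (U' := setT) (G := rsubmx) oU' openT (fun _ _ => I) (srs k U')
    (Ck_rV_linear setT (rsubmx : {linear 'rV[R]_(n + 1) -> 'rV[R]_1}) k).
  by move=> /(Ck_coordP _ _ oU')/(_ 0).
have oU : open U by exact: open_preim_Ck openT oO (sla 0%N _).
have sF : smooth_on U F.
  move=> k; apply: Ck_row_mx => //; apply: Ck_row_mx => //.
    have Aij i j : Ck k U (fun z => A (la z) i j).
      by apply: (Ck_comp_scalar oU oO _ (sla k U) (@sA i j k)) => z [].
    have Bij i j : Ck k U (fun z => B (la z) i j).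
      by apply: (Ck_comp_scalar oU oO _ (sla k U) (@sB i j k)) => z [].
    apply: CkD => //; first by apply: Ck_mulmx => //; exact: slw.
    apply: CkN => //; apply: CkZ => //; first exact: slk.
    by apply: Ck_mulmx => //; exact: slw.
  apply: Ck_scalar_mx => //; apply: Ck_dot => //; first exact: slw.
  exact: Ck_cst.
pose z0 : 'rV[R]_(p + (n + 1)) := row_mx a0 (row_mx w0 (k0%:M : 'rV_1)).
have la0 : la z0 = a0 by rewrite /la row_mxKl.
have lw0 : lw z0 = w0 by rewrite /lw row_mxKr row_mxKl.
have lk0 : lk z0 = k0 by rewrite /lk !row_mxKr mxE eqxx mulr1n.
have Uz0 : U z0 by split=> //=; rewrite la0.
have dF : differentiable F z0 by exact: smooth_on_differentiable sF Uz0.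
have w0w0 : dot w0 w0 != 0 by rewrite gt_eqF// dot_gt0.
have inj v : 'd F z0 v = 0 -> v = 0.
  move=> dv.
  have lav : la v = 0.
    have : 'D_v (fun z => la (F z)) z0 = 'D_v la z0.
      by congr ('D_v _ z0); apply/funext => z; rewrite /la /F row_mxKl.
    rewrite (derive_comp (G := la))//; last exact: (sla 1%N setT).1.
    rewrite deriveE// dv linear0 deriveE; last exact: (sla 1%N setT).1.
    by rewrite diff_lin; [move=> H; exact/esym|exact: linear_rV_continuous].
  pose dw := lw v; pose dk := lk v.
  have := is_derive_line0 v dF; rewrite dv => H1.
  pose P1 : 'rV[R]_(p + (n + 1)) := row_mx 0 (row_mx
    (dw *m A a0 - k0 *: (dw *m B a0) - dk *: (w0 *m B a0)) ((dot dw w0)%:M : 'rV_1)).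
  pose P2 : 'rV[R]_(p + (n + 1)) := row_mx 0 (row_mx (- dk *: (dw *m B a0)) (0 : 'rV_1)).
  (* Since [v] has no [a]-component, [F] is a quadratic polynomial in t along it, with linear
     coefficient [P1]. *)
  have H2 : (fun t : R => F (z0 + t *: v)) = (fun t : R => F z0 + t *: P1 + t ^+ 2 *: P2).
    apply/funext => t; rewrite /F.
    have -> : la (z0 + t *: v) = a0.
      by rewrite /la linearD linearZ /= -/(la v) lav scaler0 addr0 -/(la z0) la0.
    have -> : lw (z0 + t *: v) = w0 + t *: dw.
      by rewrite lwD lw0.
    have -> : lk (z0 + t *: v) = k0 + t * dk.
      by rewrite lkD lk0.
    rewrite la0 lw0 lk0 /P1 /P2 !scale_row_mx !add_row_mx !scaler0 !addr0.
    congr (row_mx _ (row_mx _ _)); last first.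
      by rewrite dotDl dotZl raddfD /= scale_scalar_mx.
    rewrite !mulmxDl -!scalemxAl.
    by apply/rowP => j; rewrite !mxE; ring.
  have P10 : P1 = 0.
    by rewrite H2 in H1; exact: is_derive_unique (is_derive_quadratic _ _ _) H1.
  have [E1 E2] : dw *m A a0 - k0 *: (dw *m B a0) - dk *: (w0 *m B a0) = 0 /\ dot dw w0 = 0.
    split.
      by rewrite -[LHS](row_mxKl _ ((dot dw w0)%:M : 'rV_1)) -[row_mx _ _](row_mxKr (0 : 'rV_p))
        -/P1 P10 !linear0.
    have : rsubmx (rsubmx P1) 0 0 = 0 by rewrite P10 !linear0 mxE.
    by rewrite /P1 !row_mxKr mxE eqxx mulr1n.
  (* Pairing the linearized equation with [w0] cancels the symmetric terms and leaves dk times B(w0,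
     w0). *)
  have dk0 : dk = 0.
    have : dot (dw *m A a0 - k0 *: (dw *m B a0) - dk *: (w0 *m B a0)) w0 = 0.
      by rewrite E1 dot0l.
    rewrite !dotBl !dotZl dot_mulmx_sym ?symA// Ew0 dotZr.
    rewrite (@dot_mulmx_sym (B a0) dw) ?symB// subrr sub0r => /eqP.
    rewrite oppr_eq0 mulf_eq0 => /orP[/eqP//|/eqP wB].
    by move: w00; rewrite (posB Oa wB) eqxx.
  have dw0 : dw = 0.
    move: E1; rewrite dk0 scale0r subr0 => /eqP; rewrite subr_eq0 => /eqP /simple[c Ec].
    move: E2; rewrite Ec dotZl => /eqP; rewrite mulf_eq0 (negbTE w0w0) orbF => /eqP ->.
    by rewrite scale0r.
  rewrite -[v]hsubmxK -/(la v) lav -[rsubmx v]hsubmxK -/(lw v) -/dw dw0.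
  have -> : rsubmx (rsubmx v) = 0.
    by apply/matrixP => i j; rewrite (ord1 i) (ord1 j) -/(lk v) -/dk dk0 mxE.
  by rewrite !row_mx0.
have [Bz [G [oBz Bz0 BzU oV [sG GF]]]] := inverse_function oU Uz0 sF inj.
pose y (a : 'rV[R]_p) : 'rV[R]_(p + (n + 1)) :=
  row_mx a (row_mx (0 : 'rV_n) ((dot w0 w0)%:M : 'rV_1)).
have sy k (U' : set 'rV[R]_p) : open U' -> Ck k U' y.
  move=> oU'; apply: Ck_row_mx => //; last exact: Ck_cst.
  by apply: (@Ck_linear _ _ _ _ idfun) => ?; exact.
pose Om' : set 'rV[R]_p := Om `&` y @^-1` (F @` Bz).
have oO' : open Om' by apply: open_preim_Ck (sy 0%N _ _).
have y0 : y a0 = F z0.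
  by rewrite /F la0 lw0 lk0 /y; congr (row_mx _ (row_mx _ _)); rewrite Ew0 subrr.
have sGy k : Ck k Om' (fun a => G (y a)).
  by apply: (Ck_comp oO' oV _ (sy k _ oO') (sG k)) => a [].
exists Om', (fun a => lk (G (y a))), (fun a => lw (G (y a))).
have Gy a : Om' a -> [/\ Bz (G (y a)), la (G (y a)) = a,
    pencil_eigen a (lk (G (y a))) (lw (G (y a))) & dot (lw (G (y a))) w0 = dot w0 w0].
  move=> [_ [z Bzz Fz]]; rewrite -Fz GF//; move: (Fz); rewrite /F /y.
  move=> /eq_row_mx[H1 /eq_row_mx[H2 H3]]; split=> //.
    rewrite /pencil_eigen -H1; apply/eqP; rewrite -subr_eq0; exact/eqP.
  by move/matrixP/(_ 0 0): H3; rewrite !mxE eqxx !mulr1n.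
split=> //.
- by split=> //=; rewrite y0; exists z0.
- by move=> a [].
- split=> k.
    have := Ck_comp_scalar (G := lk) oO' openT (fun _ _ => I) (sGy k).
    by apply; exact: slk openT.
  have := Ck_comp (G := lw) oO' openT (fun _ _ => I) (sGy k).
  by apply; exact: slw openT.
split; first by rewrite y0 GF.
move=> a O'a; have [BG laG EG dG] := Gy a O'a; split=> //.
  by apply: contraNneq w0w0 => w0'; rewrite -dG w0' dot0l.
(* Simplicity persists: [u'] is an eigenvector orthogonal to [w0], so adding multiples of it to the
   [w]-entry does not change [F], and injectivity of [F] on [Bz] forces u' = 0. *)
move=> u Eu; pose c := dot u w0 / dot w0 w0; exists c.
pose u' := u - c *: lw (G (y a)).
suff u'0 : u' = 0 by apply/eqP; rewrite -subr_eq0; apply/eqP.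
have u'w0 : dot u' w0 = 0 by rewrite dotBl dotZl dG /c divfK// subrr.
have Eu' : pencil_eigen a (lk (G (y a))) u'.
  by rewrite /pencil_eigen /u' !mulmxBl -!scalemxAl Eu EG scalerBr !scalerA [c * _]mulrC.
pose v : 'rV[R]_(p + (n + 1)) := row_mx 0 (row_mx u' (0 : 'rV_1)).
have lav : la v = 0 by rewrite /la row_mxKl.
have lwv : lw v = u' by rewrite /lw row_mxKr row_mxKl.
have lkv : lk v = 0 by rewrite /lk !row_mxKr mxE.
have Fv (t : R) : F (G (y a) + t *: v) = F (G (y a)).
  rewrite /F.
  have -> : la (G (y a) + t *: v) = la (G (y a)).
    by rewrite /la linearD linearZ /= -/(la v) lav scaler0 addr0.
  have -> : lw (G (y a) + t *: v) = lw (G (y a)) + t *: u'.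
    by rewrite lwD lwv.
  have -> : lk (G (y a) + t *: v) = lk (G (y a)).
    by rewrite lkD lkv mulr0 addr0.
  rewrite laG dotDl dotZl u'w0 mulr0 addr0; congr (row_mx _ (row_mx _ _)).
  rewrite !mulmxDl -!scalemxAl Eu' EG scalerDr !scalerA [t * _]mulrC.
  by rewrite !subrr.
have /nbhs_ballP[r /= r0 Hr] := curve_near (curve_line v oBz BG).
have [t t0 Bt] : exists2 t : R, t != 0 & Bz (G (y a) + t *: v).
  have r20 : 0 < r / 2 by rewrite divr_gt0.
  exists (r / 2); first by rewrite gt_eqF.
  by apply: Hr; rewrite -ball_normE /= sub0r normrN gtr0_norm//; lra.
have : G (y a) + t *: v = G (y a) by rewrite -(GF _ Bt) Fv GF.
move=> /(congr1 (fun z => z - G (y a))); rewrite addrAC subrr add0r => /eqP.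
rewrite scaler_eq0 (negbTE t0) => /= /eqP v0.
by rewrite -lwv v0 /lw !linear0.
Qed.

End SimpleEigenpair.

(** * Curvatures of a Dupin hypersurface *)

(* Sealed copies of ['d F a w] and of the Jacobian matrix: rewriting with the
   originals makes unification unfold the choice operator behind them. *)
HB.lock Definition dmap (R : realType) (m n : nat) (F : 'rV[R]_m -> 'rV[R]_n)
  (a w : 'rV[R]_m) : 'rV[R]_n := 'd F a w.
HB.lock Definition jac (R : realType) (m n : nat) (F : 'rV[R]_m -> 'rV[R]_n)
  (a : 'rV[R]_m) : 'M[R]_(m, n) := jacobian F a.

Section Differential.
Variables (R : realType) (m n : nat) (F : 'rV[R]_m -> 'rV[R]_n) (a : 'rV[R]_m).

Lemma dmapE w : 'd F a w = dmap F a w.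
Proof. by rewrite dmap.unlock. Qed.

Lemma dmap_jac w : dmap F a w = w *m jac F a.
Proof. by rewrite dmap.unlock jac.unlock jacobianE. Qed.

Lemma dmapD u w : dmap F a (u + w) = dmap F a u + dmap F a w.
Proof. by rewrite !dmap_jac mulmxDl. Qed.

Lemma dmapZ c w : dmap F a (c *: w) = c *: dmap F a w.
Proof. by rewrite !dmap_jac -scalemxAl. Qed.

Lemma dmap0 : dmap F a 0 = 0.
Proof. by rewrite dmap_jac mul0mx. Qed.

End Differential.

Section Schwarz.
Variables (R : realType).

Lemma schwarz_rV n m (F : 'rV[R]_n -> 'rV[R]_m) (U : set 'rV[R]_n) x u v :
  open U -> U x -> Ck 2 U F -> 'D_v ('D_u F) x = 'D_u ('D_v F) x.
Proof.
move=> oU Ux CF.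
have H a b j : ('D_b ('D_a F) x) 0 j = 'D_b ('D_a (fun y => F y 0 j)) x.
  rewrite derive_coord; last by apply: diff_derivable; exact: (CF.2 a).1.
  apply: near_eq_derive; near=> y; rewrite derive_coord//.
  apply: diff_derivable; apply: CF.1; near: y; exact: open_nbhs_nbhs.
apply/rowP => j; apply: etrans (H u v j) _; apply: etrans _ (esym (H v u j)).
exact: (schwarz _ _ oU Ux (iffLR (Ck_coordP _ _ oU) CF j)).
Unshelve. all: by end_near. Qed.

(** The finitely many listed values other than f x are all avoided near [x]. *)
Lemma continuous_finite_values (T : topologicalType) (f : T -> R) (s : seq R) x :
  {for x, continuous f} -> (\forall y \near x, f y \in s) -> \forall y \near x, f y = f x.
Proof.
move=> cf.
have H : \forall y \near x, all (fun c => (c == f x) || (f y != c)) s.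
  elim: s => [|c s IH]; first exact: nearW.
  have [cfx|cfx] := eqVneq c (f x).
    by apply: filterS IH => y /= ->; rewrite ?cfx ?eqxx.
  have : \forall y \near x, f y != c.
    have N : nbhs (f x) [set t | t != c].
      by apply: open_nbhs_nbhs; split; [exact: open_neq|rewrite /= eq_sym].
    exact: (cf _ N).
  by apply: filterS2 IH => y /= -> ->; rewrite orbT.
apply: filterS2 H => y /allP H fs.
by have := H _ fs; rewrite eqxx orbF eq_sym => /eqP.
Qed.

Lemma continuous_neq (T : topologicalType) (f g : T -> R) x :
  {for x, continuous f} -> {for x, continuous g} -> f x != g x -> \forall y \near x, f y != g y.
Proof.
move=> cf cg; rewrite -subr_eq0 => fg.
have cfg : {for x, continuous (fun y => f y - g y)} by exact: continuousB.
have N : nbhs (f x - g x) [set t : R | t != 0].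
  by apply: open_nbhs_nbhs; split; [exact: open_neq|].
have : \forall y \near x, f y - g y != 0 by exact: (cfg _ N).
by apply: filterS => y; rewrite subr_eq0.
Qed.

Lemma is_derive_diff (V W : normedModType R) (F : V -> W) x v : differentiable F x ->
  is_derive x v F ('d F x v).
Proof. by move=> dF; split; [exact: diff_derivable|rewrite deriveE]. Qed.

End Schwarz.

(** * Fundamental forms and curvature lines in a chart *)

Section LocalGeometry.
Variables (R : realType) (m : nat) (M : set 'rV[R]_m.+2) (xi : 'rV[R]_m.+2 -> 'rV[R]_m.+2).
Hypothesis HM : @oriented_hypersurface R m.+2 m.+1 M idfun xi.
Variables (W : set 'rV[R]_m.+2) (Om : set 'rV[R]_m) (f : 'rV[R]_m -> 'rV[R]_m.+2).
Hypotheses (oW : open W) (oO : open Om) (df : diffeomorphism Om (M `&` W) f).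
(** The Gauss map in the chart, held abstract behind an equation so that it stays folded in
    rewriting. *)
Variable n : 'rV[R]_m -> 'rV[R]_m.+2.
Hypothesis nE : n = fun a => xi (f a).

Lemma chart_in a : Om a -> M (f a).
Proof. by move=> Oa; have [_ [psi [_ H _]]] := df; have [[]] := H a Oa. Qed.

Lemma chart_smooth : smooth_on Om f.
Proof. by have [/(smooth_map_open _ oO)] := df. Qed.

Lemma normal_smooth : smooth_on Om n.
Proof.
(* [tdiff_chart] asks for a point of the chart, so an empty domain is treated apart. *)
rewrite nE => k; case: (pselect (exists a, Om a)) => [[a Oa]|H].
  by have [] := @tdiff_chart _ _ _ _ _ _ _ _ xi a 0 oO df Oa (oh_normal_smooth HM).
by apply: Ck_local => a Oa; case: H; exists a.
Qed.

Lemma chart_inj a w : Om a -> dmap f a w = 0 -> w = 0.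
Proof. by move=> Oa; rewrite -dmapE; exact: diffeo_diff_inj oO df Oa. Qed.

Lemma chart_differentiable a : Om a -> differentiable f a.
Proof. exact: smooth_on_differentiable chart_smooth. Qed.

Lemma normal_differentiable a : Om a -> differentiable n a.
Proof. exact: smooth_on_differentiable normal_smooth. Qed.

Lemma tdiff_normal a w : Om a -> tdiff M xi (f a) (dmap f a w) = dmap n a w.
Proof.
by move=> Oa; rewrite nE -!dmapE; have [] := @tdiff_chart _ _ _ _ _ _ _ _ xi a w oO df Oa (oh_normal_smooth HM).
Qed.

Lemma chart_tangent a v : Om a -> tangent M (f a) v <-> exists w, v = dmap f a w.
Proof.
move=> Oa; have H := tangent_chart v oW oO df Oa.
split=> [/(iffLR H)[w ->]|[w vE]]; first by exists w; rewrite dmapE.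
by apply: (iffRL H); exists w; rewrite vE dmapE.
Qed.

Lemma dot_tangent_normal a w : Om a -> dot (dmap f a w) (n a) = 0.
Proof.
move=> Oa; have Ma := chart_in Oa.
by rewrite nE; have [] := iffLR (hypersurface_tangent _ HM Ma) (iffRL (chart_tangent _ Oa) (ex_intro _ w erefl)).
Qed.

Lemma normal_tangent a w : Om a -> exists u, dmap n a w = dmap f a u.
Proof.
move=> Oa; apply/(chart_tangent _ Oa); rewrite -(tdiff_normal _ Oa).
by apply: (shape_tangent HM (chart_in Oa)); apply/(chart_tangent _ Oa); exists w.
Qed.

Lemma chart_eigenspace a k X : Om a -> shape_eigenspace M idfun xi (f a) k X <->
  exists2 w, X = dmap f a w & dmap n a w = - (k *: dmap f a w).
Proof.
move=> Oa; have P := shape_eigenspaceP xi k X (oh_submanifold HM) (chart_in Oa).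
split=> [/(iffLR P)[/(chart_tangent _ Oa)[w ->]]|[w XE E]].
  by rewrite (tdiff_normal _ Oa) => E; exists w.
apply: (iffRL P); rewrite XE (tdiff_normal _ Oa); split; last exact: E.
by apply/(chart_tangent _ Oa); exists w.
Qed.

(** The rows of [jac f a] are the coordinate tangent vectors, so this is their Gram matrix. *)
Definition first_form a : 'M[R]_m := jac f a *m (jac f a)^T.
Definition second_form a : 'M[R]_m := - (jac n a *m (jac f a)^T).
Local Notation eigen := (pencil_eigen second_form first_form).

Lemma first_formE a w u : dot (w *m first_form a) u = dot (dmap f a w) (dmap f a u).
Proof. by rewrite !dotE /first_form !dmap_jac trmx_mul !mulmxA. Qed.

Lemma second_formE a w u : dot (w *m second_form a) u = - dot (dmap n a w) (dmap f a u).
Proof. by rewrite !dotE /second_form !dmap_jac trmx_mul mulmxN mulNmx !mulmxA mxE. Qed.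

(** Differentiating <D_x f, n> = 0 in direction y gives <D_y D_x f, n> = -<df x, dn y>, and mixed
    second derivatives commute. *)
Lemma shape_symmetric a w u : Om a ->
  dot (dmap n a w) (dmap f a u) = dot (dmap n a u) (dmap f a w).
Proof.
move=> Oa.
have H x y : dot ('D_y ('D_x f) a) (n a) + dot (dmap f a x) (dmap n a y) = 0.
  have Cf := (chart_smooth 2).2 x.
  have H1 : is_derive a y ('D_x f) ('D_y ('D_x f) a).
    by apply/derivableP/diff_derivable; exact: Cf.1.
  have := is_derive_dot H1 (is_derive_diff y (normal_differentiable Oa)).
  rewrite dmapE (_ : 'D_x f a = dmap f a x); last by rewrite deriveE ?dmapE//; exact: chart_differentiable.
  move=> H2; apply: (is_derive_unique H2).
  have H3 : is_derive a y (cst 0 : 'rV[R]_m -> R) 0 by exact: is_derive_cst.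
  apply: near_eq_is_derive H3; near=> b.
  have Ob : Om b by near: b; exact: open_nbhs_nbhs.
  rewrite deriveE ?dmapE; last exact: chart_differentiable.
  by rewrite dot_tangent_normal.
have S := schwarz_rV u w oO Oa (chart_smooth 2).
have H2 := etrans (H u w) (esym (H w u)); rewrite S in H2.
by move/addrI: H2 => H3; rewrite dotC H3 dotC.
Unshelve. all: by end_near. Qed.

Lemma sym_bilinear_mx p (A : 'M[R]_p) : (forall w u, dot (w *m A) u = dot (u *m A) w) -> A^T = A.
Proof.
have E i j : A i j = dot (delta_mx 0 i *m A) (delta_mx 0 j).
  by rewrite -rowE dotE trmx_delta -colE !mxE.
by move=> H; apply/matrixP => i j; rewrite mxE E H -E.
Qed.

Lemma first_form_sym a : (first_form a)^T = first_form a.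
Proof. by apply: sym_bilinear_mx => w u; rewrite !first_formE dotC. Qed.

Lemma second_form_sym a : Om a -> (second_form a)^T = second_form a.
Proof. by move=> Oa; apply: sym_bilinear_mx => w u; rewrite !second_formE shape_symmetric. Qed.

Lemma first_form_pos a w : Om a -> dot (w *m first_form a) w = 0 -> w = 0.
Proof. by move=> Oa; rewrite first_formE => /dot_eq0; exact: chart_inj. Qed.

(** The pencil equation tests dn w + k df w against tangent vectors only; that vector is itself
    tangent, so it vanishes. *)
Lemma eigenP a k w : Om a -> eigen a k w <-> dmap n a w = - (k *: dmap f a w).
Proof.
move=> Oa; split=> [E|E].
  have [u Hu] := normal_tangent w Oa.
  have z0 : dmap n a w + k *: dmap f a w = 0.
    have z2 : dmap n a w + k *: dmap f a w = dmap f a (u + k *: w).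
      by rewrite dmapD dmapZ Hu.
    apply: dot_eq0; rewrite {2}z2 dotDl dotZl.
    have := congr1 (fun z => dot z (u + k *: w)) E.
    by rewrite dotZl second_formE first_formE => <-; rewrite subrr.
  by apply/eqP; rewrite -addr_eq0 z0.
apply/eqP; rewrite -subr_eq0; apply/eqP/dot_eq0.
set z := _ - _; rewrite {1}/z dotBl dotZl second_formE first_formE E dotNl opprK dotZl.
by rewrite subrr.
Qed.

Lemma chart_curvature a k : Om a ->
  principal_curvatures M idfun xi (f a) k <-> exists2 w, w != 0 & eigen a k w.
Proof.
move=> Oa; split=> [[X /(chart_eigenspace _ _ Oa)[w -> /(eigenP _ _ Oa) E] w0]|[w w0 /(eigenP _ _ Oa) E]].
  by exists w => //; apply: contra_neq w0 => ->; rewrite dmap0.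
exists (dmap f a w); first by apply/(chart_eigenspace _ _ Oa); exists w.
by apply: contra_neq w0; exact: chart_inj.
Qed.

Lemma smooth_first_form i j : smooth_on Om (fun a => first_form a i j).
Proof.
move=> k; rewrite /first_form; under eq_fun do rewrite mxE.
apply: Ck_sum => // l; apply: CkM => //; first by rewrite jac.unlock; exact: Ck_jacobian (chart_smooth k.+1).
by under eq_fun do rewrite mxE; rewrite jac.unlock; exact: Ck_jacobian (chart_smooth k.+1).
Qed.

Lemma smooth_second_form i j : smooth_on Om (fun a => second_form a i j).
Proof.
move=> k; rewrite /second_form; under eq_fun do rewrite mxE mxE.
apply: CkN => //; apply: Ck_sum => // l; apply: CkM => //.
  rewrite jac.unlock; exact: Ck_jacobian (normal_smooth k.+1).
by under eq_fun do rewrite mxE; rewrite jac.unlock; exact: Ck_jacobian (chart_smooth k.+1).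
Qed.

Hypothesis HD : dupin M idfun xi.

Definition eigenpair (Om' : set 'rV[R]_m) (kap : 'rV[R]_m -> R) (w : 'rV[R]_m -> 'rV[R]_m) :=
  [/\ smooth_on Om' kap, smooth_on Om' w & forall a, Om' a ->
    [/\ w a != 0, eigen a (kap a) (w a) &
        forall u, eigen a (kap a) u -> exists c, u = c *: w a]].

(** The image under [f] of an integral curve of [w] is a curvature surface of dimension one, because
    [w] spans the eigenspace; the Dupin condition then makes [kap] constant along it. *)
Lemma curvature_line_constant Om' kap w a : open Om' -> Om' `<=` Om ->
  eigenpair Om' kap w -> Om' a -> 'D_(w a) kap a = 0.
Proof.
move=> oO' O'O [skap sw Hw] O'a.
have [h [g [h0 sg g0 gO' dg]]] := integral_curve oO' O'a sw.
(* Charts of submanifolds are defined on sets of row vectors, hence the passage from 'rV_1 to the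
   time line. *)
pose e1 (s : 'rV[R]_1) : R := s 0 0.
have se1 k (U : set 'rV[R]_1) : Ck k U e1.
  have L := Ck_rV_linear setT (idfun : {linear 'rV[R]_1 -> 'rV[R]_1}) k.
  by apply: (@Ck_sub _ _ _ setT) => //; exact: (iffLR (Ck_coordP _ _ openT) L 0).
pose Om1 : set 'rV[R]_1 := setT `&` e1 @^-1` ball (0 : R) h.
have oB : open (ball (0 : R) h) by exact: ball_open.
have oO1 : open Om1 by exact: open_preim_Ck openT oB (se1 0%N _).
have sge : smooth_on Om1 (fun s => g (e1 s)).
  by move=> k; apply: (Ck_comp_real oO1 oB _ (se1 k _) (sg k)) => s [].
pose c1 s := f (g (e1 s)).
have sc1 : smooth_on Om1 c1.
  move=> k; apply: (Ck_comp oO1 oO _ (sge k) (chart_smooth k)) => s [_ hs].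
  exact/O'O/gO'.
have dge s v : Om1 s -> 'd (fun s => g (e1 s)) s v = v 0 0 *: w (g (e1 s)).
  move=> O1s; have [_ hs] := O1s.
  have de : differentiable e1 s by exact: (se1 1%N setT).1.
  have dgs : differentiable g (e1 s) by exact: smooth_on_differentiable sg hs.
  rewrite (diff_comp (f := e1))//=.
  have -> : 'd e1 s v = v 0 0 *: (1 : R).
    rewrite -deriveE//; have := @is_derive_coord _ _ _ idfun s v v 0 (is_derive_id _ _).
    by move=> [_ ->]; rewrite [RHS]mulr1.
  rewrite linearZ -deriveE//.
  by have [_ ->] := dg _ hs.
have dc1 s v : Om1 s -> 'd c1 s v = v 0 0 *: dmap f (g (e1 s)) (w (g (e1 s))).
  move=> O1s; have [_ hs] := O1s.
  have Ogs : Om (g (e1 s)) by exact/O'O/gO'.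
  rewrite (diff_comp (f := fun s => g (e1 s)))/=.
  - by rewrite dge// linearZ dmapE.
  - exact: smooth_on_differentiable sge O1s.
  - exact: chart_differentiable.
have O10 : Om1 0 by split=> //=; rewrite /e1 mxE; exact: ballxx.
have e10 : e1 0 = 0 by rewrite /e1 mxE.
(* The curve is immersed at time 0: its velocity is the image of the nonzero vector w(a) under the
   injective differential of [f]. *)
have [|B [oB1 B0 BO dB]] := immersion_diffeo oO1 O10 sc1.
  move=> v; rewrite dc1// e10 g0 => /eqP; rewrite scaler_eq0 => /orP[/eqP v0|/eqP H].
    by apply/rowP => j; rewrite (ord1 j) v0 mxE.
  by have [/eqP[]] := Hw a O'a; exact: chart_inj (O'O _ O'a) H.
have /nbhs_ballP[r /= r0 Hr] : nbhs (0 : 'rV[R]_1) B by exact: open_nbhs_nbhs.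
pose D1 := ball (0 : 'rV[R]_1) r.
have oD1 : open D1 by exact: ball_open.
have dD1 : diffeomorphism D1 (c1 @` D1) c1 by exact: diffeo_sub Hr dB.
have D1O s : D1 s -> Om1 s by move=> /Hr/BO.
have teig s : D1 s -> tangent_eigenspace M idfun xi (c1 @` D1) (c1 s) (kap (g (e1 s))).
  move=> D1s; have O1s := D1O s D1s; have [_ hs] := O1s.
  have O'g : Om' (g (e1 s)) by exact: gO'.
  have Og := O'O _ O'g; have [wn0 Ew simple] := Hw _ O'g.
  split; first by apply/(chart_curvature _ Og); exists (w (g (e1 s))).
  have dD1' : diffeomorphism D1 (c1 @` D1 `&` setT) c1 by rewrite setIT.
  apply/seteqP; split=> X.
    move=> /(tangent_chart _ openT oD1 dD1' D1s)[v ->]; rewrite dc1//.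
    apply/(chart_eigenspace _ _ Og); exists (v 0 0 *: w (g (e1 s))); first by rewrite dmapZ.
    have E := iffLR (eigenP _ _ Og) Ew.
    by rewrite !dmapZ E scalerN !scalerA mulrC.
  move=> /(chart_eigenspace _ _ Og)[u -> /(eigenP _ _ Og)/simple[c ->]].
  apply/(tangent_chart _ openT oD1 dD1' D1s); exists (c%:M); rewrite dc1// mxE eqxx mulr1n.
  by rewrite dmapZ.
have cS : curvature_surface M idfun xi (c1 @` D1).
  split.
  - exists 1%N => _ [s D1s <-]; exists setT, D1, c1; split=> //; first exact: openT.
    by rewrite setIT.
  - apply: connected_continuous_connected; first exact: ball_connected.
    apply: smooth_map_continuous; apply/smooth_map_open => // k.
    by apply: Ck_sub (sc1 k) => s /D1O.
  - by move=> _ [s /D1O[_ hs] <-]; exact/chart_in/O'O/gO'.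
  - by move=> _ [s D1s <-]; exists (kap (g (e1 s))); exact: teig.
have D10 : D1 0 by exact: ballxx.
have kc s : D1 s -> kap (g (e1 s)) = kap a.
  move=> D1s; have := HD cS _ _ (teig s D1s) (teig 0 D10); rewrite e10 g0.
  by apply; [exists s|exists 0].
have b0 : ball (0 : R) h 0 by exact: ballxx.
have H1 : is_derive (0 : R) (1 : R) (fun t => kap (g t)) ('d kap (g 0) (w (g 0))).
  have dg0 := dg 0 b0.
  have dfg : differentiable g (0 : R) by exact: smooth_on_differentiable sg b0.
  have dk : differentiable kap (g 0) by rewrite g0; exact: smooth_on_differentiable skap O'a.
  split; last first.
    by rewrite (derive_comp (F := g)); [have [_ ->] := dg0| |].
  by apply: diff_derivable; exact: differentiable_comp.
have H0 : is_derive (0 : R) (1 : R) (cst (kap a) : R -> R) 0 by exact: is_derive_cst.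
rewrite deriveE; last exact: smooth_on_differentiable skap O'a.
rewrite -g0; apply: (is_derive_unique H1); apply: near_eq_is_derive H0.
apply/nbhs_ballP; exists r => // t rt; rewrite /cst.
have := kc (t%:M); rewrite /e1 mxE eqxx mulr1n => -> //.
rewrite /D1 -ball_normE /= sub0r normrN; apply: le_lt_trans (_ : `|t| < r).
  by apply: rV_norm_le => // j; rewrite mxE (ord1 j) mulr1n.
by move: rt; rewrite -ball_normE /= sub0r normrN.
Qed.

Local Notation PC := (principal_curvatures M idfun xi).
Local Notation bI a w u := (dot (w *m first_form a) u).

Implicit Types (a b w u : 'rV[R]_m) (k l : R).

Lemma bI_sym a w u : bI a w u = bI a u w.
Proof. by rewrite !first_formE dotC. Qed.

Lemma bI_gt0 a w : Om a -> w != 0 -> 0 < bI a w w.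
Proof.
move=> Oa w0; rewrite first_formE; apply: dot_gt0; apply: contra_neq w0.
exact: chart_inj.
Qed.

Lemma eigen_ortho a k l w u : Om a -> eigen a k w -> eigen a l u -> k != l -> bI a w u = 0.
Proof.
move=> Oa Ew Eu kl.
have : k * bI a w u = l * bI a w u.
  have sI := first_form_sym a; have sII := second_form_sym Oa.
  by rewrite -[LHS]dotZl -Ew (dot_mulmx_sym _ _ sII) Eu dotZr -(dot_mulmx_sym _ _ sI).
move/eqP; rewrite -subr_eq0 -mulrBl mulf_eq0 subr_eq0 (negbTE kl) => /= /eqP.
by [].
Qed.

Lemma eigenD a k w u : eigen a k w -> eigen a k u -> eigen a k (w + u).
Proof. by rewrite /pencil_eigen => Ew Eu; rewrite !mulmxDl Ew Eu scalerDr. Qed.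

Lemma eigenZ a k c w : eigen a k w -> eigen a k (c *: w).
Proof.
by rewrite /pencil_eigen => Ew; rewrite -!scalemxAl Ew !scalerA mulrC.
Qed.

Lemma ortho_coef a p (e : 'I_p -> 'rV[R]_m) (c : 'I_p -> R) i :
  (forall i j, i != j -> bI a (e i) (e j) = 0) ->
  bI a (\sum_j c j *: e j) (e i) = c i * bI a (e i) (e i).
Proof.
move=> oe; rewrite bI_sym.
have -> : bI a (e i) (\sum_j c j *: e j) = \sum_j c j * bI a (e i) (e j).
  elim/big_ind2: _ => [|x1 x2 y1 y2|j _]; first by rewrite dot0r.
    by move=> <- <-; rewrite dotDr.
  by rewrite dotZr.
by rewrite (bigD1 i)//= big1 ?addr0// => j ji; rewrite oe ?mulr0// eq_sym.
Qed.

(** Orthogonality together with positive lengths makes the family free. The equation p = m is a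
    hypothesis so that families over 'I_3 can be used while [m] remains a variable. *)
Lemma basis_expand a p (e : 'I_p -> 'rV[R]_m) u : Om a -> p = m -> (forall i, e i != 0) ->
  (forall i j, i != j -> bI a (e i) (e j) = 0) -> exists c : 'I_p -> R, u = \sum_i c i *: e i.
Proof.
move=> Oa pm e0 oe; pose E : 'M[R]_(p, m) := \matrix_(i, j) e i 0 j.
have rE i : row i E = e i by apply/rowP => j; rewrite !mxE.
have ES (v : 'rV[R]_p) : v *m E = \sum_i v 0 i *: e i.
  by rewrite mulmx_sum_row; apply: eq_bigr => i _; rewrite rE.
have : row_free E.
  apply: inj_row_free => v; rewrite ES => v0; apply/rowP => i; rewrite mxE.
  have := ortho_coef (v 0) i oe; rewrite v0 mul0mx dot0l => /esym/eqP.
  by rewrite mulf_eq0 (gt_eqF (bI_gt0 Oa (e0 i))) orbF => /eqP.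
rewrite -row_leq_rank => fE.
have : (u <= E)%MS by apply: submx_full; rewrite /row_full eqn_leq rank_leq_col -{1}pm.
by move=> /submxP[d ->]; exists (d 0); rewrite ES.
Qed.

Lemma basis_simple a p (e : 'I_p -> 'rV[R]_m) (k : 'I_p -> R) i u : Om a -> p = m ->
  (forall i, e i != 0) -> (forall i j, i != j -> bI a (e i) (e j) = 0) ->
  (forall j, eigen a (k j) (e j)) -> (forall j, j != i -> k j != k i) ->
  eigen a (k i) u -> exists c, u = c *: e i.
Proof.
move=> Oa pm e0 oe Ee ki Eu; have [c uE] := basis_expand u Oa pm e0 oe.
exists (c i); rewrite uE (bigD1 i)//= big1 ?addr0// => j ji.
have := ortho_coef c j oe; rewrite -uE (eigen_ortho Oa Eu (Ee j)); last by rewrite eq_sym ki.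
move=> /esym/eqP; rewrite mulf_eq0 (gt_eqF (bI_gt0 Oa (e0 j))) orbF => /eqP ->.
by rewrite scale0r.
Qed.

Definition triple (T : Type) (x y z : T) (i : 'I_3) : T := nth x [:: x; y; z] i.

Hypothesis m3 : m = 3%N.

Lemma triple_ortho a e1 e2 e3 : bI a e1 e2 = 0 -> bI a e1 e3 = 0 -> bI a e2 e3 = 0 ->
  forall i j, i != j -> bI a (triple e1 e2 e3 i) (triple e1 e2 e3 j) = 0.
Proof.
move=> H1 H2 H3 [[|[|[|//]]] ?] [[|[|[|//]]] ?] //= _;
by rewrite /triple /= // bI_sym.
Qed.

(** In dimension 3 two orthogonal eigenvectors leave a line, which the self-adjoint operator
    preserves. [N] has two columns, so it kills some nonzero [e3], which spans that line. *)
Lemma third_eigenvector a k l (e1 e2 : 'rV[R]_m) : Om a -> e1 != 0 -> e2 != 0 -> eigen a k e1 ->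
  eigen a l e2 -> bI a e1 e2 = 0 ->
  exists k3 (e3 : 'rV[R]_m), [/\ e3 != 0, eigen a k3 e3, bI a e1 e3 = 0 & bI a e2 e3 = 0].
Proof.
move=> Oa e10 e20 E1 E2 e12.
pose N := first_form a *m (col_mx e1 e2)^T.
have NE (v : 'rV[R]_m) : v *m N = row_mx (bI a v e1)%:M (bI a v e2)%:M.
  rewrite /N tr_col_mx mulmxA mul_mx_row !dotE.
  by congr row_mx; rewrite -mx11_scalar.
have [e3 [e30 e3N]] : exists e3 : 'rV[R]_m, e3 != 0 /\ e3 *m N = 0.
  apply: contrapT => H; have : row_free N.
    apply: inj_row_free => v vN; apply: contrapT => v0; apply: H; exists v.
    by split=> //; exact/eqP.
  by rewrite -row_leq_rank => /leq_trans/(_ (rank_leq_col _)); rewrite m3.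
have [q1 q2] : bI a e1 e3 = 0 /\ bI a e2 e3 = 0.
  move: e3N; rewrite NE -[0](row_mx0 _ _ 1%N 1%N) => /eq_row_mx[/matrixP/(_ 0 0) H1 /matrixP/(_ 0 0) H2].
  by split; rewrite bI_sym; [move: H1|move: H2]; rewrite !mxE eqxx mulr1n.
(* The Rayleigh quotient of [e3], the only possible eigenvalue. *)
pose k3 := dot (e3 *m second_form a) e3 / bI a e3 e3.
exists k3, e3; split=> //.
pose z := e3 *m second_form a - k3 *: (e3 *m first_form a).
have sII := second_form_sym Oa.
have z1 : dot z e1 = 0.
  by rewrite /z dotBl dotZl (dot_mulmx_sym _ _ sII) E1 dotZr (dotC e3) q1 (bI_sym _ e3) q1 !mulr0 subrr.
have z2 : dot z e2 = 0.
  by rewrite /z dotBl dotZl (dot_mulmx_sym _ _ sII) E2 dotZr (dotC e3) q2 (bI_sym _ e3) q2 !mulr0 subrr.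
have z3 : dot z e3 = 0.
  by rewrite /z dotBl dotZl /k3 divfK ?subrr// gt_eqF// bI_gt0.
have [||c zE] := basis_expand (e := triple e1 e2 e3) z Oa (esym m3).
- by move=> [[|[|[|//]]] ?].
- exact: triple_ortho.
apply/eqP; rewrite -subr_eq0; apply/eqP/dot_eq0; rewrite -/z {2}zE.
elim/big_ind: _ => [|x y Hx Hy|i _]; first by rewrite dot0r.
  by rewrite dotDr Hx Hy addr0.
by rewrite dotZr; case: i => [[|[|[|//]]] ?]; rewrite /triple /= ?z1 ?z2 ?z3 mulr0.
Qed.

(** A third eigenvector orthogonal to [w] cannot belong to the simple [k]. Hence [l] is double and
    its eigenspace is the complement of [w]. *)
Lemma simple_ortho_eigen b k l w u : Om b -> PC (f b) = [set k; l] -> k != l -> w != 0 ->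
  eigen b k w -> (forall v, eigen b k v -> exists c, v = c *: w) -> bI b u w = 0 ->
  eigen b l u.
Proof.
move=> Ob PCb kl w0 Ew simple uw.
have [e2 e20 E2] : exists2 e2, e2 != 0 & eigen b l e2.
  by apply/(chart_curvature _ Ob); rewrite PCb; right.
have o12 := eigen_ortho Ob Ew E2 kl.
have [k3 [e3 [e30 E3 o13 o23]]] := third_eigenvector Ob w0 e20 Ew E2 o12.
have k3l : k3 = l.
  have : PC (f b) k3 by apply/(chart_curvature _ Ob); exists e3.
  rewrite PCb => -[k3k|//]; rewrite k3k in E3; have [c e3E] := simple _ E3.
  move: o13; rewrite e3E dotZr => /eqP; rewrite mulf_eq0 (gt_eqF (bI_gt0 Ob w0)) orbF => /eqP c0.
  by move: e30; rewrite e3E c0 scale0r eqxx.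
rewrite k3l in E3.
have oe := triple_ortho o12 o13 o23.
have [||c uE] := basis_expand (e := triple w e2 e3) u Ob (esym m3) => //.
  by move=> [[|[|[|//]]] ?].
have c0 : c ord0 = 0.
  have := ortho_coef c ord0 oe; rewrite -uE {1}/triple /= uw => /esym/eqP.
  by rewrite mulf_eq0 /triple /= (gt_eqF (bI_gt0 Ob w0)) orbF => /eqP.
rewrite uE big_ord_recl c0 scale0r add0r !big_ord_recl big_ord0 addr0.
by apply: eigenD; apply: eigenZ.
Qed.

(** Whichever of [k] and [l] the third orthogonal eigenvector belongs to is double, and the other
    one is simple. *)
Lemma simple_of_two a k l : Om a -> PC (f a) = [set k; l] -> k != l ->
  exists k1 k2 w, [/\ PC (f a) = [set k1; k2], k1 != k2, w != 0, eigen a k1 w &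
    forall u, eigen a k1 u -> exists c, u = c *: w].
Proof.
move=> Oa PCa kl.
have [e1 e10 E1] : exists2 e1, e1 != 0 & eigen a k e1.
  by apply/(chart_curvature _ Oa); rewrite PCa; left.
have [e2 e20 E2] : exists2 e2, e2 != 0 & eigen a l e2.
  by apply/(chart_curvature _ Oa); rewrite PCa; right.
have o12 := eigen_ortho Oa E1 E2 kl.
have [k3 [e3 [e30 E3 o13 o23]]] := third_eigenvector Oa e10 e20 E1 E2 o12.
have k3kl : k3 = k \/ k3 = l.
  have : PC (f a) k3 by apply/(chart_curvature _ Oa); exists e3.
  by rewrite PCa.
have oe := triple_ortho o12 o13 o23.
have Ee j : eigen a (triple k l k3 j) (triple e1 e2 e3 j) by case: j => [[|[|[|//]]] ?].
have e0 j : triple e1 e2 e3 j != 0 by case: j => [[|[|[|//]]] ?].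
case: k3kl => k3E.
  exists l, k, e2; split=> //; [by rewrite setUC|by rewrite eq_sym|].
  move=> u Eu; apply: (@basis_simple a 3 (triple e1 e2 e3) (triple k l k3) 1 u) => //.
  by move=> [[|[|[|//]]] ?] //= _; rewrite /triple /= ?k3E.
exists k, l, e1; split=> // u Eu.
apply: (@basis_simple a 3 (triple e1 e2 e3) (triple k l k3) 0 u) => //.
by move=> [[|[|[|//]]] ?] //= _; rewrite /triple /= ?k3E eq_sym.
Qed.

Lemma simple_of_three a k1 k2 k3 : Om a -> PC (f a) = [set k1; k2; k3] ->
  k1 != k2 -> k1 != k3 -> k2 != k3 -> forall k, PC (f a) k ->
  exists w, [/\ w != 0, eigen a k w & forall u, eigen a k u -> exists c, u = c *: w].
Proof.
move=> Oa PCa k12 k13 k23.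
have ex k : PC (f a) k -> exists2 w, w != 0 & eigen a k w by move=> /(chart_curvature _ Oa).
have [e1 e10 E1] : exists2 w, w != 0 & eigen a k1 w by apply: ex; rewrite PCa; left; left.
have [e2 e20 E2] : exists2 w, w != 0 & eigen a k2 w by apply: ex; rewrite PCa; left; right.
have [e3 e30 E3] : exists2 w, w != 0 & eigen a k3 w by apply: ex; rewrite PCa; right.
have oe := triple_ortho (eigen_ortho Oa E1 E2 k12) (eigen_ortho Oa E1 E3 k13) (eigen_ortho Oa E2 E3 k23).
have Ee j : eigen a (triple k1 k2 k3 j) (triple e1 e2 e3 j) by case: j => [[|[|[|//]]] ?].
have e0 j : triple e1 e2 e3 j != 0 by case: j => [[|[|[|//]]] ?].
have inj i j : j != i -> triple k1 k2 k3 j != triple k1 k2 k3 i.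
  by case: i j => [[|[|[|//]]] ?] [[|[|[|//]]] ?] //= _; rewrite /triple //= eq_sym.
have H i : exists w, [/\ w != 0, eigen a (triple k1 k2 k3 i) w &
    forall u, eigen a (triple k1 k2 k3 i) u -> exists c, u = c *: w].
  exists (triple e1 e2 e3 i); split=> // u.
  by apply: (@basis_simple a 3 (triple e1 e2 e3) (triple k1 k2 k3)) => // j; exact: inj.
by move=> k; rewrite PCa => -[[->|->]|->]; [exact: (H 0)|exact: (H 1)|exact: (H (Ordinal (isT : (2 < 3)%N)))].
Qed.

Variable vals : seq R.
Hypothesis finite_vals : forall a k l, Om a -> PC (f a) k -> PC (f a) l -> k != l ->
  (1 + k * l) / (l - k) \in vals.

(** On a ball the continuous function (1 + k l)/(l - k) has finitely many values, hence is a
    constant c. Differentiating 1 + k l = c (l - k) with k' = 0 gives (k - c) l' = 0, and k = c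
    would force 1 + k^2 = 0. *)
Lemma rigid_pair a0 r (k l : 'rV[R]_m -> R) : ball a0 r `<=` Om ->
  (forall a, ball a0 r a -> [/\ differentiable k a, differentiable l a, PC (f a) (k a),
     PC (f a) (l a) & k a != l a]) ->
  forall a u, ball a0 r a -> 'D_u k a = 0 -> 'D_u l a = 0.
Proof.
move=> rO H; pose T a := (1 + k a * l a) / (l a - k a).
have lk0 a : ball a0 r a -> l a - k a != 0.
  by move=> /H[_ _ _ _]; rewrite subr_eq0 eq_sym.
have oB : open (ball a0 r) by exact: ball_open.
have cT a : ball a0 r a -> {for a, continuous T}.
  move=> ra; have [/differentiable_continuous ck /differentiable_continuous cl _ _ _] := H a ra.
  apply: continuousM; first by apply: continuousD; [exact: cst_continuous|exact: continuousM].
  apply: continuousV; first exact: lk0.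
  exact: continuousB.
have T_const a b : ball a0 r a -> ball a0 r b -> T a = T b.
  apply: (connected_locally_constant (@ball_connected _ _ _ _)) => x rx.
  have : \forall y \near x, T y \in vals.
    apply: filterS (open_nbhs_nbhs (conj oB rx)) => y ry.
    have [_ _ kP lP kl] := H y ry.
    exact: (finite_vals (rO _ ry) kP lP kl).
  by move=> /(continuous_finite_values (cT x rx)); apply: filterS => y ->.
move=> a u ra Dk; have [dk dl _ _ kl] := H a ra.
pose c := T a.
have E : \forall b \near a, 1 + k b * l b = c * (l b - k b).
  apply: filterS (open_nbhs_nbhs (conj oB ra)) => b rb.
  by rewrite /c (T_const a b ra rb) /T divfK// lk0.
have Hk : is_derive a u k 0 by split; [exact: diff_derivable|].
have Hl : is_derive a u l ('D_u l a) by exact/derivableP/diff_derivable.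
have dc (z : R) : is_derive a u (cst z : 'rV[R]_m -> R) 0 by exact: is_derive_cst.
have H1 := is_deriveD (dc 1) (is_deriveM Hk Hl).
have H2 := is_deriveM (dc c) (is_deriveB Hl Hk).
have := is_derive_unique (near_eq_is_derive E H1) H2.
rewrite /cst /GRing.scale /= !mulr0 addr0 add0r subr0 addr0 => /eqP.
rewrite -subr_eq0 -mulrBl mulf_eq0 => /orP[|/eqP//].
rewrite subr_eq0 => /eqP kc; move: (lk0 a ra) => lka.
have : (1 + k a * l a) = k a * (l a - k a).
  by have := nbhs_singleton E; rewrite -kc.
rewrite mulrBr => E0; suff : 1 + k a * k a != 0.
  by rewrite (_ : 1 + _ = 0) ?eqxx//; lra.
by rewrite gt_eqF// ltr_pwDl// -expr2 sqr_ge0.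
Qed.

Definition constant_near a0 := \forall a \near a0, PC (f a) = PC (f a0).

Lemma constant_near3 a0 k1 k2 k3 : Om a0 -> PC (f a0) = [set k1; k2; k3] ->
  k1 != k2 -> k1 != k3 -> k2 != k3 ->
  (forall a, Om a -> forall x y z, PC (f a) x -> PC (f a) y -> PC (f a) z ->
     x != y -> x != z -> y != z -> PC (f a) = [set x; y; z]) ->
  constant_near a0.
Proof.
move=> Oa PCa k12 k13 k23 three.
have pair k : PC (f a0) k -> exists (Om' : set 'rV[R]_m)
    (kap : 'rV[R]_m -> R) (w : 'rV[R]_m -> 'rV[R]_m), [/\ open Om', Om' a0, Om' `<=` Om,
    kap a0 = k & eigenpair Om' kap w].
  move=> /(simple_of_three Oa PCa k12 k13 k23)[w0 [w00 Ew0 simple]].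
  have [Om' [kap [w [oO' O'a O'O [skap sw] [ka H]]]]] := simple_eigenpair oO
    smooth_second_form smooth_first_form second_form_sym (fun a _ => first_form_sym a)
    first_form_pos Oa w00 Ew0 simple.
  by exists Om', kap, w; split.
have [|O1 [x1 [w1 [oO1 O1a O1O x1a P1]]]] := pair k1; first by rewrite PCa; left; left.
have [|O2 [x2 [w2 [oO2 O2a O2O x2a P2]]]] := pair k2; first by rewrite PCa; left; right.
have [|O3 [x3 [w3 [oO3 O3a O3O x3a P3]]]] := pair k3; first by rewrite PCa; right.
have cont (O' : set 'rV[R]_m) x (w : 'rV[R]_m -> 'rV[R]_m) a : eigenpair O' x w -> O' a -> {for a, continuous x}.
  by move=> [sx _ _]; exact: (sx 0%N).
have /nbhs_ballP[r /= r0 Hr] : \forall a \near a0, [/\ O1 a, O2 a & O3 a] /\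
    [/\ x1 a != x2 a, x1 a != x3 a & x2 a != x3 a].
  near=> a; split; split; near: a.
  - exact: open_nbhs_nbhs.
  - exact: open_nbhs_nbhs.
  - exact: open_nbhs_nbhs.
  - by apply: (@continuous_neq R 'rV[R]_m x1 x2 a0 (cont _ _ _ _ P1 O1a) (cont _ _ _ _ P2 O2a)); rewrite x1a x2a.
  - by apply: (@continuous_neq R 'rV[R]_m x1 x3 a0 (cont _ _ _ _ P1 O1a) (cont _ _ _ _ P3 O3a)); rewrite x1a x3a.
  - by apply: (@continuous_neq R 'rV[R]_m x2 x3 a0 (cont _ _ _ _ P2 O2a) (cont _ _ _ _ P3 O3a)); rewrite x2a x3a.
have rO a : ball a0 r a -> Om a by move=> /Hr[[/O1O]].
have PCx (O' : set 'rV[R]_m) x (w : 'rV[R]_m -> 'rV[R]_m) a : eigenpair O' x w -> O' a -> Om a ->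
    differentiable x a /\ PC (f a) (x a).
  move=> [sx _ Hx] O'a U1a; split; first exact: smooth_on_differentiable sx O'a.
  by apply/(chart_curvature _ U1a); have [wn0 Ew _] := Hx a O'a; exists (w a).
have B a : ball a0 r a -> [/\ differentiable x1 a /\ PC (f a) (x1 a),
    differentiable x2 a /\ PC (f a) (x2 a) & differentiable x3 a /\ PC (f a) (x3 a)].
  move=> ra; have [[U1a U2a U3a] _] := Hr a ra; have Oa' := rO a ra.
  by split; [exact: PCx P1 _ _|exact: PCx P2 _ _|exact: PCx P3 _ _].
have rig (x y : 'rV[R]_m -> R) : (forall a, ball a0 r a -> [/\ differentiable x a /\ PC (f a) (x a),
    differentiable y a /\ PC (f a) (y a) & x a != y a]) ->
    forall a u, ball a0 r a -> 'D_u x a = 0 -> 'D_u y a = 0.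
  by move=> H; apply: rigid_pair rO _ => a /H[[? ?] [? ?] ?].
have ne a : ball a0 r a -> [/\ x1 a != x2 a, x1 a != x3 a & x2 a != x3 a] by move=> /Hr[].
have D a : ball a0 r a -> forall u, [/\ 'D_u x1 a = 0, 'D_u x2 a = 0 & 'D_u x3 a = 0].
  move=> ra; have [[U1a U2a U3a] _] := Hr a ra; have Oa' := rO a ra.
  have [n12 n13 n23] := ne a ra; have [[d1 _] [d2 _] [d3 _]] := B a ra.
  have L1 := curvature_line_constant oO1 O1O P1 U1a.
  have L2 := curvature_line_constant oO2 O2O P2 U2a.
  have L3 := curvature_line_constant oO3 O3O P3 U3a.
  have r12 := rig x1 x2 (fun b rb => let: And3 b1 b2 b3 := B b rb in
    let: And3 n1 n2 n3 := ne b rb in And3 b1 b2 n1).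
  have r13 := rig x1 x3 (fun b rb => let: And3 b1 b2 b3 := B b rb in
    let: And3 n1 n2 n3 := ne b rb in And3 b1 b3 n2).
  have r23 := rig x2 x3 (fun b rb => let: And3 b1 b2 b3 := B b rb in
    let: And3 n1 n2 n3 := ne b rb in And3 b2 b3 n3).
  have sw (x y : R) : x != y -> y != x by rewrite eq_sym.
  have r21 := rig x2 x1 (fun b rb => let: And3 b1 b2 b3 := B b rb in
    let: And3 n1 n2 n3 := ne b rb in And3 b2 b1 (sw _ _ n1)).
  have r31 := rig x3 x1 (fun b rb => let: And3 b1 b2 b3 := B b rb in
    let: And3 n1 n2 n3 := ne b rb in And3 b3 b1 (sw _ _ n2)).
  have [_ _ /(_ a U1a)[w10 E1 _]] := P1; have [_ _ /(_ a U2a)[w20 E2 _]] := P2.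
  have [_ _ /(_ a U3a)[w30 E3 _]] := P3.
  have oe := triple_ortho (eigen_ortho Oa' E1 E2 n12) (eigen_ortho Oa' E1 E3 n13)
    (eigen_ortho Oa' E2 E3 n23).
  have e0 j : triple (w1 a) (w2 a) (w3 a) j != 0 by case: j => [[|[|[|//]]] ?].
  (* The basis argument is made for [x1] alone; rigidity then passes the vanishing on to [x2] and
     [x3]. *)
  have D1 u : 'D_u x1 a = 0.
    have [c ->] := basis_expand u Oa' (esym m3) e0 oe.
    rewrite deriveE// linear_sum big1// => i _; rewrite linearZ -deriveE//.
    case: i => [[|[|[|//]]] ?]; rewrite /triple /=.
    - by rewrite L1 scaler0.
    - by rewrite (r21 _ _ ra L2) scaler0.
    - by rewrite (r31 _ _ ra L3) scaler0.
  by move=> u; split; [exact: D1|exact: r12 ra (D1 u)|exact: r13 ra (D1 u)].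
have C (x : 'rV[R]_m -> R) : (forall a, ball a0 r a -> differentiable x a /\ forall u, 'D_u x a = 0) ->
    forall a, ball a0 r a -> x a = x a0.
  by move=> H a ra; exact: derive0_ball_const H a ra.
suff H a : ball a0 r a -> PC (f a) = PC (f a0).
  by apply: filterS H _; apply: nbhsx_ballx.
move=> ra.
have [n12 n13 n23] := ne a ra; have [[d1 p1] [d2 p2] [d3 p3]] := B a ra.
rewrite (three a (rO a ra) _ _ _ p1 p2 p3 n12 n13 n23).
rewrite (C x1 _ a ra) ?(C x2 _ a ra) ?(C x3 _ a ra) ?x1a ?x2a ?x3a ?PCa// => b rb;
  have [[? _] [? _] [? _]] := B b rb; split=> // u; have [] := D b rb u; by [].
Unshelve. all: by end_near. Qed.


Lemma smooth_jac O' i j : O' `<=` Om -> smooth_on O' (fun a => jac f a i j).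
Proof.
move=> sub k; apply: (@Ck_sub _ _ _ Om) => //; rewrite jac.unlock.
exact: Ck_jacobian (chart_smooth k.+1).
Qed.

Lemma smooth_dmap O' (w : 'rV[R]_m -> 'rV[R]_m) : open O' -> O' `<=` Om -> smooth_on O' w ->
  smooth_on O' (fun b => dmap f b (w b)).
Proof.
move=> oO' sub sw k.
have -> : (fun b => dmap f b (w b)) = (fun b => w b *m jac f b).
  by apply/funext => b; rewrite dmap_jac.
by apply: Ck_mulmx => // i j; exact: smooth_jac.
Qed.

Lemma smooth_bI O' (u w : 'rV[R]_m -> 'rV[R]_m) : open O' -> O' `<=` Om -> smooth_on O' u ->
  smooth_on O' w -> smooth_on O' (fun b => bI b (u b) (w b)).
Proof.
move=> oO' sub su sw k; apply: Ck_dot => //; apply: Ck_mulmx => // i j.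
by apply: (@Ck_sub _ _ _ Om) => //; exact: smooth_first_form.
Qed.

Section TwoCurvatures.
Hypothesis two : forall a x, Om a -> PC (f a) x -> exists2 y, PC (f a) = [set x; y] & x != y.

(** [k] is the simple curvature, with eigenvector field [w], so that [l] is the double one. *)
Definition curvature_pair (O' : set 'rV[R]_m) (k l : 'rV[R]_m -> R) (w : 'rV[R]_m -> 'rV[R]_m) :=
  [/\ open O', O' `<=` Om, eigenpair O' k w, smooth_on O' l &
      forall b, O' b -> PC (f b) = [set k b; l b] /\ k b != l b].

(** The double curvature has no distinguished eigenvector to follow. Instead a fixed vector [e] is
    projected off [w], which gives an [l]-eigenvector v, and l = II(v, e)/I(v, e) is visibly
    smooth. *)
Lemma exists_curvature_pair a0 x : Om a0 -> PC (f a0) x ->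
  exists O' (k l : 'rV[R]_m -> R) (w : 'rV[R]_m -> 'rV[R]_m), curvature_pair O' k l w /\ O' a0.
Proof.
move=> Oa /(two Oa)[y PCa xy].
have [k1 [k2 [w0 [PCa' k12 w00 Ew0 simple]]]] := simple_of_two Oa PCa xy.
have [U1 [k [w [oU1 U1a U1O [sk sw] [ka H]]]]] := simple_eigenpair oO
  smooth_second_form smooth_first_form second_form_sym (fun a _ => first_form_sym a)
  first_form_pos Oa w00 Ew0 simple.
have [e e0 Ee] : exists2 e, e != 0 & eigen a0 k2 e.
  by apply/(chart_curvature _ Oa); rewrite PCa'; right.
have [wn0 Ew _] := H a0 U1a; rewrite ka in Ew.
have ew : bI a0 e (w a0) = 0 by rewrite bI_sym; exact: eigen_ortho Oa Ew Ee k12.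
pose ww b := bI b (w b) (w b).
have ww0 b : U1 b -> ww b != 0.
  by move=> U1b; have [wb _ _] := H b U1b; rewrite gt_eqF// bI_gt0//; exact: U1O.
(* With v the component of [e] orthogonal to [w], I(v, e) = I(e, e) - q and II(v, e) = II(e, e) - k
   q. *)
pose q b := (bI b e (w b) * bI b e (w b)) / ww b.
pose den b := bI b e e - q b.
have scst j : Ck j U1 (fun _ : 'rV[R]_m => e) by exact: Ck_cst.
have sq j : Ck j U1 q.
  apply: CkM => //; last by apply: CkV => //; exact: (smooth_bI oU1 U1O sw sw j).
  by apply: CkM => //; exact: smooth_bI oU1 U1O scst sw j.
have sden j : Ck j U1 den.
  by apply: CkD => //; [exact: (smooth_bI oU1 U1O scst scst j)|exact: CkN].
pose l b := (dot (e *m second_form b) e - k b * q b) / den b.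
pose O' := U1 `&` den @^-1` [set t : R | t != 0].
have oO' : open O' by apply: open_preim_Ck oU1 _ (sden 0%N); exact: open_neq.
have O'U1 : O' `<=` U1 by move=> ? [].
have sl j : Ck j O' l.
  apply: CkM => //; last by apply: CkV => //; [move=> ? []|exact: Ck_sub (sden j)].
  apply: (@Ck_sub _ _ _ U1) => //; apply: CkD => //; last by apply: CkN => //; exact: CkM.
  apply: Ck_dot => //; apply: Ck_mulmx => // i i'.
  by apply: (@Ck_sub _ _ _ Om) => //; exact: smooth_second_form.
exists O', k, l, w; split; last first.
  by split=> //=; rewrite /den /q ew mul0r mul0r subr0 gt_eqF// bI_gt0.
split=> //; first by move=> b /O'U1/U1O.
- split; [by move=> j; exact: Ck_sub (sk j)|by move=> j; exact: Ck_sub (sw j)|].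
  by move=> b /O'U1/H.
move=> b O'b; have [U1b dn] := O'b; have Ob := U1O b U1b; have [wb Ewb sb] := H b U1b.
have Pk : PC (f b) (k b) by apply/(chart_curvature _ Ob); exists (w b).
have [y' PCb ky] := two Ob Pk.
suff -> : l b = y' by [].
pose t := bI b e (w b) / ww b; pose v := e - t *: w b.
have vw : bI b v (w b) = 0.
  by rewrite /v mulmxBl -scalemxAl dotBl dotZl /t divfK ?subrr// ww0.
have Ev := simple_ortho_eigen Ob PCb ky wb Ewb sb vw.
have H1 : dot (v *m second_form b) e = dot (e *m second_form b) e - k b * q b.
  rewrite /v mulmxBl -scalemxAl dotBl dotZl Ewb dotZl (bI_sym b (w b)) /q /t.
  by congr (_ - _); ring.
have H2 : bI b v e = den b.
  rewrite /v mulmxBl -scalemxAl dotBl dotZl (bI_sym b (w b)) /den /q /t.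
  by congr (_ - _); ring.
by rewrite /l -H1 Ev dotZl H2 mulfK.
Qed.

Variables (O' : set 'rV[R]_m) (k l : 'rV[R]_m -> R) (w : 'rV[R]_m -> 'rV[R]_m).
Hypothesis pair : curvature_pair O' k l w.

Let oO' : open O'. Proof. by have [] := pair. Qed.
Let sub : O' `<=` Om. Proof. by have [] := pair. Qed.

Lemma pair_split b u : O' b -> exists t v, [/\ u = t *: w b + v, bI b v (w b) = 0, eigen b (l b) v &
  t = bI b u (w b) / bI b (w b) (w b)].
Proof.
move=> O'b; have Ob := sub O'b.
have [_ _ [_ _ /(_ b O'b)[w0 Ew simple]] _ /(_ b O'b)[PCb kl]] := pair.
pose t := bI b u (w b) / bI b (w b) (w b).
have vw : bI b (u - t *: w b) (w b) = 0.
  by rewrite mulmxBl -scalemxAl dotBl dotZl /t divfK ?subrr// gt_eqF// bI_gt0.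
exists t, (u - t *: w b); split=> //; first by rewrite addrC subrK.
exact: simple_ortho_eigen Ob PCb kl w0 Ew simple vw.
Qed.

(* In the direction of [u] the second curvature satisfies
   [dn u + l df u = t (l - k) df w], where [t] is the [w]-component of [u]. *)
Lemma pair_defect b u : O' b ->
  dmap n b u + l b *: dmap f b u =
  ((l b - k b) * (bI b u (w b) / bI b (w b) (w b))) *: dmap f b (w b).
Proof.
move=> O'b; have Ob := sub O'b; have [t [v [-> _ Ev <-]]] := pair_split u O'b.
have [_ _ [_ _ /(_ b O'b)[_ Ew _]] _ _] := pair.
rewrite !dmapD !dmapZ (iffLR (eigenP _ _ Ob) Ew) (iffLR (eigenP _ _ Ob) Ev).
by apply/rowP => j; rewrite !mxE; ring.
Qed.

(** [pair_defect] is paired with the fixed vector [z] and differentiated along [X]. Its right-hand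
    side becomes a product of two functions that both vanish at [a], so its derivative there is
    zero. *)
Lemma pair_derivative a u X (z : 'rV[R]_m.+2) : O' a -> bI a u (w a) = 0 -> dot (dmap f a (w a)) z = 0 ->
  dot ('D_X ('D_u n) a) z + ('D_X l a * dot (dmap f a u) z + l a * dot ('D_X ('D_u f) a) z) = 0.
Proof.
move=> O'a uw wz; have Oa := sub O'a.
have [_ _ [sk sw Hw] sl _] := pair.
have scst j (c : 'rV[R]_m) : Ck j O' (fun _ : 'rV[R]_m => c) by exact: Ck_cst.
pose p b := (l b - k b) * (bI b u (w b) / bI b (w b) (w b)).
pose q b := dot (dmap f b (w b)) z.
have sp j : Ck j O' p.
  apply: CkM => //; first by apply: CkD => //; exact: CkN.
  apply: CkM => //; first exact: (smooth_bI oO' sub (fun j => scst j u) sw j).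
  apply: CkV => //; last exact: (smooth_bI oO' sub sw sw j).
  by move=> b O'b; have [wb _ _] := Hw b O'b; rewrite gt_eqF// bI_gt0//; exact: sub.
have sq j : Ck j O' q.
  by apply: Ck_dot => //; [exact: smooth_dmap oO' sub sw j|exact: Ck_cst].
have p0 : p a = 0 by rewrite /p uw mul0r mulr0.
have q0 : q a = 0 by exact: wz.
have dz : is_derive a X (cst z : 'rV[R]_m -> 'rV[R]_m.+2) 0 by exact: is_derive_cst.
have Hn : is_derive a X ('D_u n) ('D_X ('D_u n) a).
  by apply/derivableP/diff_derivable; exact: ((normal_smooth 2).2 u).1.
have Hf : is_derive a X ('D_u f) ('D_X ('D_u f) a).
  by apply/derivableP/diff_derivable; exact: ((chart_smooth 2).2 u).1.
have Hl : is_derive a X l ('D_X l a) by apply/derivableP/diff_derivable; exact: (sl 1%N).1.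
have Hp : is_derive a X p ('D_X p a) by apply/derivableP/diff_derivable; exact: (sp 1%N).1.
have Hq : is_derive a X q ('D_X q a) by apply/derivableP/diff_derivable; exact: (sq 1%N).1.
have Dfa : 'D_u f a = dmap f a u by rewrite deriveE ?dmapE//; exact: chart_differentiable.
have H1 := is_deriveD (is_derive_dot Hn dz) (is_deriveM Hl (is_derive_dot Hf dz)).
have H2 := is_deriveM Hp Hq.
have E : \forall b \near a, p b * q b = dot ('D_u n b) z + l b * dot ('D_u f b) z.
  near=> b; have O'b : O' b by near: b; exact: open_nbhs_nbhs.
  have Dn : 'D_u n b = dmap n b u.
    by rewrite deriveE ?dmapE//; exact: normal_differentiable (sub O'b).
  have Df : 'D_u f b = dmap f b u.
    by rewrite deriveE ?dmapE//; exact: chart_differentiable (sub O'b).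
  rewrite Dn Df.
  have := congr1 (fun y => dot y z) (pair_defect u O'b).
  by rewrite dotDl !dotZl => /esym.
have K (d1 d2 d3 d4 d5 pa qa Dp Dq la Dl : R) : d2 = 0 -> d4 = 0 -> pa = 0 -> qa = 0 ->
    d1 + d2 + (la * (d3 + d4) + d5 * Dl) = pa * Dq + qa * Dp -> d1 + (Dl * d5 + la * d3) = 0.
  by move=> -> -> -> ->; rewrite !mul0r !addr0 => <-; rewrite [X in _ + X]addrC (mulrC d5).
have U := is_derive_unique H1 (near_eq_is_derive E H2).
by rewrite -Dfa; exact: K (dot0r _) (dot0r _) p0 q0 U.
Unshelve. all: by end_near. Qed.

(** The Codazzi equation. For orthogonal X, Y in the eigenplane of [l], [pair_derivative] is applied
    with the roles of X and Y exchanged; mixed second derivatives agree, which leaves (D_X l) I(Y,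
    Y) = (D_Y l) I(X, Y) = 0. *)
Lemma second_curvature_constant a X : O' a -> bI a X (w a) = 0 -> 'D_X l a = 0.
Proof.
move=> O'a Xw; have Oa := sub O'a.
have dl : differentiable l a by have [_ _ _ sl _] := pair; exact: (sl 1%N).1.
have [->|X0] := eqVneq X 0; first by rewrite deriveE// linear0.
have [_ _ [_ _ /(_ a O'a)[w0 Ew simple]] _ /(_ a O'a)[PCa kl]] := pair.
have EX := simple_ortho_eigen Oa PCa kl w0 Ew simple Xw.
have wX : bI a (w a) X = 0 by rewrite bI_sym.
have [_ [Y [Y0 _ wY XY]]] := third_eigenvector Oa w0 X0 Ew EX wX.
have Yw : bI a Y (w a) = 0 by rewrite bI_sym.
pose z := dmap f a Y.
have wz : dot (dmap f a (w a)) z = 0 by rewrite -first_formE.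
have HX := pair_derivative X O'a Yw wz.
have HY := pair_derivative Y O'a Xw wz.
have Sn := schwarz_rV X Y oO Oa (normal_smooth 2).
have Sf := schwarz_rV X Y oO Oa (chart_smooth 2).
rewrite Sn Sf -[dot (dmap f a X) z]first_formE XY mulr0 add0r in HY.
move: HX; rewrite addrCA HY addr0 -first_formE => /eqP.
by rewrite mulf_eq0 (gt_eqF (bI_gt0 Oa Y0)) orbF => /eqP.
Qed.

Lemma pair_constant_near a0 : O' a0 -> constant_near a0.
Proof.
move=> O'a0; have [_ _ Ekw sl PCkl] := pair; have [sk _ _] := Ekw.
have /nbhs_ballP[r /= r0 Hr] : nbhs a0 O' by exact: open_nbhs_nbhs.
have dk a : ball a0 r a -> differentiable k a by move=> /Hr; exact: (sk 1%N).1.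
have dl a : ball a0 r a -> differentiable l a by move=> /Hr; exact: (sl 1%N).1.
have rO : ball a0 r `<=` Om by move=> a /Hr/sub.
have kl a u : ball a0 r a -> 'D_u k a = 0 -> 'D_u l a = 0.
  apply: (rigid_pair rO) => b rb; have [-> kb] := PCkl b (Hr b rb).
  by split; [exact: dk|exact: dl|left|right|].
have lk a u : ball a0 r a -> 'D_u l a = 0 -> 'D_u k a = 0.
  apply: (rigid_pair rO) => b rb; have [-> kb] := PCkl b (Hr b rb).
  by split; [exact: dl|exact: dk|right|left|rewrite eq_sym].
(* Along [w] the simple curvature is constant, so rigidity applies; across [w] the Codazzi equation
   does. *)
have Dl a u : ball a0 r a -> 'D_u l a = 0.
  move=> ra; have O'a := Hr a ra; have [t [v [-> vw _ _]]] := pair_split u O'a.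
  have D1 := kl a (w a) ra (curvature_line_constant oO' sub Ekw O'a).
  have D2 := second_curvature_constant O'a vw.
  rewrite deriveE; last exact: dl.
  rewrite linearD linearZ -!deriveE; [|exact: dl|exact: dl].
  by rewrite D1 D2 [LHS]addr0; exact: mulr0.
have Dk a u : ball a0 r a -> 'D_u k a = 0 by move=> ra; apply: lk ra (Dl a u ra).
have ck a : ball a0 r a -> k a = k a0.
  by move=> ra; apply: derive0_ball_const ra => b rb; split; [exact: dk|move=> u; exact: Dk].
have cl a : ball a0 r a -> l a = l a0.
  by move=> ra; apply: derive0_ball_const ra => b rb; split; [exact: dl|move=> u; exact: Dl].
suff H a : ball a0 r a -> PC (f a) = PC (f a0).
  by apply: filterS H _; apply: nbhsx_ballx.
move=> ra; have [-> _] := PCkl a (Hr a ra); have [-> _] := PCkl a0 O'a0.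
by rewrite ck// cl.
Qed.

End TwoCurvatures.

End LocalGeometry.

Section Cardinality.
Import finmap.
Variable T : choiceType.

Lemma card_II_seqP (A : set T) n : (A #= `I_n)%card <->
  exists s : seq T, [/\ uniq s, size s = n & A = [set` s]].
Proof.
split=> [An|[s [us <- ->]]].
  have [X AX] : exists X : {fset T}, A = [set` X] by apply/finite_fsetP; exists n.
  move: An; rewrite AX => /card_eq_fsetP Xn; by exists X; split; [exact: fset_uniq| |].
have -> : [set` s] = [set` [fset x in s]%fset] by apply/seteqP; split=> x; rewrite /= inE.
by apply/card_eq_fsetP; rewrite card_fseq undup_id.
Qed.

Lemma card_two (A : set T) x : (A #= `I_2)%card -> A x -> exists2 y, A = [set x; y] & x != y.
Proof.
move=> /card_II_seqP[s [us s2 ->]].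
case: s us s2 => [|a [|b [|//]]] //= + _; rewrite inE andbT => ab.
rewrite /= !inE => /orP[]/eqP ->; [exists b|exists a] => //; last by rewrite eq_sym.
  apply/seteqP; split=> y; rewrite /= !inE; first by move=> /orP[]/eqP ->; auto.
  by move=> [] ->; rewrite eqxx ?orbT.
apply/seteqP; split=> y; rewrite /= !inE; first by move=> /orP[]/eqP ->; auto.
by move=> [] ->; rewrite eqxx ?orbT.
Qed.

Lemma card_three (A : set T) : (A #= `I_3)%card ->
  (exists x y z, [/\ A = [set x; y; z], x != y, x != z & y != z]) /\
  (forall x y z, A x -> A y -> A z -> x != y -> x != z -> y != z -> A = [set x; y; z]).
Proof.
move=> /card_II_seqP[s [us s3 ->]]; split.
  case: s us s3 => [|a [|b [|c [|//]]]] //= + _; rewrite !inE andbT negb_or => /andP[/andP[ab ac] bc].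
  exists a, b, c; split=> //; apply/seteqP; split=> y; rewrite /= !inE.
    by move=> /or3P[]/eqP ->; auto.
  by move=> [[]|] ->; rewrite eqxx ?orbT.
move=> x y z sx sy sz xy xz yz.
have u : uniq [:: x; y; z] by rewrite /= !inE negb_or xy xz yz.
have sub : {subset [:: x; y; z] <= s} by move=> t; rewrite !inE => /or3P[]/eqP ->.
have [_ E] := uniq_min_size u sub ltac:(by rewrite s3).
apply/seteqP; split=> t; rewrite /= -E !inE.
  by move=> /or3P[]/eqP ->; auto.
by move=> [[]|] ->; rewrite eqxx ?orbT.
Qed.

End Cardinality.

Lemma continuous_near (T U : topologicalType) (F : T -> U) x (A : set U) :
  {for x, continuous F} -> nbhs (F x) A -> \forall y \near x, A (F y).
Proof. by move=> cF N; exact: (cF _ N). Qed.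

(** Points of [D] near phi a are images of points near [a], because the extension of the inverse
    chart is continuous. *)
Lemma chart_near (R : realType) N d (D W : set 'rV[R]_N) (Om : set 'rV[R]_d) phi a
    (Q : set 'rV[R]_N) : open W -> diffeomorphism Om (D `&` W) phi -> Om a ->
  (\forall b \near a, Q (phi b)) -> \forall y \near phi a, D y -> Q y.
Proof.
move=> oW [sphi [psi [spsi H1 H2]]] Oa Qa.
have [[Da Wa] pa] := H1 a Oa.
have [F [U [oU Ux sF FE]]] := spsi _ (conj Da Wa).
have nF : \forall y \near phi a, (fun b => Q (phi b)) (F y).
  by apply: (@continuous_near _ _ F _ (fun b => Q (phi b))); [exact: (sF 0%N _ Ux)|rewrite FE// pa].
near=> y => Dy.
have Wy : W y by near: y; exact: open_nbhs_nbhs.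
have Uy : U y by near: y; exact: open_nbhs_nbhs.
have [_ fy] := H2 y (conj Dy Wy).
have Qy : Q (phi (F y)) by near: y; exact: nF.
by rewrite (FE y (conj Dy Wy) Uy) fy in Qy.
Unshelve. all: by end_near. Qed.

(* If [k1, k2] is a pair of principal curvatures then [(1 + k1 k2) / (k2 - k1)]
   is the cotangent of the difference of the corresponding angles. *)
Theorem finite_angles_isoparametric (R : realType) (M : set 'rV[R]_5) (xi : 'rV[R]_5 -> 'rV[R]_5)
    (g : nat) (vals : seq R) : g = 2%N \/ g = 3%N ->
  @oriented_hypersurface R 5 4 M idfun xi -> connected M -> proper_dupin M idfun xi g ->
  (forall x k l, M x -> principal_curvatures M idfun xi x k ->
     principal_curvatures M idfun xi x l -> k != l -> (1 + k * l) / (l - k) \in vals) ->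
  isoparametric M idfun xi.
Proof.
move=> hg HM cM [HD HC] Hv x y Mx My.
apply: (connected_locally_constant cM _ Mx My) => {x y Mx My} x Mx.
have [W [Om [phi [oW Wx oO dphi]]]] := oh_submanifold HM Mx.
have [sphi [psi [spsi H1 H2]]] := dphi.
have [Oa fa] := H2 x (conj Mx Wx); set a := psi x in Oa fa.
have MO b : Om b -> M (phi b) by move=> /H1[[]].
have Hv' b k l : Om b -> principal_curvatures M idfun xi (phi b) k ->
     principal_curvatures M idfun xi (phi b) l -> k != l -> (1 + k * l) / (l - k) \in vals.
  by move=> /MO; exact: Hv.
have near_a : constant_near M xi phi a.
  case: hg => gE; rewrite gE in HC.
    have two b z : Om b -> principal_curvatures M idfun xi (phi b) z ->
      exists2 t, principal_curvatures M idfun xi (phi b) = [set z; t] & z != t.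
      by move=> /MO/HC; exact: card_two.
    have [z Pz] : exists z, principal_curvatures M idfun xi (phi a) z.
      have /card_II_seqP[s [_ s2 ->]] := HC _ (MO a Oa).
      by case: s s2 => // z s _; exists z; rewrite /= inE eqxx.
    have [U' [k [l [w [kl U'a]]]]] :=
      @exists_curvature_pair _ _ _ _ HM W Om phi oW oO dphi _ erefl erefl two a z Oa Pz.
    exact: (@pair_constant_near _ _ _ _ HM W Om phi oW oO dphi _ erefl HD erefl vals Hv' U' k l w kl a U'a).
  have [[k1 [k2 [k3 [PCa k12 k13 k23]]]] _] := card_three (HC _ (MO a Oa)).
  apply: (@constant_near3 _ _ _ _ HM W Om phi oW oO dphi _ erefl HD erefl vals Hv' a k1 k2 k3) => //.
  by move=> b /MO/HC/card_three[].
pose Q y := principal_curvatures M idfun xi y = principal_curvatures M idfun xi x.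
rewrite /constant_near fa in near_a.
by have := chart_near (Q := Q) oW dphi Oa near_a; rewrite fa.
Qed.

(** * The Clifford action behind the Hopf fibration *)

Section Clifford.
Variable R : realType.
Implicit Types (u v a : 'rV[R]_5) (x y Y : 'rV[R]_8) (s t : seq R).

(** Vectors given by explicit lists of coordinates, which turns quaternionic identities into
    coordinatewise [ring] goals. *)
Definition row_of (n : nat) s : 'rV[R]_n := \row_(l < n) nth 0 s l.

Lemma row_of_inord n s k : (k < n.+1)%N -> row_of n.+1 s 0 (inord k) = nth 0 s k.
Proof. by move=> kn; rewrite mxE inordK. Qed.

Lemma row_of5P v : exists a b c d r : R, v = row_of 5 [:: a; b; c; d; r].
Proof.
pose c k := v 0 (inord k); exists (c 0%N), (c 1%N), (c 2%N), (c 3%N), (c 4%N).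
apply/rowP => l; rewrite mxE /c.
by case: l => [[|[|[|[|[|//]]]]] lt] /=; congr (v 0 _); apply: val_inj; rewrite /= inordK.
Qed.

Lemma row_of8P x : exists z0 z1 z2 z3 z4 z5 z6 z7 : R, x = row_of 8 [:: z0; z1; z2; z3; z4; z5; z6; z7].
Proof.
pose c k := x 0 (inord k).
exists (c 0%N), (c 1%N), (c 2%N), (c 3%N), (c 4%N), (c 5%N), (c 6%N), (c 7%N).
apply/rowP => l; rewrite mxE /c.
by case: l => [[|[|[|[|[|[|[|[|//]]]]]]]] lt] /=; congr (x 0 _); apply: val_inj; rewrite /= inordK.
Qed.

Lemma dot_row_of n s t : dot (row_of n s) (row_of n t) = \sum_(l < n) nth 0 s l * nth 0 t l.
Proof. by apply: eq_bigr => l _; rewrite !mxE. Qed.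

Lemma row_ofD n s t : size s = size t ->
  row_of n s + row_of n t = row_of n [seq p.1 + p.2 | p <- zip s t].
Proof.
move=> st; apply/rowP => l; rewrite !mxE; move: (nat_of_ord l) => k.
elim: s t st k => [|a s IH] [|b t] //= st [|k] //=; rewrite ?nth_nil ?addr0//.
by apply: IH; case: st.
Qed.

Lemma row_ofZ n c s : c *: row_of n s = row_of n [seq c * z | z <- s].
Proof.
apply/rowP => l; rewrite !mxE; move: (nat_of_ord l) => k.
by elim: s k => [|a s IH] [|k] //=; rewrite ?nth_nil ?mulr0.
Qed.

Lemma row_ofN n s : - row_of n s = row_of n [seq - z | z <- s].
Proof.
apply/rowP => l; rewrite !mxE; move: (nat_of_ord l) => k.
by elim: s k => [|a s IH] [|k] //=; rewrite ?nth_nil ?oppr0.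
Qed.

(* The Clifford action [(a, r) (p, q) = (a q + r p, conj a p - r q)] of H x R on H x H. *)
Definition cliff v x : 'rV[R]_8 :=
  let a := v 0 (inord 0) in let b := v 0 (inord 1) in let c := v 0 (inord 2) in
  let d := v 0 (inord 3) in let r := v 0 (inord 4) in
  let z k := x 0 (inord k) in
  row_of 8
  [:: a * z 4%N - b * z 5%N - c * z 6%N - d * z 7%N + r * z 0%N;
     a * z 5%N + b * z 4%N + c * z 7%N - d * z 6%N + r * z 1%N;
     a * z 6%N - b * z 7%N + c * z 4%N + d * z 5%N + r * z 2%N;
     a * z 7%N + b * z 6%N - c * z 5%N + d * z 4%N + r * z 3%N;
     a * z 0%N + b * z 1%N + c * z 2%N + d * z 3%N - r * z 4%N;
     a * z 1%N - b * z 0%N - c * z 3%N + d * z 2%N - r * z 5%N;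
     a * z 2%N + b * z 3%N - c * z 0%N - d * z 1%N - r * z 6%N;
     a * z 3%N - b * z 2%N + c * z 1%N - d * z 0%N - r * z 7%N].

(* right multiplication by the unit quaternions i, j, k *)
Definition right_unit (q : nat) x : 'rV[R]_8 :=
  let z k := x 0 (inord k) in
  row_of 8 (nth [::]
    [:: [:: - z 1%N; z 0%N; z 3%N; - z 2%N; - z 5%N; z 4%N; z 7%N; - z 6%N];
        [:: - z 2%N; - z 3%N; z 0%N; z 1%N; - z 6%N; - z 7%N; z 4%N; z 5%N];
        [:: - z 3%N; z 2%N; - z 1%N; z 0%N; - z 7%N; z 6%N; - z 5%N; z 4%N]] q).

Lemma cliff_row_of (a b c d r z0 z1 z2 z3 z4 z5 z6 z7 : R) :
  cliff (row_of 5 [:: a; b; c; d; r]) (row_of 8 [:: z0; z1; z2; z3; z4; z5; z6; z7]) =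
  row_of 8
  [:: a * z4 - b * z5 - c * z6 - d * z7 + r * z0;
     a * z5 + b * z4 + c * z7 - d * z6 + r * z1;
     a * z6 - b * z7 + c * z4 + d * z5 + r * z2;
     a * z7 + b * z6 - c * z5 + d * z4 + r * z3;
     a * z0 + b * z1 + c * z2 + d * z3 - r * z4;
     a * z1 - b * z0 - c * z3 + d * z2 - r * z5;
     a * z2 + b * z3 - c * z0 - d * z1 - r * z6;
     a * z3 - b * z2 + c * z1 - d * z0 - r * z7].
Proof. by rewrite /cliff !row_of_inord. Qed.

Lemma right_unit_row_of q (z0 z1 z2 z3 z4 z5 z6 z7 : R) :
  right_unit q (row_of 8 [:: z0; z1; z2; z3; z4; z5; z6; z7]) =
  row_of 8 (nth [::]
    [:: [:: - z1; z0; z3; - z2; - z5; z4; z7; - z6];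
        [:: - z2; - z3; z0; z1; - z6; - z7; z4; z5];
        [:: - z3; z2; - z1; z0; - z7; z6; - z5; z4]] q).
Proof. by rewrite /right_unit !row_of_inord. Qed.

Lemma hopf_row_of (z0 z1 z2 z3 z4 z5 z6 z7 : R) : hopf (row_of 8 [:: z0; z1; z2; z3; z4; z5; z6; z7]) =
  row_of 5
  [:: 2 * (z0 * z4 + z1 * z5 + z2 * z6 + z3 * z7);
     2 * (z1 * z4 - z0 * z5 - z2 * z7 + z3 * z6);
     2 * (z2 * z4 - z0 * z6 + z1 * z7 - z3 * z5);
     2 * (z3 * z4 - z0 * z7 - z1 * z6 + z2 * z5);
     z0 * z0 + z1 * z1 + z2 * z2 + z3 * z3 - (z4 * z4 + z5 * z5 + z6 * z6 + z7 * z7)].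
Proof.
rewrite /hopf; set x := row_of 8 _.
have xl : lsubmx (x : 'rV_(4 + 4)) = row_of 4 [:: z0; z1; z2; z3].
  by apply/rowP => -[[|[|[|[|//]]]] lt]; rewrite !mxE.
have xr : rsubmx (x : 'rV_(4 + 4)) = row_of 4 [:: z4; z5; z6; z7].
  by apply/rowP => -[[|[|[|[|//]]]] lt]; rewrite !mxE.
have xc : qconj (row_of 4 [:: z4; z5; z6; z7]) = row_of 4 [:: z4; - z5; - z6; - z7].
  by apply/rowP => -[[|[|[|[|//]]]] lt]; rewrite !mxE.
rewrite xl xr xc /qmul /qcoef !row_of_inord//= !dot_row_of !big_ord_recl !big_ord0 /=.
apply/(@rowP _ (4 + 1)) => l; rewrite -(splitK l); case: (fintype.split l) => i /=.
  by rewrite row_mxEl !mxE; case: i => [[|[|[|[|//]]]] lt] /=; ring.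
by rewrite row_mxEr !mxE (ord1 i) /= mulr1n; ring.
Qed.

Lemma hopf_cliff v x : dot (hopf x) v = dot (cliff v x) x.
Proof.
have [a [b [c [d [r ->]]]]] := row_of5P v; have [z0 [z1 [z2 [z3 [z4 [z5 [z6 [z7 ->]]]]]]]] := row_of8P x.
by rewrite hopf_row_of cliff_row_of !dot_row_of !big_ord_recl !big_ord0 /=; ring.
Qed.

Lemma cliffDl u v x : cliff (u + v) x = cliff u x + cliff v x.
Proof.
by apply/rowP => l; rewrite !mxE; case: l => [[|[|[|[|[|[|[|[|//]]]]]]]] lt] /=; ring.
Qed.

Lemma cliffDr v x y : cliff v (x + y) = cliff v x + cliff v y.
Proof.
by apply/rowP => l; rewrite !mxE; case: l => [[|[|[|[|[|[|[|[|//]]]]]]]] lt] /=; ring.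
Qed.

Lemma cliffZl k v x : cliff (k *: v) x = k *: cliff v x.
Proof.
by apply/rowP => l; rewrite !mxE; case: l => [[|[|[|[|[|[|[|[|//]]]]]]]] lt] /=; ring.
Qed.

Lemma cliffZr k v x : cliff v (k *: x) = k *: cliff v x.
Proof.
by apply/rowP => l; rewrite !mxE; case: l => [[|[|[|[|[|[|[|[|//]]]]]]]] lt] /=; ring.
Qed.

Lemma cliff0r v : cliff v 0 = 0.
Proof. by rewrite -(scale0r 0) cliffZr !scale0r. Qed.

Lemma cliff0l x : cliff 0 x = 0.
Proof. by rewrite -(scale0r 0) cliffZl scale0r. Qed.

Lemma cliff_sym v x y : dot (cliff v x) y = dot x (cliff v y).
Proof.
have [a [b [c [d [r ->]]]]] := row_of5P v; have [z0 [z1 [z2 [z3 [z4 [z5 [z6 [z7 ->]]]]]]]] := row_of8P x.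
have [y0 [y1 [y2 [y3 [y4 [y5 [y6 [y7 ->]]]]]]]] := row_of8P y.
by rewrite !cliff_row_of !dot_row_of !big_ord_recl !big_ord0 /=; ring.
Qed.

Lemma cliff_sqr v x : cliff v (cliff v x) = dot v v *: x.
Proof.
have [a [b [c [d [r ->]]]]] := row_of5P v; have [z0 [z1 [z2 [z3 [z4 [z5 [z6 [z7 ->]]]]]]]] := row_of8P x.
rewrite !cliff_row_of row_ofZ dot_row_of !big_ord_recl !big_ord0 /=.
by do ![congr (_ :: _) || congr (row_of _ _)]; ring.
Qed.

Lemma cliff_hopf x : cliff (hopf x) x = dot x x *: x.
Proof.
have [z0 [z1 [z2 [z3 [z4 [z5 [z6 [z7 ->]]]]]]]] := row_of8P x.
rewrite hopf_row_of cliff_row_of row_ofZ dot_row_of !big_ord_recl !big_ord0 /=.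
by do ![congr (_ :: _) || congr (row_of _ _)]; ring.
Qed.

(** Polarization of [cliff_sqr]. *)
Lemma cliff_anti u v x : cliff u (cliff v x) + cliff v (cliff u x) = (2 * dot u v) *: x.
Proof.
have := cliff_sqr (u + v) x; rewrite !(cliffDl, cliffDr, dotDl, dotDr) !cliff_sqr => H.
move: (cliff u (cliff v x)) (cliff v (cliff u x)) H => A B /rowP H.
by apply/rowP => l; move: (H l); rewrite !mxE (dotC v u); lra.
Qed.

(** Polarization of the quadratic map [hopf]; by [is_derive_hopf] it is the differential of [hopf]
    at [x]. *)
Definition hopf_diff x Y := hopf (x + Y) - hopf x - hopf Y.

Lemma dot_hopf_diff x Y v : dot (hopf_diff x Y) v = 2 * dot (cliff v x) Y.
Proof.
rewrite /hopf_diff !dotBl !hopf_cliff cliffDr !(dotDl, dotDr) (cliff_sym v Y x) [dot Y (cliff v x)]dotC.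
by ring.
Qed.

Lemma dot_inj n (u v : 'rV[R]_n) : (forall w, dot u w = dot v w) -> u = v.
Proof.
move=> H; apply/eqP; rewrite -subr_eq0; apply/eqP/dot_eq0.
by rewrite dotBl H subrr.
Qed.

Lemma hopf_diffD x Y y : hopf_diff x (Y + y) = hopf_diff x Y + hopf_diff x y.
Proof. by apply: dot_inj => v; rewrite dotDl !dot_hopf_diff dotDr mulrDr. Qed.

Lemma hopf_diffZ x k Y : hopf_diff x (k *: Y) = k *: hopf_diff x Y.
Proof. by apply: dot_inj => v; rewrite dotZl !dot_hopf_diff dotZr mulrCA. Qed.

Lemma cliff_hopf_diff x Y :
  cliff (hopf_diff x Y) x = dot x x *: Y - cliff (hopf x) Y + (2 * dot x Y) *: x.
Proof.
have [z0 [z1 [z2 [z3 [z4 [z5 [z6 [z7 ->]]]]]]]] := row_of8P x.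
have [y0 [y1 [y2 [y3 [y4 [y5 [y6 [y7 ->]]]]]]]] := row_of8P Y.
rewrite /hopf_diff row_ofD//= !hopf_row_of cliff_row_of ?row_ofN ?row_ofD//= !cliff_row_of.
rewrite !dot_row_of !big_ord_recl !big_ord0 /= !row_ofZ ?row_ofN/= !row_ofD//=.
by do ![congr (_ :: _) || congr (row_of _ _)]; ring.
Qed.

(** The products of [x] with i, j, k span the directions along the fibre. Thus [hopf_diff x Y] and
    three vertical coordinates determine [Y], which makes the coordinates in
    [hopf_preimage_submanifold] nondegenerate. *)
Lemma hopf_frame x Y : (2 * dot x x) *: Y = cliff (hopf_diff x Y) x +
  2 *: \sum_(q < 3) dot Y (right_unit q x) *: right_unit q x.
Proof.
rewrite cliff_hopf_diff !big_ord_recl big_ord0 addr0.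
have [z0 [z1 [z2 [z3 [z4 [z5 [z6 [z7 ->]]]]]]]] := row_of8P x.
have [y0 [y1 [y2 [y3 [y4 [y5 [y6 [y7 ->]]]]]]]] := row_of8P Y.
rewrite !right_unit_row_of hopf_row_of cliff_row_of.
rewrite !dot_row_of !big_ord_recl !big_ord0 /= !row_ofZ ?row_ofN/= !row_ofD//= !row_ofZ/= !row_ofD//=.
by do ![congr (_ :: _) || congr (row_of _ _)]; ring.
Qed.

(** Tested against v, this concerns triple products <H(a)H(b)H(c)x, x>. Self-adjointness makes them
    invariant under reversal, and the Clifford relation exchanges neighbouring factors at the cost
    of terms <H(c)x, x> = <h(x), c>. *)
Lemma hopf_diff_cliff2 x u a : hopf_diff x (cliff u (cliff a x)) =
  2 *: (dot (hopf x) a *: u - dot (hopf x) u *: a + dot u a *: hopf x).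
Proof.
apply: dot_inj => v; rewrite dot_hopf_diff dotZl; congr (2 * _).
rewrite dotDl dotBl !dotZl !hopf_cliff.
pose T a b c := dot (cliff a (cliff b (cliff c x))) x.
have Tanti1 a1 b c : T a1 b c + T b a1 c = 2 * dot a1 b * dot (cliff c x) x.
  by rewrite -dotDl cliff_anti dotZl.
have Trev a1 b c : T a1 b c = T c b a1.
  by rewrite /T cliff_sym cliff_sym cliff_sym dotC.
have Tanti2 a1 b c : T a1 b c + T a1 c b = 2 * dot b c * dot (cliff a1 x) x.
  by rewrite (Trev a1 b c) (Trev a1 c b) Tanti1 (dotC c).
have -> : dot (cliff v x) (cliff u (cliff a x)) = T v u a.
  by rewrite /T (cliff_sym v (cliff u _)) dotC.
have := Tanti1 v u a; have := Tanti2 u v a; have := Tanti1 u a v; have := Trev a u v.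
by rewrite (dotC v u) (dotC v a); lra.
Qed.

End Clifford.

Section BilinearDerivative.
Variable R : realType.

Lemma is_derive_row (V : normedModType R) n (F : V -> 'rV[R]_n) (x v : V) (dF : 'rV[R]_n) :
  (forall j, is_derive x v (fun t => F t 0 j) (dF 0 j)) -> is_derive x v F dF.
Proof.
move=> H; have dv : derivable F x v.
  by apply/derivable_mxP => i j; rewrite (ord1 i); have [] := H j.
split=> //; apply/rowP => j; rewrite derive_coord//; by have [] := H j.
Qed.

Lemma smooth_map_row_mx (V : normedModType R) n1 n2 (D : set V) (f : V -> 'rV[R]_n1)
    (g : V -> 'rV[R]_n2) : smooth_map D f -> smooth_map D g ->
  smooth_map D (fun x => row_mx (f x) (g x)).
Proof.
move=> sf sg x Dx; have [F [U [oU Ux sF FE]]] := sf x Dx.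
have [G [U' [oU' U'x sG GE]]] := sg x Dx.
exists (fun x => row_mx (F x) (G x)), (U `&` U'); split => //.
- exact: openI.
- move=> k; apply: Ck_row_mx; first exact: openI.
    by apply: Ck_sub (sF k) => ? [].
  by apply: Ck_sub (sG k) => ? [].
- by move=> y Dy [Uy U'y]; rewrite FE// GE.
Qed.

Lemma Ck_id (V : normedModType R) k (U : set V) : Ck k U (idfun : V -> V).
Proof. by apply: Ck_linear => y; exact. Qed.

Lemma dot_delta n (u : 'rV[R]_n) j : dot u (delta_mx 0 j) = u 0 j.
Proof.
rewrite /dot (bigD1 j)//= mxE !eqxx mulr1 big1 ?addr0// => i ij.
by rewrite mxE eqxx (negbTE ij) mulr0.
Qed.

Lemma additive_expand n m (f : 'rV[R]_n -> 'rV[R]_m) u : (forall u w, f (u + w) = f u + f w) ->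
  (forall c u, f (c *: u) = c *: f u) -> f u = \sum_k u 0 k *: f (delta_mx 0 k).
Proof.
move=> fD fZ; rewrite {1}[u]row_sum_delta.
have f0 : f 0 = 0 by rewrite -(scale0r 0) fZ scale0r.
rewrite (big_morph f fD f0); apply: eq_bigr => k _; exact: fZ.
Qed.

(** Matrices of the coordinates of the bilinear map [cliff], through which its derivative and
    smoothness reduce to those of [dot]. *)
Definition cliff_mx j : 'M[R]_(8, 5) := \matrix_(i, k) cliff (delta_mx 0 k) (delta_mx 0 i) 0 j.

Lemma cliff_coord (v : 'rV[R]_5) (x : 'rV[R]_8) j : cliff v x 0 j = dot v (x *m cliff_mx j).
Proof.
rewrite (additive_expand (f := fun w => cliff w x) v (fun u w => cliffDl u w x) (fun c u => cliffZl c u x)).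
rewrite summxE; apply: eq_bigr => k _; rewrite mxE [X in _ = _ * X]mxE; congr (_ * _).
rewrite (additive_expand (f := cliff (delta_mx 0 k)) x (cliffDr _) (fun c u => cliffZr c _ u)).
by rewrite summxE; apply: eq_bigr => i _; rewrite !mxE.
Qed.

Section Derive.
Variables (V : normedModType R).
Implicit Types (F : V -> 'rV[R]_5) (G : V -> 'rV[R]_8) (t v : V).

Lemma is_derive_mulmx n m (A : 'M[R]_(n, m)) (G : V -> 'rV[R]_n) t v (dG : 'rV[R]_n) :
  is_derive t v G dG -> is_derive t v (fun s => G s *m A) (dG *m A).
Proof.
move=> HG; apply: is_derive_row => j.
have dc : is_derive t v (cst (col j A)^T : V -> 'rV[R]_n) 0 by exact: is_derive_cst.
have E s : (G s *m A) 0 j = dot (G s) (col j A)^T.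
  by rewrite mxE; apply: eq_bigr => i _; rewrite !mxE.
have -> : (fun s => (G s *m A) 0 j) = (fun s => dot (G s) (col j A)^T) by exact/funext.
have -> : (dG *m A) 0 j = dot dG (col j A)^T + dot (G t) 0.
  by rewrite dot0r addr0 mxE; apply: eq_bigr => i _; rewrite !mxE.
exact: is_derive_dot HG dc.
Qed.

Lemma is_derive_cliff F G t v (dF : 'rV[R]_5) (dG : 'rV[R]_8) : is_derive t v F dF ->
  is_derive t v G dG ->
  is_derive t v (fun s => cliff (F s) (G s)) (cliff dF (G t) + cliff (F t) dG).
Proof.
move=> HF HG; apply: is_derive_row => j.
have -> : (fun s => cliff (F s) (G s) 0 j) = (fun s => dot (F s) (G s *m cliff_mx j)).
  by apply/funext => s; rewrite cliff_coord.
have -> : (cliff dF (G t) + cliff (F t) dG) 0 j =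
    dot dF (G t *m cliff_mx j) + dot (F t) (dG *m cliff_mx j) by rewrite mxE !cliff_coord.
exact: is_derive_dot HF (is_derive_mulmx _ HG).
Qed.

Lemma Ck_cliff k (U : set V) F G : open U -> Ck k U F -> Ck k U G ->
  Ck k U (fun s => cliff (F s) (G s)).
Proof.
move=> oU CF CG; apply/Ck_coordP => // j; under eq_fun do rewrite cliff_coord.
by apply: Ck_dot => //; apply: Ck_mulmx => // i l; exact: Ck_cst.
Qed.

Lemma hopf_coord (x : 'rV[R]_8) j : hopf x 0 j = dot (cliff (delta_mx 0 j) x) x.
Proof.
by rewrite -hopf_cliff dot_delta.
Qed.

Lemma Ck_hopf k (U : set V) G : open U -> Ck k U G -> Ck k U (fun s => hopf (G s)).
Proof.
move=> oU CG; apply/Ck_coordP => // j; under eq_fun do rewrite hopf_coord.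
by apply: Ck_dot => //; apply: Ck_cliff => //; exact: Ck_cst.
Qed.

Lemma is_derive_hopf G t v (dG : 'rV[R]_8) : is_derive t v G dG ->
  is_derive t v (fun s => hopf (G s)) (hopf_diff (G t) dG).
Proof.
move=> HG; apply: is_derive_row => j.
have -> : (fun s => hopf (G s) 0 j) = (fun s => dot (cliff (delta_mx 0 j) (G s)) (G s)).
  by apply/funext => s; rewrite hopf_coord.
have dc : is_derive t v (cst (delta_mx 0 j) : V -> 'rV[R]_5) 0 by exact: is_derive_cst.
have -> : hopf_diff (G t) dG 0 j = dot (cliff 0 (G t) + cliff (delta_mx 0 j) dG) (G t) +
    dot (cliff (delta_mx 0 j) (G t)) dG.
  by rewrite cliff0l add0r cliff_sym (dotC dG) -dot_delta dot_hopf_diff; ring.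
exact: is_derive_dot (is_derive_cliff dc HG) HG.
Qed.

End Derive.
End BilinearDerivative.

(** * The preimage as a submanifold *)

Section HopfPreimage.
Variables (R : realType) (M : set 'rV[R]_5) (xi : 'rV[R]_5 -> 'rV[R]_5).
Hypothesis HM : @oriented_hypersurface R 5 4 M idfun xi.
Local Notation P := (hopf_preimage M).
Implicit Types (x Y : 'rV[R]_8).

Lemma hopf_norm x : dot (hopf x) (hopf x) = dot x x ^+ 2.
Proof. by rewrite hopf_cliff cliff_hopf dotZl. Qed.

(** Since |h(x)| = |x|^2, a point whose image lies on the unit sphere is itself a unit vector. *)
Lemma hopf_preimageE x : P x <-> M (hopf x).
Proof.
split=> [[]//|Mx]; split=> //; rewrite /sphere /=.
have := oh_sphere HM Mx; rewrite /sphere /= hopf_norm => /eqP.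
rewrite sqrf_eq1 => /orP[/eqP//|/eqP h].
by have := dot_ge0 x; rewrite h; lra.
Qed.

Lemma smooth_map_hopf (D : set 'rV[R]_8) : smooth_map D (@hopf R).
Proof.
apply: (@smooth_on_map _ _ _ D setT) => //; first exact: openT.
by move=> k; exact: Ck_hopf openT (Ck_id _ _).
Qed.

Lemma tdiff_hopf x Y : P x -> tangent P x Y -> tdiff P (@hopf R) x Y = hopf_diff x Y.
Proof.
move=> Px /tangentP[gamma cg dg].
have := is_derive_hopf dg; have [_ [_ _ _ g0]] := cg; rewrite g0.
move=> H; have H2 := tdiff_derive (smooth_map_hopf (D := P)) cg dg.
exact (is_derive_unique H2 H).
Qed.

(* Coordinates on the fibre of [hopf] through [x0]. *)
Definition fibre_coord (x0 x : 'rV[R]_8) : 'rV[R]_3 := \row_(q < 3) dot x (right_unit q x0).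

(** Near [x0] the map [Psi], made of [hopf] and [fibre_coord x0], is a diffeomorphism onto an open
    part of R^5 x R^3, and the preimage corresponds to [M] x R^3. A chart is therefore a chart of
    [M] together with three fibre coordinates, followed by the local inverse of [Psi]. *)
Lemma hopf_preimage_submanifold : submanifold 6 P.
Proof.
move=> x0 Px0; have Mx0 := iffLR (hopf_preimageE _) Px0.
have [W [Om [phi [oW Wx oO [sphi [psi [spsi H1 H2]]]]]]] := oh_submanifold HM Mx0.
have sfib k (U : set 'rV[R]_8) : open U -> Ck k U (fibre_coord x0).
  move=> oU; apply/Ck_coordP => // q; rewrite /fibre_coord; under eq_fun do rewrite mxE.
  by apply: Ck_dot => //; [exact: Ck_id|exact: Ck_cst].
pose Psi x : 'rV[R]_8 := row_mx (hopf x) (fibre_coord x0 x) : 'rV[R]_(5 + 3).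
have sPsi : smooth_on setT Psi.
  move=> k; apply: (@Ck_row_mx _ _ setT openT 5 3); last exact: sfib openT.
  by exact: Ck_hopf openT (Ck_id _ _).
have dPsi Y : 'd Psi x0 Y = (row_mx (hopf_diff x0 Y) (fibre_coord x0 Y) : 'rV[R]_(5 + 3)).
  have H : is_derive x0 Y Psi (row_mx (hopf_diff x0 Y) (fibre_coord x0 Y) : 'rV[R]_(5 + 3)).
    apply: (@is_derive_row _ _ (5 + 3)) => j; rewrite -(splitK j); case: (fintype.split j) => i /=.
      rewrite /Psi; under eq_fun do rewrite row_mxEl; rewrite row_mxEl.
      exact: is_derive_coord i (is_derive_hopf (is_derive_id _ _)).
    rewrite /Psi; under eq_fun do rewrite row_mxEr !mxE; rewrite row_mxEr mxE.
    have dc : is_derive x0 Y (cst (right_unit i x0) : _ -> 'rV[R]_8) 0 by exact: is_derive_cst.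
    have := is_derive_dot (is_derive_id x0 Y) dc; rewrite dot0r addr0; exact.
  by have [_ <-] := H; rewrite deriveE//; exact: smooth_on_differentiable sPsi I.
have inj Y : 'd Psi x0 Y = 0 -> Y = 0.
  rewrite dPsi => Y0.
  have [h0 /rowP f0] : hopf_diff x0 Y = 0 /\ fibre_coord x0 Y = 0.
    by apply: (@eq_row_mx _ 1 5 3); rewrite row_mx0.
  have := hopf_frame x0 Y; rewrite h0 cliff0l.
  rewrite big1 => [|q _]; last by have := f0 q; rewrite !mxE => ->; rewrite scale0r.
  have [-> _] := Px0; rewrite scaler0 addr0 mulr1 => /eqP.
  by rewrite scaler_eq0 pnatr_eq0 => /eqP.
have [B [G [oB B0 _ oPB [sG GPsi]]]] := inverse_function openT I sPsi inj.
pose Om1 : set 'rV[R]_(3 + 3) := setT `&` (fun p => lsubmx p) @^-1` Om.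
have sl k (U : set 'rV[R]_(3 + 3)) : Ck k U (fun p => lsubmx p : 'rV[R]_3).
  exact: Ck_linear (@linear_rV_continuous _ _ _ _).
have sr k (U : set 'rV[R]_(3 + 3)) : Ck k U (fun p => rsubmx p : 'rV[R]_3).
  exact: Ck_linear (@linear_rV_continuous _ _ _ _).
have oO1 : open Om1 by exact: open_preim_Ck openT oO (sl 0%N _).
have sOphi : smooth_on Om phi by exact/smooth_map_open.
pose E (p : 'rV[R]_(3 + 3)) : 'rV[R]_8 := row_mx (phi (lsubmx p)) (rsubmx p) : 'rV[R]_(5 + 3).
have sE : smooth_on Om1 E.
  move=> k; apply: (@Ck_row_mx _ _ _ oO1 5 3) => //.
  by apply: (Ck_comp oO1 oO _ (sl k _) (sOphi k)) => p [].
pose Om2 := Om1 `&` E @^-1` (Psi @` B).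
have oO2 : open Om2 by exact: open_preim_Ck oO1 oPB (sE 0%N).
pose W' := B `&` (@hopf R) @^-1` W.
have sh k (U : set 'rV[R]_8) : open U -> Ck k U (@hopf R).
  by move=> oU; exact: Ck_hopf oU (Ck_id _ _).
exists W', Om2, (fun p => G (E p)); split.
- exact: open_preim_Ck oB oW (sh 0%N _ oB).
- by split.
- exact: oO2.
split.
  apply/smooth_map_open => // k.
  by apply: (Ck_comp oO2 oPB _ (Ck_sub _ (sE k)) (sG k)) => p [].
exists (fun x => row_mx (psi (hopf x)) (fibre_coord x0 x)); split.
- apply: (@smooth_map_row_mx R _ 3 3).
    apply: (smooth_map_comp (E := M `&` W)) => //; last exact: smooth_map_hopf.
    by move=> x [/hopf_preimageE Mx [_ Wx']].
  by apply: (@smooth_on_map _ _ _ _ setT) => // [|k]; [exact: openT|exact: sfib openT].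
- move=> p [[_ Op] [y By EP]].
  have Gy : G (E p) = y by rewrite -EP GPsi.
  rewrite Gy; have [hy fy] : hopf y = phi (lsubmx (p : 'rV_(3 + 3))) /\
      fibre_coord x0 y = rsubmx (p : 'rV_(3 + 3)).
    exact: (@eq_row_mx _ 1 5 3).
  have [[Mp Wp] pp] := H1 _ Op.
  split; last by rewrite hy fy pp hsubmxK.
  by split; [apply/hopf_preimageE; rewrite hy|split=> //=; rewrite hy].
- move=> x [/hopf_preimageE Mx [Bx Wx']].
  have [Opx px] := H2 _ (conj Mx Wx').
  have EP : E (row_mx (psi (hopf x)) (fibre_coord x0 x)) = Psi x.
    by rewrite /E row_mxKl row_mxKr px.
  split; last by rewrite EP GPsi.
  by split; [split=> //=; rewrite row_mxKl|exists x].
Qed.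

End HopfPreimage.

Lemma clopen_connected (T : topologicalType) (A B C : set T) x y : connected C -> C `<=` A ->
  (exists2 U, open U & B = A `&` U) -> (exists2 U, closed U & B = A `&` U) ->
  C x -> C y -> B x -> B y.
Proof.
move=> cC CA [U oU BU] [D cD BD] Cx Cy Bx.
suff E : B `&` C = C by have : C y by []; rewrite -E => -[].
apply: cC; first by exists x.
  exists U => //; rewrite BU; apply/seteqP; split=> z [].
    by move=> [? ?] ?.
  by move=> Cz Uz; split=> //; split=> //; exact: CA.
exists D => //; rewrite BD; apply/seteqP; split=> z [].
  by move=> [? ?] ?.
by move=> Cz Uz; split=> //; split=> //; exact: CA.
Qed.

Lemma hopf_right_unit (R : realType) (x : 'rV[R]_8) : hopf (right_unit 0 x) = hopf x.
Proof.
have [z0 [z1 [z2 [z3 [z4 [z5 [z6 [z7 ->]]]]]]]] := row_of8P x.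
rewrite right_unit_row_of /= !hopf_row_of.
by do ![congr (_ :: _) || congr (row_of _ _)]; ring.
Qed.

Lemma dot_right_unit (R : realType) (x : 'rV[R]_8) : dot x (right_unit 0 x) = 0.
Proof.
have [z0 [z1 [z2 [z3 [z4 [z5 [z6 [z7 ->]]]]]]]] := row_of8P x.
by rewrite right_unit_row_of /= dot_row_of !big_ord_recl big_ord0 /=; ring.
Qed.

(** * The preimage of a hypersurface *)

Section HopfHypersurface.
Variables (R : realType) (M : set 'rV[R]_5) (xi : 'rV[R]_5 -> 'rV[R]_5).
Hypothesis HM : @oriented_hypersurface R 5 4 M idfun xi.
Local Notation P := (hopf_preimage M).
Implicit Types (x Y : 'rV[R]_8).

Definition hopf_normal x := cliff (xi (hopf x)) x.

Lemma preimage_norm x : P x -> dot x x = 1.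
Proof. by case. Qed.

Lemma preimage_base x : P x -> M (hopf x).
Proof. by case. Qed.

Lemma tangent_hopf_diff x Y : P x -> tangent P x Y -> tangent M (hopf x) (hopf_diff x Y).
Proof.
move=> Px TY; rewrite -(tdiff_hopf Px TY).
by apply: tangent_push TY; [exact: smooth_map_hopf|exact: preimage_base].
Qed.

Lemma smooth_map_cliff (V : normedModType R) (D : set V) (f : V -> 'rV[R]_5) (g : V -> 'rV[R]_8) :
  smooth_map D f -> smooth_map D g -> smooth_map D (fun z => cliff (f z) (g z)).
Proof.
move=> sf sg z Dz; have [F [U [oU Ux sF FE]]] := sf z Dz.
have [G [U' [oU' U'x sG GE]]] := sg z Dz.
exists (fun z => cliff (F z) (G z)), (U `&` U'); split => //.
- exact: openI.
- move=> k; apply: Ck_cliff; first exact: openI.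
    by apply: Ck_sub (sF k) => ? [].
  by apply: Ck_sub (sG k) => ? [].
- by move=> y Dy [Uy U'y]; rewrite FE// GE.
Qed.

Lemma smooth_map_hopf_normal : smooth_map P hopf_normal.
Proof.
apply: smooth_map_cliff; last exact: smooth_map_id.
by apply: (smooth_map_comp (E := M)); [exact: preimage_base|exact: smooth_map_hopf|exact: oh_normal_smooth HM].
Qed.

Lemma hopf_normal_dot x Y : dot (hopf_normal x) Y = dot (hopf_diff x Y) (xi (hopf x)) / 2.
Proof. by rewrite dot_hopf_diff mulrC mulrA mulVf ?mul1r// pnatr_eq0. Qed.

Lemma hopf_diff_self x Y : dot (hopf_diff x Y) (hopf x) = 2 * dot x x * dot x Y.
Proof. by rewrite dot_hopf_diff cliff_hopf dotZl mulrA. Qed.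

Lemma hopf_normal_hypersurface : @oriented_hypersurface R 8 7 P idfun hopf_normal.
Proof.
have unit x : P x -> dot (xi (hopf x)) (xi (hopf x)) = 1.
  by move=> /preimage_base Mx; exact (oh_normal_unit HM Mx).
split.
- exact: hopf_preimage_submanifold HM.
- exact: smooth_map_id.
- by move=> x [].
- by move=> x v Px Tv; rewrite (tdiff_id Px Tv).
- exact: smooth_map_hopf_normal.
- move=> x Px; rewrite /sphere /= /hopf_normal cliff_sym cliff_sqr unit// scale1r.
  exact: preimage_norm.
- move=> x Px; rewrite /hopf_normal -hopf_cliff dotC.
  exact (oh_normal_sphere HM (preimage_base Px)).
- move=> x v Px Tv; rewrite (tdiff_id Px Tv) hopf_normal_dot.
  have := tangent_hopf_diff Px Tv.
  move=> /(iffLR (hypersurface_tangent _ HM (preimage_base Px)))[_ ->].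
  by rewrite mul0r.
Qed.

(** The two conditions of [hypersurface_tangent] upstairs and downstairs agree up to a factor 2: <dh
    Y, h(x)> = 2 <x, Y>, and likewise for the normals. *)
Lemma tangent_preimage x Y : P x ->
  tangent P x Y <-> tangent M (hopf x) (hopf_diff x Y).
Proof.
move=> Px; split=> [|TY]; first exact: tangent_hopf_diff.
have [h1 h2] := iffLR (hypersurface_tangent _ HM (preimage_base Px)) TY.
apply: (iffRL (@hypersurface_tangent R 6 P hopf_normal x Y hopf_normal_hypersurface Px)).
split; last by rewrite dotC hopf_normal_dot h2 mul0r.
move: h1; rewrite hopf_diff_self (preimage_norm Px) mulr1 dotC => /eqP.
by rewrite mulf_eq0 pnatr_eq0 => /eqP.
Qed.

Lemma hopf_continuous : continuous (@hopf R).
Proof.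
have C : Ck 0 setT (@hopf R) by exact: Ck_hopf openT (Ck_id _ _).
by move=> x; exact: C.
Qed.

Lemma hopf_preimage_compact : compact M -> compact P.
Proof.
move=> cM; apply: bounded_closed_compact.
  exists 1; split; first exact: num_real.
  move=> r r1 x /preimage_norm xx; apply: rV_norm_le => [|j]; first by lra.
  have : x 0 j ^+ 2 <= 1.
    rewrite -xx /dot (bigD1 j)//= -expr2 lerDl sumr_ge0// => i _.
    by rewrite -expr2 sqr_ge0.
  rewrite -ler_sqrt// sqrtr1 sqrtr_sqr; lra.
have -> : P = (@hopf R) @^-1` M by apply/seteqP; split=> x /(hopf_preimageE HM).
apply: preimage_closed; first by move=> x _; exact: hopf_continuous.
by apply: compact_closed cM; exact: norm_hausdorff.
Qed.

(** The fibre over a unit vector [m] is the unit sphere of the fixed space of [cliff m]: if [x] is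
    fixed, then |h(x) - m|^2 = 2 - 2 <H(m)x, x> = 0. *)
Lemma hopf_fibreP (m : 'rV[R]_5) x : dot m m = 1 -> dot x x = 1 ->
  hopf x = m <-> cliff m x = x.
Proof.
move=> m1 x1; split=> [<-|cx]; first by rewrite cliff_hopf x1 scale1r.
apply/eqP; rewrite -subr_eq0; apply/eqP/dot_eq0.
rewrite dotBl !dotBr m1 hopf_norm x1 expr1n (dotC m) hopf_cliff cx x1; lra.
Qed.

(** As [cliff m] is an involution, z + H(m)z is fixed by it, and only its vanishing must be
    excluded. If [e] is in the eigenspace of -1, then [cliff (xi m)], which anticommutes with
    [cliff m], moves it to the other eigenspace. *)
Lemma hopf_fibre_nonempty (m : 'rV[R]_5) : M m -> exists2 x, P x & hopf x = m.
Proof.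
move=> Mm; have m1 : dot m m = 1 by exact (oh_sphere HM Mm).
have u1 : dot (xi m) (xi m) = 1 by exact (oh_normal_unit HM Mm).
have um : dot (xi m) m = 0 by exact (oh_normal_sphere HM Mm).
suff [z zm0] : exists z : 'rV[R]_8, z + cliff m z != 0.
  pose w := z + cliff m z; have w0 : 0 < dot w w by exact: dot_gt0.
  pose x := (Num.sqrt (dot w w))^-1 *: w.
  have x1 : dot x x = 1.
    rewrite /x dotZl dotZr mulrA -invfM -expr2 sqr_sqrtr ?ltW// mulVf//; lra.
  have hx : hopf x = m.
    apply/(hopf_fibreP m1 x1); rewrite /x cliffZr; congr (_ *: _).
    by rewrite /w cliffDr cliff_sqr m1 scale1r addrC.
  by exists x => //; apply/(hopf_preimageE HM); rewrite hx.
pose e : 'rV[R]_8 := delta_mx 0 0.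
have e0 : e != 0.
  by apply/eqP => /rowP/(_ 0); rewrite !mxE eqxx => /eqP; rewrite oner_eq0.
have [E|] := eqVneq (e + cliff m e) 0; last by exists e.
have me : cliff m e = - e by apply/eqP; rewrite -addr_eq0 addrC E.
exists (cliff (xi m) e); have := cliff_anti m (xi m) e.
rewrite me (dotC m) um mulr0 scale0r -scaleN1r cliffZr scaleN1r => /eqP.
rewrite subr_eq0 => /eqP ->; rewrite -mulr2n -scaler_nat scaler_eq0 pnatr_eq0/=.
apply: contra_neq e0 => E0; have := cliff_sqr (xi m) e.
by rewrite E0 u1 scale1r cliff0r.
Qed.


(** The fibre is the unit sphere of a linear space, so the normalized segment stays in it; the
    segment avoids 0 because its ends are not antipodal. *)
Lemma hopf_fibre_segment x y : dot x x = 1 -> dot y y = 1 -> hopf x = hopf y -> y != - x ->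
  exists C : set 'rV[R]_8, [/\ connected C, C x, C y & forall z, C z -> hopf z = hopf x].
Proof.
move=> x1 y1 hxy yx; pose m := hopf x.
have m1 : dot m m = 1 by rewrite hopf_norm x1 expr1n.
have cx : cliff m x = x by apply/(hopf_fibreP m1 x1).
have cy : cliff m y = y by apply/(hopf_fibreP m1 y1).
pose w (t : R) : 'rV[R]_8 := (1 - t) *: x + t *: y.
pose q t := dot (w t) (w t).
have qE t : q t = 1 - 2 * t * (1 - t) * (1 - dot x y).
  by rewrite /q /w !(dotDl, dotDr, dotZl, dotZr) x1 y1 (dotC y); ring.
have xy : -1 < dot x y.
  have : 0 < dot (x + y) (x + y).
    by apply: dot_gt0; rewrite addrC addr_eq0.
  by rewrite !(dotDl, dotDr) x1 y1 (dotC y); lra.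
have q0 t : t \in `[0, 1] -> 0 < q t.
  rewrite in_itv /= => /andP[t0 t1]; rewrite qE.
  have : 0 <= (2 * t - 1) ^+ 2 by exact: sqr_ge0.
  have : 0 <= t * (1 - t) by rewrite mulr_ge0// subr_ge0.
  move: xy; set s := dot x y => xy ts sq.
  have : 0 <= (1 + s) * (t * (1 - t)) by rewrite mulr_ge0//; lra.
  (* Here q t = (2t - 1)^2 + 2t(1 - t)(1 + s). If t(1 - t) <= 1/8 the square is at least 1/2;
     otherwise the second term is positive. *)
  have [ts0|ts0] := leP (t * (1 - t)) (1/8).
    by nra.
  have : 0 < (1 + s) * (t * (1 - t)) by rewrite mulr_gt0//; lra.
  by rewrite expr2 in sq; nra.
pose c t := (Num.sqrt (q t))^-1 *: w t.
have cw t : cliff m (w t) = w t by rewrite /w cliffDr !cliffZr cx cy.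
have c1 t : t \in `[0, 1] -> dot (c t) (c t) = 1.
  move=> /q0 qt; rewrite /c dotZl dotZr mulrA -invfM -expr2 sqr_sqrtr ?ltW// mulVf//; lra.
exists (c @` [set` `[0, 1]]); split.
- apply: connected_continuous_connected; first exact: segment_connected.
  apply: continuous_in_subspaceT => t; rewrite inE /= => tI.
  have Cw k : Ck k (setT : set R) w.
    apply/Ck_coordP => [|j]; first exact: openT.
    rewrite /w; under eq_fun do rewrite !mxE.
    have C1t : Ck k (setT : set R) (fun t => 1 - t).
      by apply: CkD; [exact: openT|exact: Ck_cst|apply: CkN; [exact: openT|exact: Ck_id]].
    apply: CkD; [exact: openT|apply: CkM; [exact: openT|exact: C1t|exact: Ck_cst]|].
    by apply: CkM; [exact: openT|exact: Ck_id|exact: Ck_cst].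
  have cq : {for t, continuous q} by exact: (Ck_dot openT (Cw 0%N) (Cw 0%N)) t I.
  apply/continuous_coordP => j.
  have -> : (fun s => c s 0 j) = (fun s => (Num.sqrt (q s))^-1 * w s 0 j).
    by apply/funext => s; rewrite /c mxE.
  apply: continuousM; last exact: (iffLR (continuous_coordP _ _) (Cw 0%N t I) j).
  apply: continuousV; first by rewrite gt_eqF// sqrtr_gt0 q0.
  by apply: continuous_comp; [exact: cq|exact: sqrt_continuous].
- exists 0 => /=; first by rewrite in_itv /= lexx ler01.
  by rewrite /c qE /w !(mul0r, mulr0, subr0, scale1r, scale0r, addr0) sqrtr1 invr1 scale1r.
- exists 1 => /=; first by rewrite in_itv /= lexx ler01.
  by rewrite /c qE /w !(subrr, mul0r, mulr0, subr0, scale1r, scale0r, add0r) sqrtr1 invr1 scale1r.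
- move=> _ [t /= tI <-]; apply/(hopf_fibreP m1 (c1 t tI)).
  by rewrite /c cliffZr cw.
Qed.

(** Antipodal points are joined through x i, which lies in the same fibre and is orthogonal to
    both. *)
Lemma hopf_fibre_clopen (B : set 'rV[R]_8) x y :
  (exists2 U, open U & B = P `&` U) -> (exists2 U, closed U & B = P `&` U) ->
  P x -> P y -> hopf x = hopf y -> B x -> B y.
Proof.
move=> oB cB Px Py hxy.
have seg z t : P z -> P t -> hopf z = hopf t -> t != - z -> B z -> B t.
  move=> Pz Pt hzt zt; have [C [cC Cz Ct Ch]] := hopf_fibre_segment (preimage_norm Pz) (preimage_norm Pt) hzt zt.
  apply: (clopen_connected cC _ oB cB Cz Ct) => s /Ch hs.
  by apply/(hopf_preimageE HM); rewrite hs; exact: preimage_base.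
have [yx|yx] := eqVneq y (- x); last exact: seg.
pose z := right_unit 0 x.
have xz : dot x z = 0 by exact: dot_right_unit.
have Pz : P z by apply/(hopf_preimageE HM); rewrite hopf_right_unit; exact: preimage_base.
have x1 := preimage_norm Px; have z1 := preimage_norm Pz.
move=> Bx; apply: (seg z y) => //.
- by rewrite hopf_right_unit.
- apply/eqP => E; have := congr1 (dot x) E.
  by rewrite yx !dotNr xz x1; lra.
- apply: (seg x z) => //; first by rewrite hopf_right_unit.
  by apply/eqP => E; have := congr1 (dot x) E; rewrite dotNr xz x1; lra.
Qed.

(** Fibres being connected, a relatively clopen [B] is a union of fibres. The images of [B] and of
    its complement are then disjoint compact sets covering [M], so the image of [B] is all of
    [M]. *)
Lemma hopf_preimage_connected : compact M -> connected M -> connected P.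
Proof.
move=> kM cM B [x Bx] oB cB; have cP := hopf_preimage_compact kM.
have BP : B `<=` P by case: oB => U _ ->; move=> z [].
have ch (A : set 'rV[R]_8) : {within A, continuous (@hopf R)}.
  by apply: continuous_subspaceT => z; exact: hopf_continuous.
have closed_image (A : set 'rV[R]_8) : compact A -> closed (@hopf R @` A).
  by move=> kA; apply: compact_closed; [exact: norm_hausdorff|exact: continuous_compact].
have kB : compact B by case: cB => D cD ->; exact: compact_closedI.
have kB' : compact (P `\` B).
  case: oB => U oU BU; have -> : P `\` B = P `&` ~` U.
    rewrite BU; apply/seteqP; split=> z [Pz]; first by move=> H; split=> // Uz; exact: H.
    by move=> nU; split=> // -[].
  by apply: compact_closedI => //; exact: open_closedC.
have sep z : M z -> (@hopf R @` B) z \/ (@hopf R @` (P `\` B)) z.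
  move=> Mz; have [y Py <-] := hopf_fibre_nonempty Mz.
  by case: (pselect (B y)) => By; [left; exists y|right; exists y].
have dis y z : B y -> P z -> hopf y = hopf z -> B z.
  by move=> By Pz yz; exact: hopf_fibre_clopen oB cB (BP _ By) Pz yz By.
have E : @hopf R @` B = M.
  apply: cM; first by exists (hopf x), x.
    exists (~` (@hopf R @` (P `\` B))); first exact/closed_openC/closed_image.
    apply/seteqP; split=> z.
      move=> [y By <-]; split; first exact/preimage_base/BP.
      by move=> [t [Pt nBt] th]; apply: nBt; exact: dis By Pt (esym th).
    by move=> [/sep[]].
  exists (@hopf R @` B); first exact: closed_image.
  by apply/seteqP; split=> z; [move=> [y By <-]; split; [exact/preimage_base/BP|exists y]|case].
apply/seteqP; split=> // z Pz; have := preimage_base Pz; rewrite -E => -[y By yz].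
exact: dis By Pz yz.
Qed.

End HopfHypersurface.

(** * Principal curvatures of the preimage *)

Section PreimageCurvature.
Variables (R : realType) (M : set 'rV[R]_5) (xi : 'rV[R]_5 -> 'rV[R]_5).
Hypothesis HM : @oriented_hypersurface R 5 4 M idfun xi.
Variable eta : 'rV[R]_8 -> 'rV[R]_8.
Local Notation P := (hopf_preimage M).
Hypothesis HE : @oriented_hypersurface R 8 7 P idfun eta.
Hypothesis etaE : forall x, P x -> eta x = hopf_normal xi x.
Implicit Types (x Y : 'rV[R]_8) (V : 'rV[R]_5) (k l : R).
Local Notation dxi x V := (tdiff M xi (hopf x) V).

Lemma tdiff_hopf_normal x Y : P x -> tangent P x Y ->
  tdiff P eta x Y = cliff (dxi x (hopf_diff x Y)) x + cliff (xi (hopf x)) Y.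
Proof.
move=> Px TY; rewrite (tdiff_eq (oh_normal_smooth HE) etaE TY).
have [gamma cg dg] := iffLR (tangentP _ _ _) TY.
have g0 : gamma 0 = x by have [? []] := cg.
have ch : curve_in M (hopf x) (fun t => hopf (gamma t)).
  by apply: curve_push cg; [exact: smooth_map_hopf|exact: preimage_base].
have dh := is_derive_hopf dg; rewrite g0 in dh.
have H1 := is_derive_cliff (tdiff_derive (oh_normal_smooth HM) ch dh) dg.
rewrite g0 in H1.
exact: is_derive_unique (tdiff_derive (smooth_map_hopf_normal HM) cg dg) H1.
Qed.

Lemma preimage_eigenP x l Y : P x -> shape_eigenspace P idfun eta x l Y <->
  tangent P x Y /\ cliff (dxi x (hopf_diff x Y)) x + cliff (xi (hopf x)) Y = - (l *: Y).
Proof.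
move=> Px; have H := shape_eigenspaceP eta l Y (oh_submanifold HE) Px.
split=> [/(iffLR H)[TY]|[TY E]]; first by rewrite (tdiff_hopf_normal Px TY).
by apply: (iffRL H); rewrite (tdiff_hopf_normal Px TY).
Qed.

Lemma base_eigenP x k V : P x -> shape_eigenspace M idfun xi (hopf x) k V <->
  tangent M (hopf x) V /\ dxi x V = - (k *: V).
Proof. by move=> /preimage_base; exact: shape_eigenspaceP (oh_submanifold HM). Qed.

Lemma hopf_diff_cliff x V : P x -> hopf_diff x (cliff V x) = 2 *: V.
Proof.
move=> Px; apply: dot_inj => w.
have H : dot (cliff w x) (cliff V x) + dot (cliff V x) (cliff w x) = 2 * dot w V.
  rewrite (cliff_sym w) (cliff_sym V) -dotDr cliff_anti dotZr (preimage_norm Px) mulr1 //.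
by rewrite dot_hopf_diff dotZl; move: H; rewrite (dotC (cliff V x)) (dotC V w); lra.
Qed.

(** All inner products in [hopf_diff_cliff2] vanish, since [V], h(x) and xi(h(x)) are mutually
    orthogonal. *)
Lemma hopf_diff_normal_cliff x V : P x -> tangent M (hopf x) V ->
  hopf_diff x (cliff (xi (hopf x)) (cliff V x)) = 0.
Proof.
move=> /preimage_base Mx TV; have [V1 V2] := iffLR (hypersurface_tangent _ HM Mx) TV.
rewrite hopf_diff_cliff2 (dotC (hopf x)) V1 (dotC _ V) V2 (dotC (hopf x)).
by rewrite (oh_normal_sphere HM Mx) !scale0r subrr addr0 scaler0.
Qed.

Lemma normal_sqr x Y : P x -> cliff (xi (hopf x)) (cliff (xi (hopf x)) Y) = Y.
Proof.
move=> /preimage_base Mx; rewrite cliff_sqr.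
by have -> : dot (xi (hopf x)) (xi (hopf x)) = 1 := oh_normal_unit HM Mx; rewrite scale1r.
Qed.

Lemma preimage_eigen_base x l Y : P x -> shape_eigenspace P idfun eta x l Y ->
  (2 * l) *: dxi x (hopf_diff x Y) = (1 - l ^+ 2) *: hopf_diff x Y.
Proof.
move=> Px /(preimage_eigenP _ _ Px)[TY E].
have TV := tangent_hopf_diff Px TY; set V := hopf_diff x Y in E TV *.
have TdV := shape_tangent HM (preimage_base Px) TV; set a := dxi x V in E TdV *.
(* apply [cliff xi - l] to the eigenvalue equation, then [hopf_diff x] *)
have E2 : cliff (xi (hopf x)) (cliff a x) + Y = (- l) *: cliff (xi (hopf x)) Y.
  by rewrite -[in LHS](normal_sqr Y Px) -cliffDr E -scaleNr cliffZr.
have E3 : cliff (xi (hopf x)) Y = - (l *: Y) - cliff a x by rewrite -E addrAC subrr add0r.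
have E4 : cliff (xi (hopf x)) (cliff a x) = l *: cliff a x + (l ^+ 2 - 1) *: Y.
  apply/eqP; rewrite eq_sym -subr_eq0; apply/eqP.
  move: E2; rewrite E3; move: (cliff (xi _) _) => A; move: (cliff a x) => B /rowP H.
  by apply/rowP => j; move: (H j); rewrite !mxE; lra.
have := congr1 (hopf_diff x) E4; rewrite (hopf_diff_normal_cliff Px TdV).
rewrite hopf_diffD !hopf_diffZ (hopf_diff_cliff _ Px) -/V => /rowP H.
by apply/rowP => j; move: (H j); rewrite !mxE; lra.
Qed.

(** A vertical [Y] is fixed by H(h(x)), and the eigenvalue equation reads H(xi)Y = -l Y. Since H(xi)
    and H(h(x)) anticommute, l Y = 0, and then Y = H(xi)H(xi)Y = 0. *)
Lemma preimage_eigen_vertical x l Y : P x -> shape_eigenspace P idfun eta x l Y ->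
  hopf_diff x Y = 0 -> Y = 0.
Proof.
move=> Px EY V0; have /(preimage_eigenP _ _ Px)[TY E] := EY.
have Mx := preimage_base Px.
have xY : dot x Y = 0.
  by have [] := iffLR (hypersurface_tangent _ HE Px) TY; rewrite dotC.
have hY : cliff (hopf x) Y = Y.
  have := cliff_hopf_diff x Y; rewrite V0 cliff0l (preimage_norm Px) xY mulr0 scale1r scale0r addr0.
  by move/eqP; rewrite eq_sym subr_eq0 => /eqP.
have dV0 : dxi x (hopf_diff x Y) = 0.
  by rewrite V0 /tdiff linear0.
rewrite dV0 cliff0l add0r in E.
have lY : l *: Y = 0.
  have := cliff_anti (xi (hopf x)) (hopf x) Y; rewrite hY E -scaleNr cliffZr hY.
  have -> : dot (xi (hopf x)) (hopf x) = 0 := oh_normal_sphere HM Mx.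
  rewrite mulr0 scale0r -mulr2n -scaler_nat => /eqP.
  by rewrite scaler_eq0 pnatr_eq0 /= scaleNr oppr_eq0 => /eqP.
by rewrite -(normal_sqr Y Px) E lY oppr0 cliff0r.
Qed.

(** In terms of angles, cot t goes to cot (2t). *)
Definition fold l : R := (l ^+ 2 - 1) / (2 * l).

Lemma preimage_eigenvalue_neq0 x l Y : P x -> shape_eigenspace P idfun eta x l Y -> Y != 0 -> l != 0.
Proof.
move=> Px EY; apply: contra_neq => l0; apply: (preimage_eigen_vertical Px EY).
by have := preimage_eigen_base Px EY; rewrite l0 mulr0 expr0n subr0 scale0r scale1r.
Qed.

Lemma preimage_eigen_down x l Y : P x -> l != 0 -> shape_eigenspace P idfun eta x l Y ->
  shape_eigenspace M idfun xi (hopf x) (fold l) (hopf_diff x Y).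
Proof.
move=> Px l0 EY; have [TY _] := iffLR (preimage_eigenP _ _ Px) EY.
apply/(base_eigenP _ _ Px); split; first exact: tangent_hopf_diff.
have H := preimage_eigen_base Px EY.
have l20 : 2 * l != 0 by rewrite mulf_neq0 ?pnatr_eq0.
apply: (scalerI l20); rewrite H scalerN scalerA -scaleNr /fold mulrC divfK//.
by congr (_ *: _); ring.
Qed.

Lemma preimage_eigen_up x l V : P x -> l != 0 ->
  shape_eigenspace M idfun xi (hopf x) (fold l) V ->
  exists2 Y, shape_eigenspace P idfun eta x l Y & hopf_diff x Y = V.
Proof.
move=> Px l0 /(base_eigenP _ _ Px)[TV dV].
have l20 : 2 * l != 0 by rewrite mulf_neq0 ?pnatr_eq0.
(* The eigenvector is sought in the span of [A] and [B]. As dh(A) = 2V and dh(B) = 0, the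
   coefficient of [A] must be 1/2; the eigenvalue equation then fixes that of [B]. *)
pose c := - (2 * l)^-1; pose A := cliff V x; pose B := cliff (xi (hopf x)) A.
exists (c *: (B - l *: A)); last first.
  rewrite hopf_diffZ -scaleNr hopf_diffD hopf_diffZ (hopf_diff_normal_cliff Px TV) add0r.
  rewrite (hopf_diff_cliff _ Px) !scalerA (_ : c * - l * 2 = 1) ?scale1r//.
  by rewrite /c; field.
have hY : hopf_diff x (c *: (B - l *: A)) = V.
  rewrite hopf_diffZ -scaleNr hopf_diffD hopf_diffZ (hopf_diff_normal_cliff Px TV) add0r.
  rewrite (hopf_diff_cliff _ Px) !scalerA (_ : c * - l * 2 = 1) ?scale1r//.
  by rewrite /c; field.
apply/(preimage_eigenP _ _ Px); split; first by apply/(tangent_preimage HM _ Px); rewrite hY.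
have E1 : cliff (- (fold l *: V)) x = - fold l *: A by rewrite -scaleNr cliffZl.
have E2 : cliff (xi (hopf x)) (c *: (B - l *: A)) = c *: (A - l *: B).
  have BA : cliff (xi (hopf x)) B = A by exact: normal_sqr.
  by rewrite cliffZr -[- (l *: A)]scaleNr cliffDr (cliffZr (- l)) -/B BA (scaleNr l).
have K (C D : 'rV[R]_8) : - fold l *: C + c *: (C - l *: D) = - (l *: (c *: (D - l *: C))).
  apply/rowP => j; rewrite !mxE; move: (C 0 j) (D 0 j) => p q.
  by rewrite /c /fold; field.
by rewrite hY dV E1 E2 K.
Qed.

Lemma preimage_curvature x l : P x -> principal_curvatures P idfun eta x l <->
  l != 0 /\ principal_curvatures M idfun xi (hopf x) (fold l).
Proof.
move=> Px; split=> [[Y EY Y0]|[l0 [V /(preimage_eigen_up Px l0)[Y EY YV] V0]]].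
  have l0 := preimage_eigenvalue_neq0 Px EY Y0; split=> //.
  exists (hopf_diff x Y); first exact: preimage_eigen_down.
  by apply: contra_neq Y0; exact: preimage_eigen_vertical EY.
exists Y => //; apply: contra_neq V0 => Y0; rewrite -YV Y0.
by rewrite -(scale0r 0) hopf_diffZ scale0r.
Qed.

End PreimageCurvature.

(** * The two curvatures above a given one *)

Section FoldRoots.
Variable R : realType.
Implicit Types (k l : R) (s : seq R).

(** [upper k] and [lower k] are the roots of l^2 - 2 k l - 1 = 0, of opposite signs since their
    product is -1. For k = cot t with 0 < t < pi they are cot (t/2) and cot (t/2 + pi/2). *)
Definition upper k : R := k + Num.sqrt (k ^+ 2 + 1).
Definition lower k : R := k - Num.sqrt (k ^+ 2 + 1).

Lemma sqrt_bound k : `|k| < Num.sqrt (k ^+ 2 + 1).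
Proof. by rewrite -sqrtr_sqr ltr_sqrt ?ltrDl// ltr_pwDr// sqr_ge0. Qed.

Lemma sqrt_sqr k : Num.sqrt (k ^+ 2 + 1) ^+ 2 = k ^+ 2 + 1.
Proof. by rewrite sqr_sqrtr// addr_ge0// sqr_ge0. Qed.

Lemma upper_gt0 k : 0 < upper k.
Proof. by have := sqrt_bound k; rewrite ltr_norml /upper => /andP[]; lra. Qed.

Lemma lower_lt0 k : lower k < 0.
Proof. by have := sqrt_bound k; rewrite ltr_norml /lower => /andP[]; lra. Qed.

Lemma lower_upper k l : lower k < upper l.
Proof. exact: lt_trans (lower_lt0 k) (upper_gt0 l). Qed.

Lemma fold_upper k : fold (upper k) = k.
Proof.
have u0 := upper_gt0 k; have := sqrt_sqr k; rewrite /fold /upper in u0 *.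
set s := Num.sqrt _ in u0 * => ss; have u0' : k + s != 0 by rewrite gt_eqF.
by rewrite (_ : (k + s) ^+ 2 - 1 = 2 * (k + s) * k); [field|rewrite sqrrD ss; ring].
Qed.

Lemma fold_lower k : fold (lower k) = k.
Proof.
have u0 := lower_lt0 k; have := sqrt_sqr k; rewrite /fold /lower in u0 *.
set s := Num.sqrt _ in u0 * => ss; have u0' : k - s != 0 by rewrite lt_eqF.
by rewrite (_ : (k - s) ^+ 2 - 1 = 2 * (k - s) * k); [field|rewrite sqrrB ss; ring].
Qed.

Lemma fold_root l : l != 0 -> l = upper (fold l) \/ l = lower (fold l).
Proof.
move=> l0; set k := fold l.
have E : (l - upper k) * (l - lower k) = 0.
  have : l ^+ 2 - 1 = k * (2 * l) by rewrite /k /fold divfK// mulf_neq0 ?pnatr_eq0.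
  have := sqrt_sqr k; rewrite /upper /lower; set s := Num.sqrt _ => ss El.
  by transitivity (l ^+ 2 - 1 - k * (2 * l) + (k ^+ 2 + 1 - s ^+ 2)); [ring|rewrite El ss; ring].
by move/eqP: E; rewrite mulf_eq0 !subr_eq0 => /orP[]/eqP; [left|right].
Qed.

Lemma upper_inj : injective upper.
Proof. by move=> k l E; rewrite -(fold_upper k) E fold_upper. Qed.

Lemma lower_inj : injective lower.
Proof. by move=> k l E; rewrite -(fold_lower k) E fold_lower. Qed.

(** The difference of the two square roots times their sum is (l - k)(l + k), and the sum exceeds |l
    + k|. *)
Lemma sqrt_increment k l : k < l ->
  `|Num.sqrt (l ^+ 2 + 1) - Num.sqrt (k ^+ 2 + 1)| < l - k.
Proof.
move=> kl; have := sqrt_bound k; have := sqrt_bound l; have := sqrt_sqr k; have := sqrt_sqr l.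
set s := Num.sqrt _; set t := Num.sqrt _ => ss tt.
rewrite !ltr_norml => /andP[l1 l2] /andP[k1 k2]; apply/andP; split; nra.
Qed.

Lemma upper_lt k l : k < l -> upper k < upper l.
Proof. by move=> /sqrt_increment; rewrite ltr_norml /upper => /andP[]; lra. Qed.

Lemma lower_lt k l : k < l -> lower k < lower l.
Proof. by move=> /sqrt_increment; rewrite ltr_norml /lower => /andP[]; lra. Qed.

Lemma fold_preimage s :
  [set l : R | l != 0 /\ fold l \in s] = [set` [seq lower k | k <- s] ++ [seq upper k | k <- s]].
Proof.
apply/seteqP; split=> l; rewrite /= mem_cat.
  move=> [/fold_root + fs] => -[] ->; apply/orP; [right|left]; exact: map_f.
move=> /orP[]/mapP[k ks ->].
  by rewrite fold_lower lt_eqF ?lower_lt0.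
by rewrite fold_upper gt_eqF ?upper_gt0.
Qed.

Lemma fold_preimage_uniq s : uniq s -> uniq ([seq lower k | k <- s] ++ [seq upper k | k <- s]).
Proof.
move=> us; rewrite cat_uniq !map_inj_uniq ?us /= ?andbT; [|exact: upper_inj|exact: lower_inj].
by apply/hasPn => _ /mapP[k _ ->]; apply/mapP => -[l _ E]; have := lower_upper l k; rewrite E ltxx.
Qed.

End FoldRoots.

(** * The preimage is Dupin *)

Section PreimageDupin.
Variables (R : realType) (M : set 'rV[R]_5) (xi : 'rV[R]_5 -> 'rV[R]_5).
Hypothesis HM : @oriented_hypersurface R 5 4 M idfun xi.
Variable eta : 'rV[R]_8 -> 'rV[R]_8.
Local Notation P := (hopf_preimage M).
Hypothesis HE : @oriented_hypersurface R 8 7 P idfun eta.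
Hypothesis etaE : forall x, P x -> eta x = hopf_normal xi x.
Hypothesis HD : dupin M idfun xi.
Local Notation PC := (principal_curvatures P idfun eta).
Local Notation TE := (tangent_eigenspace P idfun eta).

Lemma tangent_eigenspace_inj S x k l : P x -> TE S x k -> TE S x l -> k = l.
Proof.
move=> Px [[Y EY Y0] Tk] [_ Tl]; have EY' := EY; rewrite -Tk Tl in EY'.
have [_ E1] := iffLR (preimage_eigenP HM HE etaE _ _ Px) EY.
have [_ E2] := iffLR (preimage_eigenP HM HE etaE _ _ Px) EY'.
have : (k - l) *: Y = 0.
  by apply/eqP; rewrite scalerBl subr_eq0 -eqr_opp -E1 E2.
by move/eqP; rewrite scaler_eq0 (negbTE Y0) orbF subr_eq0 => /eqP.
Qed.

(* Along a chart [phi] of a curvature surface, [hopf \o phi] is an immersion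
   onto a curvature surface of [M]. *)
Lemma fold_locally_constant (S W : set 'rV[R]_8) d (Om : set 'rV[R]_d) phi a (lam : 'rV[R]_8 -> R) :
  S `<=` P -> open W -> open Om -> diffeomorphism Om (S `&` W) phi -> Om a ->
  (forall x, S x -> TE S x (lam x)) ->
  \forall b \near a, fold (lam (phi b)) = fold (lam (phi a)).
Proof.
move=> SP oW oO dphi Oa Hlam.
have S_ b : Om b -> S (phi b) by have [_ [psi [_ H _]]] := dphi; move=> /H[[]].
have P_ b : Om b -> P (phi b) by move=> /S_/SP.
have [/(smooth_map_open _ oO) sphi _] := dphi.
have dfphi b : Om b -> differentiable phi b by exact: smooth_on_differentiable sphi.
pose F b := hopf (phi b).
have sF : smooth_on Om F by move=> k; apply: Ck_hopf.
have dF b w : Om b -> dmap F b w = hopf_diff (phi b) (dmap phi b w).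
  move=> Ob; have H := is_derive_hopf (is_derive_diff w (dfphi b Ob)).
  rewrite (dmapE phi b w) in H; have [_ <-] := H.
  by rewrite deriveE ?dmapE//; exact: smooth_on_differentiable sF Ob.
have TS b v : Om b -> tangent S (phi b) v <-> exists w, v = dmap phi b w.
  move=> Ob; have H := tangent_chart v oW oO dphi Ob.
  split=> [/(iffLR H)[w ->]|[w vE]]; first by exists w; rewrite dmapE.
  by apply: (iffRL H); exists w; rewrite vE dmapE.
have Elam b w : Om b -> shape_eigenspace P idfun eta (phi b) (lam (phi b)) (dmap phi b w).
  by move=> Ob; have [_ <-] := Hlam _ (S_ b Ob); apply/(TS _ _ Ob); exists w.
have inj b w : Om b -> dmap F b w = 0 -> w = 0.
  move=> Ob; rewrite dF// => /(preimage_eigen_vertical HM HE etaE (P_ b Ob) (Elam b w Ob)).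
  by rewrite -dmapE; exact: diffeo_diff_inj oO dphi Ob.
have [|B [oB Ba BO dB]] := immersion_diffeo oO Oa sF.
  by move=> w; rewrite dmapE; exact: inj.
have /nbhs_ballP[r /= r0 Hr] : nbhs a B by exact: open_nbhs_nbhs.
pose D1 := ball a r; have oD1 : open D1 by exact: ball_open.
have dD1 : diffeomorphism D1 (F @` D1) F by exact: diffeo_sub Hr dB.
have D1O b : D1 b -> Om b by move=> /Hr/BO.
have lam0 b : Om b -> lam (phi b) != 0.
  move=> Ob; have [[Y EY Y0] _] := Hlam _ (S_ b Ob).
  exact (preimage_eigenvalue_neq0 HM HE etaE (P_ b Ob) EY Y0).
have TEF b : D1 b -> tangent_eigenspace M idfun xi (F @` D1) (F b) (fold (lam (phi b))).
  move=> D1b; have Ob := D1O b D1b; have Pb := P_ b Ob; have Sb := S_ b Ob.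
  have [PCb TSb] := Hlam _ Sb; split.
    by have [] := iffLR (preimage_curvature HM HE etaE _ Pb) PCb.
  have dD1' : diffeomorphism D1 (F @` D1 `&` setT) F by rewrite setIT.
  apply/seteqP; split=> V.
    move=> /(tangent_chart _ openT oD1 dD1' D1b)[w ->]; rewrite dmapE dF//.
    exact (preimage_eigen_down HM HE etaE Pb (lam0 b Ob) (Elam b w Ob)).
  move=> /(preimage_eigen_up HM HE etaE Pb (lam0 b Ob))[Y EY <-].
  have : tangent S (phi b) Y by rewrite TSb.
  move=> /(TS _ _ Ob)[w ->]; apply/(tangent_chart _ openT oD1 dD1' D1b); exists w.
  by rewrite dmapE dF.
have cS : curvature_surface M idfun xi (F @` D1).
  split.
  - exists d => _ [s D1s <-]; exists setT, D1, F; split=> //; first exact: openT.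
    by rewrite setIT.
  - apply: connected_continuous_connected; first exact: ball_connected.
    apply: smooth_map_continuous; apply/smooth_map_open => // k.
    by apply: Ck_sub (sF k) => s /D1O.
  - by move=> _ [s /D1O Os <-]; exact (preimage_base (P_ _ Os)).
  - by move=> _ [s D1s <-]; exists (fold (lam (phi s))); exact: TEF.
have D1a : D1 a by exact: ballxx.
have H b : D1 b -> fold (lam (phi b)) = fold (lam (phi a)).
  by move=> D1b; apply: (HD cS _ _ (TEF b D1b) (TEF a D1a)); [exists b|exists a].
by apply: filterS H _; apply: nbhsx_ballx.
Qed.

(** [lam] is given pointwise only, but along a fixed nonzero coordinate vector [w] it equals -<D_w
    n, D_w phi>/<D_w phi, D_w phi>, a quotient of smooth functions. *)
Lemma eigenvalue_continuous (S W : set 'rV[R]_8) d (Om : set 'rV[R]_d) phi a (lam : 'rV[R]_8 -> R) :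
  S `<=` P -> open W -> open Om -> diffeomorphism Om (S `&` W) phi -> Om a ->
  (forall x, S x -> TE S x (lam x)) -> {for a, continuous (fun b => lam (phi b))}.
Proof.
move=> SP oW oO dphi Oa Hlam.
have S_ b : Om b -> S (phi b) by have [_ [psi [_ H _]]] := dphi; move=> /H[[]].
have P_ b : Om b -> P (phi b) by move=> /S_/SP.
have [/(smooth_map_open _ oO) sphi _] := dphi.
have dfphi b : Om b -> differentiable phi b by exact: smooth_on_differentiable sphi.
have seta : smooth_map S eta by apply: smooth_map_sub SP (oh_normal_smooth HE).
pose n b := eta (phi b).
have sn : smooth_on Om n by have [] := @tdiff_chart _ _ _ _ _ _ _ _ eta a 0 oO dphi Oa seta.
have dn b w : Om b -> dmap n b w = - (lam (phi b) *: dmap phi b w).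
  move=> Ob; have Tw : tangent S (phi b) (dmap phi b w).
    by apply/(tangent_chart _ oW oO dphi Ob); exists w; rewrite dmapE.
  have [_ E] := Hlam _ (S_ b Ob); rewrite E in Tw.
  have [TY TlY] := Tw; rewrite (tdiff_id (P_ b Ob) TlY) => ->; rewrite opprK.
  have cg : curve_in P (phi b) (fun t : R => phi (b + t *: w)).
    exact: curve_push (proj1 dphi) P_ (curve_line w oO Ob).
  have dg := is_derive_line0 w (dfphi b Ob).
  have H1 := tdiff_derive (oh_normal_smooth HE) cg dg.
  have H2 := is_derive_line0 w (smooth_on_differentiable sn Ob).
  by rewrite -!dmapE; exact: is_derive_unique H2 H1.
have [w w0] : exists w : 'rV[R]_d, w != 0.
  have [[Y EY Y0] E] := Hlam _ (S_ a Oa).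
  have : tangent S (phi a) Y by rewrite E.
  move=> /(tangent_chart _ oW oO dphi Oa)[w Yw]; exists w; apply: contra_neq Y0 => w0.
  by rewrite Yw w0 linear0.
pose c b := - dot ('D_w n b) ('D_w phi b) / dot ('D_w phi b) ('D_w phi b).
have Dphi b : Om b -> 'D_w phi b = dmap phi b w.
  by move=> Ob; rewrite deriveE ?dmapE//; exact: dfphi.
have Dn b : Om b -> 'D_w n b = dmap n b w.
  by move=> Ob; rewrite deriveE ?dmapE//; exact: smooth_on_differentiable sn Ob.
have pos b : Om b -> dot ('D_w phi b) ('D_w phi b) != 0.
  move=> Ob; rewrite Dphi// gt_eqF// dot_gt0//; apply: contra_neq w0.
  by rewrite -dmapE; exact: diffeo_diff_inj oO dphi Ob.
have lamE b : Om b -> lam (phi b) = c b.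
  move=> Ob; have := pos b Ob; rewrite /c Dphi// Dn// dn// dotNl dotZl opprK => p0.
  by rewrite mulfK.
have Cc k : Ck k Om c.
  apply: CkM => //.
    by apply: CkN => //; apply: Ck_dot => //; [exact: (sn k.+1).2|exact: (sphi k.+1).2].
  by apply: CkV => //; apply: Ck_dot => //; exact: (sphi k.+1).2.
have Cl : Ck 0 Om (fun b => lam (phi b)).
  by apply: Ck_eq (Cc 0%N) => // b Ob; rewrite lamE.
exact: Cl.
Qed.

(** Near each point of the surface [fold lam] is constant, which leaves two values of opposite sign
    for [lam]. Continuity selects one of them, and connectedness of the surface makes the local
    constancy global. *)
Lemma hopf_preimage_dupin : dupin P idfun eta.
Proof.
move=> S [[d sS] cS SP HS] x y k l Sx Sy Tk Tl.
pose lam z := xget 0 [set t | TE S z t].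
have Hlam z : S z -> TE S z (lam z).
  by move=> /HS[t Tt]; apply: (@xgetPex _ 0 [set t | TE S z t]); exists t.
rewrite (tangent_eigenspace_inj (SP _ Sx) Tk (Hlam x Sx)) (tangent_eigenspace_inj (SP _ Sy) Tl (Hlam y Sy)).
apply: (connected_locally_constant cS _ Sx Sy) => {x y Sx Sy Tk Tl} x Sx.
have [W [Om [phi [oW Wx oO dphi]]]] := sS x Sx.
have [sphi [psi [spsi H1 H2]]] := dphi.
have [Oa fa] := H2 x (conj Sx Wx); set a := psi x in Oa fa.
have near_a : \forall b \near a, lam (phi b) = lam x.
  have cl := eigenvalue_continuous SP oW oO dphi Oa Hlam.
  pose vals := [:: upper (fold (lam x)); lower (fold (lam x))].
  have : \forall b \near a, lam (phi b) \in vals.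
    have := fold_locally_constant SP oW oO dphi Oa Hlam; rewrite fa.
    have : \forall b \near a, Om b by exact: open_nbhs_nbhs.
    apply: filterS2 => b Ob E; rewrite /vals -E.
    have Sb : S (phi b) by have [[]] := H1 b Ob.
    have l0 : lam (phi b) != 0.
      have [[Y EY Y0] _] := Hlam _ Sb.
      exact (preimage_eigenvalue_neq0 HM HE etaE (SP _ Sb) EY Y0).
    by rewrite !inE; case: (fold_root l0) => <-; rewrite eqxx ?orbT.
  move=> /(continuous_finite_values cl); apply: filterS => b; by rewrite fa.
have := chart_near (Q := fun y => lam y = lam x) oW dphi Oa near_a; rewrite fa; exact.
Qed.

End PreimageDupin.

(** * Lie sphere transformations *)

Section LieEquivalence.
Variables (R : realType) (n : nat).

Lemma lie_vec_comb (a b : R) (v w : 'rV[R]_n.+1) :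
  a *: lie_vec 1 v 0 + b *: lie_vec 0 w 1 = lie_vec a (a *: v + b *: w) b.
Proof.
rewrite /lie_vec !scale_row_mx !add_row_mx; congr row_mx; last congr row_mx;
by apply/matrixP => i j; rewrite !mxE (ord1 i) (ord1 j) /= ?mulr1n ?mulr0n; ring.
Qed.

Lemma lie_vec0 : lie_vec (0 : R) (0 : 'rV[R]_n.+1) 0 = 0.
Proof. by have := lie_vec_comb 0 0 0 0; rewrite !scale0r !addr0. Qed.

Lemma lie_vec_first (a b : R) (v : 'rV[R]_n.+1) : lie_vec a v b 0 (lshift _ 0) = a.
Proof. by rewrite row_mxEl mxE eqxx mulr1n. Qed.

Lemma lie_vec_last (a b : R) (v : 'rV[R]_n.+1) :
  lie_vec a v b 0 (rshift 1 (rshift n.+1 0)) = b.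
Proof. by rewrite row_mxEr row_mxEr mxE eqxx mulr1n. Qed.

Lemma lie_vec_middle (a b : R) (v : 'rV[R]_n.+1) j :
  lie_vec a v b 0 (rshift 1 (lshift 1 j)) = v 0 j.
Proof. by rewrite row_mxEr row_mxEl. Qed.

Lemma is_derive_lie_vec (V : normedModType R) (a b : V -> R) (F : V -> 'rV[R]_n.+1)
    (t v : V) (da db : R) (dF : 'rV[R]_n.+1) :
  is_derive t v a da -> is_derive t v F dF -> is_derive t v b db ->
  is_derive t v (fun s => lie_vec (a s) (F s) (b s)) (lie_vec da dF db).
Proof.
move=> Ha HF Hb; apply: is_derive_row => j; rewrite -(splitK j).
case: (fintype.split j) => [i|k] /=.
  rewrite (ord1 i) lie_vec_first.
  by have -> : (fun s => lie_vec (a s) (F s) (b s) 0 (lshift _ 0)) = a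
    by apply/funext => s; rewrite lie_vec_first.
rewrite -(splitK k); case: (fintype.split k) => [i|i] /=.
  rewrite lie_vec_middle.
  have -> : (fun s => lie_vec (a s) (F s) (b s) 0 (rshift 1 (lshift 1 i))) = (fun s => F s 0 i)
    by apply/funext => s; rewrite lie_vec_middle.
  exact: is_derive_coord.
rewrite (ord1 i) lie_vec_last.
by have -> : (fun s => lie_vec (a s) (F s) (b s) 0 (rshift 1 (rshift n.+1 0))) = b
  by apply/funext => s; rewrite lie_vec_last.
Qed.

Lemma legendre_lift_mul N (f xi : 'rV[R]_N -> 'rV[R]_n.+1) x (v : 'rV[R]_(1 + 1)) :
  v *m legendre_lift f xi x =
  lie_vec (v 0 (lshift 1 0)) (v 0 (lshift 1 0) *: f x + v 0 (rshift 1 0) *: xi x)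
    (v 0 (rshift 1 0)).
Proof.
rewrite -lie_vec_comb /legendre_lift -{1}[v]hsubmxK mul_row_col.
by congr (_ + _); rewrite [X in X *m _]mx11_scalar mul_scalar_mx !mxE.
Qed.

Variables (N1 N2 : nat) (D1 : set 'rV[R]_N1) (f1 xi1 : 'rV[R]_N1 -> 'rV[R]_n.+1).
Variables (D2 : set 'rV[R]_N2) (f2 xi2 : 'rV[R]_N2 -> 'rV[R]_n.+1).
Hypotheses (H1 : oriented_hypersurface D1 f1 xi1) (H2 : oriented_hypersurface D2 f2 xi2).
Variables (B : 'M[R]_(1 + (n.+1 + 1))) (phi : 'rV[R]_N1 -> 'rV[R]_N2).
Hypotheses (uB : B \in unitmx) (dphi : diffeomorphism D1 D2 phi).
Hypothesis BE : forall x, D1 x ->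
  (legendre_lift f1 xi1 x *m B == legendre_lift f2 xi2 (phi x))%MS.

Lemma diffeo_tangent x Y : D1 x -> tangent D1 x Y ->
  tangent D2 (phi x) (tdiff D1 phi x Y) /\ (tdiff D1 phi x Y = 0 -> Y = 0).
Proof.
move=> D1x TY; have [sphi [psi [spsi P1 P2]]] := dphi.
have D12 y : D1 y -> D2 (phi y) by move=> /P1[].
split; first exact: tangent_push TY.
have [gamma cg dg] := iffLR (tangentP _ _ _) TY.
have H := tdiff_derive spsi (curve_push sphi D12 cg) (tdiff_derive sphi cg dg).
move=> Z0; rewrite Z0 in H.
have E : \forall t \near (0 : R), psi (phi (gamma t)) = gamma t.
  by apply: filterS (curve_near cg) => t /P1[].
rewrite (is_derive_unique dg (near_eq_is_derive E H)).
by rewrite /tdiff linear0.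
Qed.

(* The line [x] goes to is spanned by [lie_vec 1 f2 0] and [lie_vec 0 xi2 1], so the
   image of a vector is determined by its first and last coordinates. *)
Lemma lift_image (x : 'rV[R]_N1) (a b : R) : D1 x ->
  let u := lie_vec a (a *: f1 x + b *: xi1 x) b *m B in
  let p := u 0 (lshift _ 0) in let q := u 0 (rshift 1 (rshift n.+1 0)) in
  u = lie_vec p (p *: f2 (phi x) + q *: xi2 (phi x)) q.
Proof.
move=> D1x u.
have : (u <= legendre_lift f2 xi2 (phi x))%MS.
  have /andP[+ _] := BE D1x; apply: submx_trans.
  pose v : 'rV[R]_(1 + 1) := row_mx a%:M b%:M.
  have -> : u = v *m (legendre_lift f1 xi1 x *m B).
    rewrite mulmxA legendre_lift_mul /u /v !row_mxEl !row_mxEr !mxE eqxx !mulr1n //.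
  exact: submxMl.
by move=> /submxP[v ->]; rewrite legendre_lift_mul lie_vec_first lie_vec_last.
Qed.

(** For a = k and b = 1 the vector is the curvature sphere of [k] at [x]; its image under [B] is
    recorded by its first and last coordinates. *)
Definition first_entry (x : 'rV[R]_N1) (a b : R) : R :=
  (lie_vec a (a *: f1 x + b *: xi1 x) b *m B) 0 (lshift _ 0).
Definition last_entry (x : 'rV[R]_N1) (a b : R) : R :=
  (lie_vec a (a *: f1 x + b *: xi1 x) b *m B) 0 (rshift 1 (rshift n.+1 0)).

(** Along the eigendirection [Y] the curvature sphere is stationary to first order, because k df1(Y)
    + dxi1(Y) = 0. The linear map [B] preserves this, and in the second lift it reads p df2(Z) + q
    dxi2(Z) = 0, so that p/q is a principal curvature there. *)
Lemma lie_curvature x k : D1 x -> principal_curvatures D1 f1 xi1 x k ->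
  last_entry x k 1 != 0 /\
  principal_curvatures D2 f2 xi2 (phi x) (first_entry x k 1 / last_entry x k 1).
Proof.
move=> D1x [Y [TY TkY E] Y0].
have [gamma cg dg] := iffLR (tangentP _ _ _) TY.
have g0 : gamma 0 = x by have [? []] := cg.
have [sphi [psi [_ P1 _]]] := dphi.
have D12 y : D1 y -> D2 (phi y) by move=> /P1[].
have [TZ Z0] := diffeo_tangent D1x TY; set Z := tdiff D1 phi x Y in TZ Z0.
have cZ := curve_push sphi D12 cg.
have dZ : is_derive (0 : R) (1 : R) (fun t => phi (gamma t)) Z := tdiff_derive sphi cg dg.
have dc (c : R) : is_derive (0 : R) (1 : R) (cst c : R -> R) 0 by exact: is_derive_cst.
pose u t := lie_vec k (k *: f1 (gamma t) + 1 *: xi1 (gamma t)) 1 *m B.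
have df := tdiff_derive (oh_smooth H1) cg dg.
have dx := tdiff_derive (oh_normal_smooth H1) cg dg.
have du : is_derive (0 : R) (1 : R) u 0.
  have E0 : k *: tdiff D1 f1 x Y + tdiff D1 xi1 x Y = 0.
    have : tdiff D1 f1 x (k *: Y) = k *: tdiff D1 f1 x Y by rewrite /tdiff linearZ.
    by rewrite E => <-; rewrite addrC subrr.
  have dm : is_derive (0 : R) (1 : R) (fun t => k *: f1 (gamma t) + 1 *: xi1 (gamma t)) 0.
    have := is_deriveD (is_deriveZ k df) dx; rewrite E0.
    have -> : (fun t => k *: f1 (gamma t) + 1 *: xi1 (gamma t)) =
      (fun t => k *: f1 (gamma t) + xi1 (gamma t)) by apply/funext => t; rewrite scale1r.
    exact.
  have := is_derive_mulmx B (is_derive_lie_vec (dc k) dm (dc 1)).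
  have -> : lie_vec (0 : R) (0 : 'rV[R]_n.+1) 0 = 0.
    by exact: lie_vec0.
  by rewrite mul0mx.
pose p t := u t 0 (lshift _ 0); pose q t := u t 0 (rshift 1 (rshift n.+1 0)).
have dp : is_derive (0 : R) (1 : R) p 0.
  by have := is_derive_coord (lshift _ 0) du; rewrite mxE; exact.
have dq : is_derive (0 : R) (1 : R) q 0.
  by have := is_derive_coord (rshift 1 (rshift n.+1 0)) du; rewrite mxE; exact.
have uE : \forall t \near (0 : R),
    u t = lie_vec (p t) (p t *: f2 (phi (gamma t)) + q t *: xi2 (phi (gamma t))) (q t).
  by apply: filterS (curve_near cg) => t D1t; exact: lift_image.
have df2 := tdiff_derive (oh_smooth H2) cZ dZ.
have dx2 := tdiff_derive (oh_normal_smooth H2) cZ dZ.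
have K (A C : 'rV[R]_n.+1) :
    is_derive (0 : R) (1 : R) (fun t => f2 (phi (gamma t))) A ->
    is_derive (0 : R) (1 : R) (fun t => xi2 (phi (gamma t))) C -> p 0 *: A + q 0 *: C = 0.
  move=> dA dC; apply/rowP => j; rewrite !mxE.
  have Ha := is_deriveD (is_deriveM dp (is_derive_coord j dA))
    (is_deriveM dq (is_derive_coord j dC)).
  have Hb : is_derive (0 : R) (1 : R) (fun t => u t 0 (rshift 1 (lshift 1 j))) 0.
    by have := is_derive_coord (rshift 1 (lshift 1 j)) du; rewrite mxE; exact.
  have Eab : \forall t \near (0 : R), u t 0 (rshift 1 (lshift 1 j)) =
      p t * f2 (phi (gamma t)) 0 j + q t * xi2 (phi (gamma t)) 0 j.
    by apply: filterS uE => t ->; rewrite lie_vec_middle !mxE.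
  have K0 (a1 a2 a3 a4 a5 a6 : R) : a1 * a2 + a3 * 0 + (a4 * a5 + a6 * 0) = 0 ->
    a1 * a2 + a4 * a5 = 0 by rewrite !mulr0 !addr0.
  exact: K0 (is_derive_unique Ha (near_eq_is_derive Eab Hb)).
have E0 := K _ _ df2 dx2.
have p0 : p 0 = first_entry x k 1 by rewrite /p /u g0.
have q0 : q 0 = last_entry x k 1 by rewrite /q /u g0.
have Zn0 : Z != 0 by apply: contra_neq Y0; exact: Z0.
have D2x := D12 x D1x.
(* If q = 0 then p df2(Z) = 0. The immersion excludes df2(Z) = 0, and p = q = 0 would mean that [B]
   kills a nonzero vector. *)
have q0n : q 0 != 0.
  apply/eqP => q00; rewrite q00 scale0r addr0 in E0.
  have p0n : p 0 != 0.
    apply/eqP => p00; have := nbhs_singleton uE; rewrite p00 q00 !scale0r addr0.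
    have -> : lie_vec (0 : R) (0 : 'rV[R]_n.+1) 0 = 0.
      by exact: lie_vec0.
    rewrite /u => u0; have : lie_vec k (k *: f1 (gamma 0) + 1 *: xi1 (gamma 0)) 1 = 0.
      by rewrite -[LHS](mulmxK uB) u0 mul0mx.
    move=> /rowP/(_ (rshift 1 (rshift n.+1 0))); rewrite lie_vec_last mxE => /eqP.
    by rewrite oner_eq0.
  move/eqP: E0; rewrite scaler_eq0 (negbTE p0n) => /= /eqP f0.
  by move/eqP: Zn0; apply; exact: (oh_immersion H2 D2x TZ f0).
split; first by rewrite -q0.
exists Z => //; split=> //; first exact: submanifold_tangentZ (oh_submanifold H2) D2x TZ.
rewrite -p0 -q0.
have -> : tdiff D2 f2 (phi x) ((p 0 / q 0) *: Z) = (p 0 / q 0) *: tdiff D2 f2 (phi x) Z.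
  by rewrite /tdiff linearZ.
apply: (scalerI q0n); apply/eqP; rewrite scalerN -addr_eq0 scalerA mulrC divfK//.
by rewrite E0.
Qed.

Lemma entry_affine x : exists p q r s, forall k : R,
  first_entry x k 1 = p * k + q /\ last_entry x k 1 = r * k + s.
Proof.
exists (first_entry x 1 0), (first_entry x 0 1), (last_entry x 1 0), (last_entry x 0 1) => k.
have E : lie_vec k (k *: f1 x + 1 *: xi1 x) 1 *m B =
    k *: (lie_vec 1 (1 *: f1 x + 0 *: xi1 x) 0 *m B) + lie_vec 0 (0 *: f1 x + 1 *: xi1 x) 1 *m B.
  rewrite scalemxAl -mulmxDl; congr (_ *m _).
  rewrite !scale1r !scale0r addr0 add0r.
  by have := lie_vec_comb k 1 (f1 x) (xi1 x); rewrite !scale1r => <-.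
by rewrite /first_entry /last_entry E !mxE; split; congr (_ + _); rewrite mulrC.
Qed.

(** Equal ratios mean proportional images under the invertible [B], hence proportional curvature
    spheres; their last coordinates are both 1. *)
Lemma entry_inj x k l : D1 x -> last_entry x k 1 != 0 ->
  first_entry x k 1 * last_entry x l 1 = first_entry x l 1 * last_entry x k 1 -> k = l.
Proof.
move=> D1x q0 E.
pose w t := lie_vec t (t *: f1 x + 1 *: xi1 x) 1.
have w_image t : w t *m B = lie_vec (first_entry x t 1) (first_entry x t 1 *: f2 (phi x) +
    last_entry x t 1 *: xi2 (phi x)) (last_entry x t 1) by exact: lift_image.
have H : last_entry x l 1 *: w k = last_entry x k 1 *: w l.
  apply: (can_inj (mulmxK uB)); rewrite -!scalemxAl !w_image -!lie_vec_comb.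
  by rewrite !scalerDr !scalerA mulrC E (mulrC (last_entry x k 1)) (mulrC (last_entry x l 1)).
have wE t i : (last_entry x l 1 *: w k) 0 i = last_entry x l 1 * w k 0 i /\
    (last_entry x k 1 *: w t) 0 i = last_entry x k 1 * w t 0 i by rewrite !mxE.
have E1 : last_entry x l 1 = last_entry x k 1.
  have [+ +] := wE l (rshift 1 (rshift n.+1 0)).
  by rewrite H => ->; rewrite /w !lie_vec_last !mulr1.
have [+ +] := wE l (lshift (n.+1 + 1) 0).
by rewrite H => ->; rewrite /w !lie_vec_first E1 => /(mulfI q0).
Qed.

(** The conditions on [a], [b], [c], [d] keep the denominators of both cross ratios nonzero. *)
Lemma lie_moebius x : D1 x -> exists T : R -> R,
  [/\ forall k, principal_curvatures D1 f1 xi1 x k -> principal_curvatures D2 f2 xi2 (phi x) (T k),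
      {in principal_curvatures D1 f1 xi1 x &, injective T} &
      forall a b c d, principal_curvatures D1 f1 xi1 x a -> principal_curvatures D1 f1 xi1 x b ->
        principal_curvatures D1 f1 xi1 x c -> principal_curvatures D1 f1 xi1 x d ->
        a != c -> d != b -> cross_ratio (T a) (T b) (T c) (T d) = cross_ratio a b c d].
Proof.
move=> D1x; exists (fun k => first_entry x k 1 / last_entry x k 1).
have inj k l : principal_curvatures D1 f1 xi1 x k -> principal_curvatures D1 f1 xi1 x l ->
    first_entry x k 1 / last_entry x k 1 = first_entry x l 1 / last_entry x l 1 -> k = l.
  move=> /(lie_curvature D1x)[k0 _] /(lie_curvature D1x)[l0 _] E; apply: (entry_inj D1x k0).
  by apply/eqP; rewrite -eqr_div// E.
split=> [k /(lie_curvature D1x)[]//|k l /set_mem Pk /set_mem Pl|a b c d Pa Pb Pc Pd ac db].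
  exact: inj.
have [p [q [r [s pqrs]]]] := entry_affine x.
have nz k : principal_curvatures D1 f1 xi1 x k -> r * k + s != 0.
  by move=> /(lie_curvature D1x)[+ _]; have [_ ->] := pqrs k.
have TE k : first_entry x k 1 / last_entry x k 1 = (p * k + q) / (r * k + s).
  by have [-> ->] := pqrs k.
(* With zero determinant the map would take equal values at the distinct curvatures [a] and [c],
   against injectivity. *)
have det0 : p * s - q * r != 0.
  apply/eqP => E; move/eqP: ac; apply; apply: inj => //.
  rewrite !TE; apply/eqP; rewrite eqr_div ?nz//; apply/eqP.
  have -> : (p * a + q) * (r * c + s) = (p * c + q) * (r * a + s) + (p * s - q * r) * (a - c) by ring.
  by rewrite E mul0r addr0.
have TB k l : principal_curvatures D1 f1 xi1 x k -> principal_curvatures D1 f1 xi1 x l ->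
    first_entry x k 1 / last_entry x k 1 - first_entry x l 1 / last_entry x l 1 =
    (p * s - q * r) * (k - l) / ((r * k + s) * (r * l + s)).
  by move=> /nz k0 /nz l0; rewrite !TE; field; rewrite ?k0 ?l0.
rewrite /cross_ratio !TB//; field.
by rewrite !nz// det0 !subr_eq0 ac db.
Qed.

End LieEquivalence.

(** * The unit normal is unique up to sign *)

Section NormalSign.
Variables (R : realType) (m : nat) (D : set 'rV[R]_m.+2).
Implicit Types (xi eta : 'rV[R]_m.+2 -> 'rV[R]_m.+2).

(** eta - c xi is orthogonal to [x] and to xi, hence tangent, hence orthogonal to eta. This gives
    c^2 = 1, and then its length is 0. *)
Lemma normal_pm xi eta x : @oriented_hypersurface R m.+2 m.+1 D idfun xi ->
  @oriented_hypersurface R m.+2 m.+1 D idfun eta -> D x ->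
  eta x = dot (eta x) (xi x) *: xi x /\ (dot (eta x) (xi x) = 1 \/ dot (eta x) (xi x) = -1).
Proof.
move=> Hxi Heta Dx; set c := dot (eta x) (xi x).
have xi1 : dot (xi x) (xi x) = 1 := oh_normal_unit Hxi Dx.
have eta1 : dot (eta x) (eta x) = 1 := oh_normal_unit Heta Dx.
have xi0 : dot (xi x) x = 0 := oh_normal_sphere Hxi Dx.
have eta0 : dot (eta x) x = 0 := oh_normal_sphere Heta Dx.
pose z := eta x - c *: xi x.
have Tz : tangent D x z.
  apply/(hypersurface_tangent _ Hxi Dx); rewrite !dotBl !dotZl xi0 eta0 xi1 -/c.
  by rewrite mulr0 mulr1 !subrr.
have := iffLR (hypersurface_tangent _ Heta Dx) Tz => -[_].
rewrite dotBl dotZl eta1 (dotC (xi x)) -/c => c2.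
have z0 : z = 0.
  by apply: dot_eq0; rewrite !(dotBl, dotBr, dotZl, dotZr) eta1 xi1 (dotC (xi x)) -/c; lra.
split; first by apply/eqP; rewrite -subr_eq0; apply/eqP.
have /eqP : c ^+ 2 = 1 by rewrite expr2; lra.
by rewrite sqrf_eq1 => /orP[]/eqP; [left|right].
Qed.

Lemma normal_unique xi eta : connected D -> @oriented_hypersurface R m.+2 m.+1 D idfun xi ->
  @oriented_hypersurface R m.+2 m.+1 D idfun eta ->
  (forall x, D x -> eta x = xi x) \/ (forall x, D x -> eta x = - xi x).
Proof.
move=> cD Hxi Heta; pose c x := dot (eta x) (xi x).
have const x y : D x -> D y -> c x = c y.
  apply: (connected_locally_constant cD) => {x y} x Dx.
  have [F [U [oU Ux sF FE]]] := oh_normal_smooth Heta Dx.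
  have [G [U' [oU' U'x sG GE]]] := oh_normal_smooth Hxi Dx.
  pose h y := dot (F y) (G y).
  have ch : {for x, continuous h}.
    have C : Ck 0 (U `&` U') h.
      apply: Ck_dot; first exact: openI.
        by apply: Ck_sub (sF 0%N) => ? [].
      by apply: Ck_sub (sG 0%N) => ? [].
    exact: C.
  (* The function [c] takes only the values 1 and -1, so a variation below 1 means none. *)
  have N : nbhs (h x) [set t | `|h x - t| < 1].
    by have := nbhsx_ballx (h x) 1 ltr01; rewrite -ball_normE.
  have nh := continuous_near ch N.
  near=> y => Dy.
  have hy : `|h x - h y| < 1 by near: y; exact: nh.
  have Uy : U y by near: y; exact: open_nbhs_nbhs.
  have U'y : U' y by near: y; exact: open_nbhs_nbhs.
  move: hy; rewrite /h !FE// !GE// -/(c x) -/(c y).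
  have [_ +] := normal_pm Hxi Heta Dx; have [_ +] := normal_pm Hxi Heta Dy.
  by rewrite -/(c x) -/(c y) ltr_norml => -[]-> -[]-> // /andP[]; lra.
case: (pselect (exists x, D x)) => [[x Dx]|nD]; last by left=> x Dx; case: nD; exists x.
have [_] := normal_pm Hxi Heta Dx; rewrite -/(c x) => -[] cx; [left|right] => y Dy;
  have [-> _] := normal_pm Hxi Heta Dy; rewrite -/(c y) (const y x Dy Dx) cx.
  by rewrite scale1r.
by rewrite scaleN1r.
Unshelve. all: by end_near. Qed.

End NormalSign.

(** * Reversal of the normal *)

Section Flip.
Variables (R : realType) (m : nat) (D : set 'rV[R]_m.+2) (xi nxi : 'rV[R]_m.+2 -> 'rV[R]_m.+2).
Hypothesis HD : @oriented_hypersurface R m.+2 m.+1 D idfun xi.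
Hypothesis nxiE : forall x, nxi x = - xi x.

Lemma smooth_map_opp : smooth_map D nxi.
Proof.
move=> x Dx; have [F [U [oU Ux sF FE]]] := oh_normal_smooth HD Dx.
exists (fun y => - F y), U; split.
- exact: oU.
- exact: Ux.
- by move=> k; apply: CkN.
- by move=> y Dy Uy; rewrite FE// nxiE.
Qed.

Lemma tdiff_opp x v : D x -> tangent D x v -> tdiff D nxi x v = - tdiff D xi x v.
Proof.
move=> Dx /tangentP[gamma cg dg].
have H := is_deriveN (tdiff_derive (oh_normal_smooth HD) cg dg).
have E : (fun t => nxi (gamma t)) = (fun t => - xi (gamma t)) by apply/funext => t; exact: nxiE.
have H2 := tdiff_derive smooth_map_opp cg dg; rewrite E in H2.
exact: (is_derive_unique H2 H).
Qed.

Lemma opp_hypersurface : @oriented_hypersurface R m.+2 m.+1 D idfun nxi.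
Proof.
have [h1 h2 h3 h4 h5 h6 h7 h8] := HD; split.
- exact: h1.
- exact: h2.
- exact: h3.
- exact: h4.
- exact: smooth_map_opp.
- by move=> x Dx; rewrite /sphere /= nxiE dotNl dotNr opprK; exact (h6 x Dx).
- by move=> x Dx; rewrite nxiE dotNl h7// oppr0.
- by move=> x v Dx Tv; rewrite nxiE dotNl h8// oppr0.
Qed.

Lemma opp_eigenspace x k : D x ->
  shape_eigenspace D idfun nxi x k = shape_eigenspace D idfun xi x (- k).
Proof.
move=> Dx; have sD : submanifold m D := oh_submanifold HD; apply/seteqP; split=> X.
  move=> /(shape_eigenspaceP _ _ _ sD Dx)[TX]; rewrite (tdiff_opp Dx TX) => E.
  by apply/(shape_eigenspaceP _ _ _ sD Dx); split; [exact: TX|rewrite scaleNr opprK; exact: oppr_inj E].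
move=> /(shape_eigenspaceP _ _ _ sD Dx)[TX]; rewrite scaleNr opprK => E.
by apply/(shape_eigenspaceP _ _ _ sD Dx); split; [exact: TX|rewrite (tdiff_opp Dx TX) E].
Qed.

Lemma opp_curvatures x k : D x ->
  principal_curvatures D idfun nxi x k <-> principal_curvatures D idfun xi x (- k).
Proof.
move=> Dx; have E := opp_eigenspace k Dx; split=> -[X EX X0].
  by exists X; [rewrite -E|exact: X0].
by exists X; [rewrite E|exact: X0].
Qed.

Lemma opp_tangent_eigenspace S x k : D x ->
  tangent_eigenspace D idfun nxi S x k <-> tangent_eigenspace D idfun xi S x (- k).
Proof.
move=> Dx; have E := opp_eigenspace k Dx; split=> -[PX TX].
  by split; [exact: (iffLR (opp_curvatures k Dx))|rewrite -E].
by split; [exact: (iffRL (opp_curvatures k Dx))|rewrite E].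
Qed.

Lemma opp_dupin : dupin D idfun xi -> dupin D idfun nxi.
Proof.
move=> H S [dS cS SD HS] x y k l Sx Sy.
move=> /(opp_tangent_eigenspace _ _ (SD _ Sx)) Tx /(opp_tangent_eigenspace _ _ (SD _ Sy)) Ty.
have cs : curvature_surface D idfun xi S.
  split; [exact: dS|exact: cS|exact: SD|] => z Sz.
  have [t /(opp_tangent_eigenspace _ _ (SD _ Sz)) Tt] := HS z Sz.
  by exists (- t).
exact: (oppr_inj (H S cs x y _ _ Sx Sy Tx Ty)).
Qed.

Lemma opp_proper_dupin g : proper_dupin D idfun xi g -> proper_dupin D idfun nxi g.
Proof.
move=> [Hd card]; split; first exact: opp_dupin.
move=> x Dx.
have /card_II_seqP[s [us ss PCs]] := card x Dx; apply/card_II_seqP.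
exists [seq - k | k <- s]; rewrite size_map map_inj_uniq; last exact: oppr_inj.
split; [exact: us|exact: ss|].
apply/seteqP; split=> k.
  move=> /(opp_curvatures _ Dx); rewrite PCs /= => ks.
  by rewrite -(opprK k) map_f.
move=> /= /mapP[l ls ->]; apply/(opp_curvatures _ Dx).
by rewrite opprK PCs.
Qed.

Lemma opp_isoparametric : isoparametric D idfun nxi -> isoparametric D idfun xi.
Proof.
move=> H x y Dx Dy.
have K z t k : D z -> D t -> principal_curvatures D idfun xi z k ->
    principal_curvatures D idfun xi t k.
  move=> Dz Dt Pk; have : principal_curvatures D idfun nxi z (- k).
    by apply: (iffRL (opp_curvatures _ Dz)); rewrite opprK.
  rewrite (H z t Dz Dt) => /(iffLR (opp_curvatures _ Dt)).
  by rewrite opprK.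
by apply/seteqP; split=> k; exact: K.
Qed.

End Flip.

(** * From cross ratios to differences of angles *)

Section CrossRatio.
Variable R : realType.

(** For k = cot s and l = cot t, with s and t between 0 and pi, [F] is cos (s - t) and both sides
    are the square of cot (s - t). *)
Lemma cross_ratio_angle (k l : R) : k != l ->
  let F := 1 - 2 * cross_ratio (upper k) (upper l) (lower k) (lower l) in
  ((1 + k * l) / (l - k)) ^+ 2 = F ^+ 2 / (1 - F ^+ 2).
Proof.
move=> kl.
have := sqrt_sqr k; have := sqrt_sqr l; have := sqrt_bound k; have := sqrt_bound l.
set s := Num.sqrt (k ^+ 2 + 1); set t := Num.sqrt (l ^+ 2 + 1) => tb sb tt ss.
have s0 : s != 0 by rewrite gt_eqF// (le_lt_trans _ sb).
have t0 : t != 0 by rewrite gt_eqF// (le_lt_trans _ tb).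
have lk : l - k != 0 by rewrite subr_eq0 eq_sym.
have crE : 1 - 2 * cross_ratio (upper k) (upper l) (lower k) (lower l) = (1 + k * l) / (s * t).
  rewrite /cross_ratio /upper /lower -/s -/t.
  have -> : (k + s - (l + t)) * (l - t - (k - s)) = 2 * (1 + k * l - s * t).
    by transitivity (s ^+ 2 + t ^+ 2 - 2 * s * t - k ^+ 2 - l ^+ 2 + 2 * k * l); [ring|rewrite ss tt; ring].
  have -> : (k + s - (k - s)) * (l - t - (l + t)) = - (4 * (s * t)) by ring.
  by field; rewrite s0 t0.
move=> F; rewrite {}/F crE.
have E : (s * t) ^+ 2 = (1 + k * l) ^+ 2 + (l - k) ^+ 2 by rewrite exprMn ss tt; ring.
have -> : 1 - ((1 + k * l) / (s * t)) ^+ 2 = (l - k) ^+ 2 / (s * t) ^+ 2.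
  rewrite expr_div_n -[X in X - _](divff (_ : (s * t) ^+ 2 != 0)) ?expf_neq0 ?mulf_neq0//.
  by rewrite -mulrBl {1}E addrAC subrr add0r.
by field; rewrite lk s0 t0.
Qed.

Lemma cross_ratio_isoparametric (M : set 'rV[R]_5) (xi : 'rV[R]_5 -> 'rV[R]_5) (g : nat)
    (A : set R) : g = 2%N \/ g = 3%N ->
  @oriented_hypersurface R 5 4 M idfun xi -> connected M -> proper_dupin M idfun xi g ->
  finite_set A ->
  (forall x k l, M x -> principal_curvatures M idfun xi x k ->
     principal_curvatures M idfun xi x l -> k != l ->
     A (cross_ratio (upper k) (upper l) (lower k) (lower l))) ->
  isoparametric M idfun xi.
Proof.
move=> hg HM cM HD /finite_seqP[s ->] H.
(* The cross ratio yields only the absolute value [F c] of the cotangent, hence the two lists of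
   values below. *)
pose F (c : R) := Num.sqrt ((1 - 2 * c) ^+ 2 / (1 - (1 - 2 * c) ^+ 2)).
apply: (@finite_angles_isoparametric _ _ _ _ ([seq F c | c <- s] ++ [seq - F c | c <- s]) hg HM cM HD).
move=> x k l Mx Pk Pl kl; have cs := H x k l Mx Pk Pl kl.
set c := cross_ratio _ _ _ _ in cs; have /= := cross_ratio_angle kl; rewrite -/c => E.
have : `|(1 + k * l) / (l - k)| = F c by rewrite /F -E sqrtr_sqr.
rewrite mem_cat; case: ler0P => _ EF; apply/orP; [right|left].
  by apply/mapP; exists c => //; rewrite -EF opprK.
by apply/mapP; exists c.
Qed.

End CrossRatio.

(** * Lie curvatures and Lie equivalence of the preimage *)

Section Preimage.
Variables (R : realType) (M : set 'rV[R]_5) (xi : 'rV[R]_5 -> 'rV[R]_5) (g : nat).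
Hypothesis hg : g = 2%N \/ g = 3%N.
Hypothesis HM : @oriented_hypersurface R 5 4 M idfun xi.
Hypothesis cM : connected M.
Hypothesis HD : proper_dupin M idfun xi g.
Hypothesis nonisoparametric : ~ isoparametric M idfun xi.
Variable eta : 'rV[R]_8 -> 'rV[R]_8.
Local Notation P := (hopf_preimage M).
Hypothesis HE : @oriented_hypersurface R 8 7 P idfun eta.
Hypothesis etaE : forall x, P x -> eta x = hopf_normal xi x.
Local Notation PCM := (principal_curvatures M idfun xi).
Local Notation PCP := (principal_curvatures P idfun eta).

Lemma preimage_curvatures x (s : seq R) : P x -> PCM (hopf x) = [set` s] ->
  PCP x = [set` [seq lower k | k <- s] ++ [seq upper k | k <- s]].
Proof.
move=> Px PCs; rewrite -fold_preimage; apply/seteqP; split=> l.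
  by move=> /(iffLR (preimage_curvature HM HE etaE _ Px))[l0]; rewrite PCs.
by move=> [l0 ls]; apply: (iffRL (preimage_curvature HM HE etaE _ Px)); rewrite PCs.
Qed.

Lemma hopf_preimage_proper_dupin : proper_dupin P idfun eta (2 * g).
Proof.
split; first exact (hopf_preimage_dupin HM HE etaE (proj1 HD)).
move=> x Px; have /card_II_seqP[s [us ss PCs]] := proj2 HD _ (preimage_base Px).
apply/card_II_seqP; exists ([seq lower k | k <- s] ++ [seq upper k | k <- s]); split.
- exact: fold_preimage_uniq.
- by rewrite size_cat !size_map ss mul2n addnn.
- exact: preimage_curvatures.
Qed.

Lemma curvature_lower x k : P x -> PCM (hopf x) k -> PCP x (lower k).
Proof.
move=> Px Pk; apply: (iffRL (preimage_curvature HM HE etaE _ Px)).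
by rewrite fold_lower lt_eqF ?lower_lt0.
Qed.

Lemma curvature_upper x k : P x -> PCM (hopf x) k -> PCP x (upper k).
Proof.
move=> Px Pk; apply: (iffRL (preimage_curvature HM HE etaE _ Px)).
by rewrite fold_upper gt_eqF ?upper_gt0.
Qed.

(** The obstruction behind both negative claims. Every point of [M] lies below a point of the
    preimage, so a bound upstairs is a bound on all of [M]. *)
Lemma infinite_cross_ratios (A : set R) : finite_set A ->
  ~ (forall x k l, P x -> PCM (hopf x) k -> PCM (hopf x) l -> k != l ->
     A (cross_ratio (upper k) (upper l) (lower k) (lower l))).
Proof.
move=> fA H; apply: nonisoparametric.
apply: (cross_ratio_isoparametric hg HM cM HD fA) => m k l Mm.
have [x Px <-] := hopf_fibre_nonempty HM Mm; exact: H.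
Qed.

(** An empty preimage would mean an empty [M], which is vacuously isoparametric. *)
Lemma exists_preimage : exists x, P x.
Proof.
apply: contrapT => nP; apply: nonisoparametric => m m' Mm _.
by have [x Px _] := hopf_fibre_nonempty HM Mm; case: nP; exists x.
Qed.

Let s_spec x (s : seq R) := [/\ sorted <%R s, size s = g & PCM (hopf x) = [set` s]].
Let ss x : seq R := xget [::] (s_spec x).

Lemma ssP x : P x -> s_spec x (ss x).
Proof.
move=> Px; have /card_II_seqP[s [us sg PCs]] := proj2 HD _ (preimage_base Px).
apply: (@xgetPex _ [::] (s_spec x)); exists (sort <=%R s); split.
- by rewrite sort_lt_sorted.
- by rewrite size_sort.
- by rewrite PCs; apply/seteqP; split=> k /=; rewrite mem_sort.
Qed.

(** All [lower] values are negative, all [upper] values positive, and both increase with k;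
    concatenation therefore lists the curvatures in increasing order. *)
Let kappa (i : 'I_(2 * g)) x : R :=
  nth 0 ([seq lower k | k <- ss x] ++ [seq upper k | k <- ss x]) i.

Lemma kappaP : principal_curvature_functions P idfun eta kappa.
Proof.
move=> x Px; have [st sg PCs] := ssP Px.
have sz : size ([seq lower k | k <- ss x] ++ [seq upper k | k <- ss x]) = (2 * g)%N.
  by rewrite size_cat !size_map sg mul2n addnn.
split.
  move=> i j ij; rewrite /kappa; set s := _ ++ _ in sz *.
  have pst : pairwise <%R (ss x) by rewrite -(sorted_pairwise lt_trans).
  have : pairwise <%R s.
    rewrite pairwise_cat !pairwise_map; apply/and3P; split.
    - by apply/allrelP => _ _ /mapP[k _ ->] /mapP[l _ ->]; exact: lower_upper.
    - by apply: sub_pairwise pst => k l /=; exact: lower_lt.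
    - by apply: sub_pairwise pst => k l /=; exact: upper_lt.
  by move=> /(pairwiseP 0) H; apply: H; rewrite ?inE ?sz.
rewrite (preimage_curvatures Px PCs); apply/seteqP; split=> l /=.
  move=> ls; have := ls; rewrite -index_mem sz => il.
  by exists (Ordinal il) => //; rewrite /kappa /= nth_index.
by move=> [i _ <-]; rewrite /kappa; apply: mem_nth; rewrite sz.
Qed.

Lemma not_constant_lie_curvatures : ~ constant_lie_curvatures P idfun eta (2 * g).
Proof.
move=> H; have [x0 Px0] := exists_preimage.
pose C (t : 'I_(2 * g) * 'I_(2 * g) * 'I_(2 * g) * 'I_(2 * g)) x :=
  cross_ratio (kappa t.1.1.1 x) (kappa t.1.1.2 x) (kappa t.1.2 x) (kappa t.2 x).
(* The finite set consists of the cross ratios formed at the single point [x0]. *)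
apply: (@infinite_cross_ratios [set C t x0 | t in setT]).
  by apply: finite_image; exact: finite_finset.
move=> x k l Px Pk Pl kl; have [st sg PCs] := ssP Px.
rewrite PCs /= in Pk Pl; have := Pk; have := Pl; rewrite -!index_mem sg.
set i := index k _; set j := index l _ => jg ig.
have lo n : (n < g)%N -> (n < 2 * g)%N by move=> ng; rewrite mul2n -addnn ltn_addr.
have up n : (n < g)%N -> (g + n < 2 * g)%N by move=> ng; rewrite mul2n -addnn ltn_add2l.
(* [lower] values occupy the positions below [g], [upper] values those from [g] on. *)
pose t := (Ordinal (up i ig), Ordinal (up j jg), Ordinal (lo i ig), Ordinal (lo j jg)).
have nl n (ng : (n < g)%N) : kappa (Ordinal (lo n ng)) x = lower (nth 0 (ss x) n).
  by rewrite /kappa /= nth_cat size_map sg ng (nth_map 0) ?sg.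
have nu n (ng : (n < g)%N) : kappa (Ordinal (up n ng)) x = upper (nth 0 (ss x) n).
  by rewrite /kappa /= nth_cat size_map sg ltnNge leq_addr /= addKn (nth_map 0) ?sg.
have ij : i != j.
  by apply: contra_neq kl => E; rewrite -(nth_index 0 Pk) -(nth_index 0 Pl) -/i -/j E.
exists t => //; rewrite /C (H kappa kappaP _ _ _ _ _ x0 x Px0 Px).
  by rewrite /= !nl !nu !nth_index.
rewrite /t /= !inE -!val_eqE /= eqn_add2l !negb_or (negbTE ij) andbT /=.
by rewrite !(gtn_eqF (ltn_addr _ _)).
Qed.

(** [D] is only known to have the same set [K] of curvatures everywhere. Its finiteness comes from
    the inverse transformation, which maps [K] injectively into the curvatures of the preimage at
    one point. The cross ratios upstairs are then among those of quadruples from [K]. *)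
Lemma not_lie_equivalent (N : nat) (D : set 'rV[R]_N) (f zeta : 'rV[R]_N -> 'rV[R]_8) :
  @oriented_hypersurface R N 7 D f zeta -> isoparametric D f zeta ->
  ~ @lie_equivalent R 8 N 7 P idfun eta D f zeta.
Proof.
move=> Hf isoD [B [phi [[uB _] dphi BE]]].
have [x0 Px0] := exists_preimage.
have [sphi [psi [spsi P1 P2]]] := dphi.
have Dphi x : P x -> D (phi x) by move=> /P1[].
have dpsi : diffeomorphism D P psi.
  split; first exact: spsi.
  by exists phi; split; [exact: sphi|exact: P2|exact: P1].
have uB' : invmx B \in unitmx by rewrite unitmx_inv.
have BE' y : D y -> (legendre_lift f zeta y *m invmx B == legendre_lift idfun eta (psi y))%MS.
  move=> /P2[Py E]; have /andP[B1 B2] := BE _ Py; rewrite E in B1 B2; apply/andP; split.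
    by rewrite -[X in (_ <= X)%MS](mulmxK uB); exact: submxMr.
  by rewrite -[X in (X <= _)%MS](mulmxK uB); exact: submxMr.
pose K := principal_curvatures D f zeta (phi x0).
have finK : finite_set K.
  have [T [T1 T2 _]] := lie_moebius Hf HE uB' dpsi BE' (Dphi _ Px0).
  have -> : finite_set K = finite_set (T @` K) by rewrite (eq_finite_set (inj_card_eq T2)).
  have [Pq _] := P2 _ (Dphi _ Px0).
  apply: (@sub_finite_set _ _ (PCP (psi (phi x0)))); first by move=> _ [k Kk <-]; exact: T1.
  by apply/finite_setP; exists (2 * g)%N; exact: (proj2 hopf_preimage_proper_dupin).
pose C (t : R * R * R * R) := cross_ratio t.1.1.1 t.1.1.2 t.1.2 t.2.
apply: (@infinite_cross_ratios (C @` (K `*` K `*` K `*` K))).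
  by apply: finite_image; do 3!apply: finite_setX => //.
move=> x k l Px Pk Pl kl; have [T [T1 _ T3]] := lie_moebius HE Hf uB dphi BE Px.
have inK a : PCP x a -> K (T a) by move=> /T1; rewrite (isoD _ _ (Dphi _ Px) (Dphi _ Px0)).
have uk := curvature_upper Px Pk; have ul := curvature_upper Px Pl.
have lk := curvature_lower Px Pk; have ll := curvature_lower Px Pl.
exists (T (upper k), T (upper l), T (lower k), T (lower l)).
  by split; [split; [split|]|] => /=; exact: inK.
by rewrite /C /= T3//; [rewrite gt_eqF// lower_upper|rewrite lt_eqF// lower_upper].
Qed.

End Preimage.

Theorem corollary3p1 (R : realType) (M : set 'rV[R]_5)
    (xi : 'rV[R]_5 -> 'rV[R]_5) (g : nat)
    (hg : g = 2%N \/ g = 3%N)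
    (M_hypersurface : oriented_hypersurface M idfun xi)
    (M_compact : compact M)
    (M_connected : connected M)
    (M_dupin : proper_dupin M idfun xi g)
    (M_nonisoparametric : ~ isoparametric M idfun xi) :
  let P := hopf_preimage M in
  [/\ compact P, connected P,
      (exists eta : 'rV[R]_8 -> 'rV[R]_8, oriented_hypersurface P idfun eta) &
      forall eta : 'rV[R]_8 -> 'rV[R]_8, oriented_hypersurface P idfun eta ->
        [/\ proper_dupin P idfun eta (2 * g)%N,
            ~ constant_lie_curvatures P idfun eta (2 * g)%N &
            forall (N : nat) (D : set 'rV[R]_N) (f zeta : 'rV[R]_N -> 'rV[R]_8),
              oriented_hypersurface D f zeta -> isoparametric D f zeta ->
              ~ lie_equivalent P idfun eta D f zeta]].
Proof.
have cP := hopf_preimage_connected M_hypersurface M_compact M_connected.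
move=> P; split.
- exact: hopf_preimage_compact M_hypersurface M_compact.
- exact: cP.
- by exists (hopf_normal xi); exact: hopf_normal_hypersurface.
move=> eta HE.
(* Stated for any normal of [M] inducing [eta], so that it serves both signs. *)
have main (xi' : 'rV[R]_5 -> 'rV[R]_5) : oriented_hypersurface M idfun xi' ->
    proper_dupin M idfun xi' g -> ~ isoparametric M idfun xi' ->
    (forall x, P x -> eta x = hopf_normal xi' x) ->
    [/\ proper_dupin P idfun eta (2 * g)%N,
        ~ constant_lie_curvatures P idfun eta (2 * g)%N &
        forall (N : nat) (D : set 'rV[R]_N) (f zeta : 'rV[R]_N -> 'rV[R]_8),
          oriented_hypersurface D f zeta -> isoparametric D f zeta ->
          ~ lie_equivalent P idfun eta D f zeta].
  move=> HM HD niso etaE; split.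
  - exact (hopf_preimage_proper_dupin HM HD HE etaE).
  - exact (not_constant_lie_curvatures hg HM M_connected HD niso HE etaE).
  - exact (not_lie_equivalent hg HM M_connected HD niso HE etaE).
have HN := hopf_normal_hypersurface M_hypersurface.
have [E|E] := normal_unique cP HN HE; first exact: main E.
(* The opposite sign is absorbed by reversing [xi], as [hopf_normal] is linear in it; the hypotheses
   on [M] survive the reversal. *)
pose nxi m := - xi m.
have nE m : nxi m = - xi m by [].
apply: (main nxi).
- exact (opp_hypersurface M_hypersurface nE).
- exact (opp_proper_dupin M_hypersurface nE M_dupin).
- by move=> /(opp_isoparametric M_hypersurface nE).
- by move=> x Px; rewrite E// /hopf_normal /nxi -scaleN1r -cliffZl scaleN1r.
Qed.
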